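(* Let $K\subset\mathbb{R}^2$ be a convex body with $\mathrm{G}^\circ(K)>0$. Then $$\frac{\mathrm{w}(K)}{\mathrm{G}^\circ(K)^{1/2}}\le\frac{\mathrm{w}(3\Delta_2)}{\mathrm{G}^\circ(3\Delta_2)^{1/2}},$$ and equality holds if and only if $K$ is unimodularly equivalent to $3\Delta_2$.
   Context: A convex body in $\mathbb{R}^d$ is a non-empty compact convex subset of $\mathbb{R}^d$. $\mathrm{G}^\circ(K)$ denotes the number of points of $\mathbb{Z}^d$ in the interior of $K$. For $u\in\mathbb{R}^d\setminus\{0\}$, $\mathrm{w}(K,u)=\max_{x\in K}\langle u,x\rangle-\min_{x\in K}\langle u,x\rangle$; the lattice width of $K$ is $\mathrm{w}(K)=\inf_{u\in\mathbb{Z}^d\setminus\{0\}}\mathrm{w}(K,u)$. Two sets $A,B\subset\mathbb{R}^d$ are unimodularly equivalent if $A=g(B)$ for some map $g(x)=Ux+t$ with $U\in\mathrm{GL}_d(\mathbb{Z})$ and $t\in\mathbb{Z}^d$. $\Delta_2=\mathrm{conv}\{(0,0),(0,1),(1,0)\}$. *)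

(* Defs.v *)
From HB Require Import structures.
From mathcomp Require Import all_boot all_order all_algebra.
From mathcomp Require Import finmap.
From mathcomp Require Import all_classical all_reals all_analysis.

Set Implicit Arguments.
Unset Strict Implicit.
Unset Printing Implicit Defensive.

Import Order.TTheory GRing.Theory Num.Theory.
Import numFieldNormedType.Exports.

Local Open Scope classical_set_scope.
Local Open Scope ring_scope.

(* Points of R^d are row vectors 'rV[R]_d, with the library topology (that of
   the max norm, which is the Euclidean one); Z^d is embedded by [intv]. *)

Definition convex_body (R : realType) (d : nat) (K : set 'rV[R]_d) : Prop :=
  [/\ K !=set0, compact K & convex_set K].

Definition intv (R : realType) (d : nat) (z : 'rV[int]_d) : 'rV[R]_d :=
  map_mx intr z.

Definition dotp (R : realType) (d : nat) (u x : 'rV[R]_d) : R :=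
  \sum_(i < d) u 0 i * x 0 i.

(* The junk value is 0 when infinitely many lattice points are interior, which
   never happens for a bounded [K]. *)
Definition interior_count (R : realType) (d : nat) (K : set 'rV[R]_d) : nat :=
  #|` fset_set [set z : 'rV[int]_d | interior K (intv R z)] |%fset.

(* For a convex body, [sup] and [inf] are the maximum and minimum, attained by
   compactness. *)
Definition width_along (R : realType) (d : nat) (K : set 'rV[R]_d)
    (u : 'rV[R]_d) : R :=
  sup [set dotp u x | x in K] - inf [set dotp u x | x in K].

Definition lattice_width (R : realType) (d : nat) (K : set 'rV[R]_d) : R :=
  inf [set width_along K (intv R u) | u in [set u : 'rV[int]_d | u != 0]].

(* [x *m U^T] is [U x] for row vectors; [U \in unitmx] over [int] is
   invertibility over Z. *)
Definition unimodular_equiv (R : realType) (d : nat)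
    (A B : set 'rV[R]_d) : Prop :=
  exists (U : 'M[int]_d) (t : 'rV[int]_d),
    U \in unitmx /\
    A = [set x *m (map_mx intr U)^T + intv R t | x in B].

Definition conv_hull (R : realType) (d : nat) (A : set 'rV[R]_d) :
  set 'rV[R]_d := smallest [set B : set 'rV[R]_d | convex_set B] A.

Definition point2 (R : realType) (a b : R) : 'rV[R]_2 :=
  \row_(j < 2) [:: a; b]`_j.

Definition Delta2 (R : realType) : set 'rV[R]_2 :=
  conv_hull [set point2 0 0; point2 0 1; point2 1 0].
Arguments Delta2 R : clear implicits.

Definition dilate (R : realType) (d : nat) (a : R) (A : set 'rV[R]_d) :
  set 'rV[R]_d := [set a *: x | x in A].

(* Main.v *)
(** With w the lattice width and G the number of interior lattice points, one
    shows w^2 <= 9 G by induction on G: halving K at a class of Z^2 modulo 2 that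
    contains at most G/4 of the points divides w by 2. Equality would force the
    same on all four classes, and two halves of K differing by (1/2, 0) cannot
    both be copies of the triangle. The longest lattice chord has length at least
    3 w / 4 and, taken horizontal, forces lattice points on neighbouring lines;
    this gives G > 0 for w > 7/3 and G > 2 for w >= 21/5.

    If 0 is the only interior lattice point and w >= 3, then in a suitable basis
    the coordinates u1 = y, u2 = - x, u3 = x - y, which sum to 0, are at most 1 on
    K because of the supporting lines at the lattice points around 0. So K lies in
    a copy of the triangle, and its width forces equality. *)

Require Import Defs.
From mathcomp Require Import all_boot all_order all_algebra.
From mathcomp Require Import finmap.
From mathcomp Require Import all_classical all_reals all_analysis.
From mathcomp Require Import ring lra zify.

Set Implicit Arguments.
Unset Strict Implicit.
Unset Printing Implicit Defensive.

Import Order.TTheory GRing.Theory Num.Theory.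
Import numFieldNormedType.Exports.

Local Open Scope classical_set_scope.
Local Open Scope ring_scope.

(** * Triples of coordinates with sum zero *)

Section Algebra.
Variable R : realFieldType.
Implicit Types (M k t : R).

(** The bound [w <= 4/3 * L] for the longest lattice chord [L] is a planar transference theorem for
    the difference body: in the generic case three crossing conditions become bounds on sums of
    reciprocals, and adding them gives [12 / r <= 3 / (r - 1)] with [r = w / L].

    An empty parity class gives [w <= 14/3], and [(14/3)^2 < 27] disposes of every [G >= 3]. It does
    not dispose of [G = 2], where 18 is the target; hence the separate threshold [21/5], just below
    the square root of 18.

    For [G = 1] and [w >= 3] one has [L >= 9/4]. The obstacle is that the supporting lines at the
    lattice points around 0 may tilt, so no single line yields [u_i <= 1]. A rough bound
    [u_i <= 1 + 5/6] comes first from the chord. Then let [M] be the largest of the three excesses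
    of [max u_i] over 1. At a point with [u_i = 1 + M] the other two coordinates are either both
    negative (a window between two neighbouring lattice points) or not (a turn around one of them).
    Either way that point tilts a supporting line so far that the points with [u_j <= -2 + b_j],
    which exist by width 3, no longer fit. *)

Lemma le_lt_cases (x y : R) : x <= y \/ y < x.
Proof. by case: leP; [left|right]. Qed.

(** The point [(1 + M, p, q)] with [p < 0] tilts the line at [(1, 0, -1)] by [tau >= M / - p]. A
    point with [z <= -2 + b3] must fit under that line and under [y <= 1 + b2], which caps [tau] at
    [(b2 + b3) / (1 + b2)]. *)
Lemma window_half (M b2 b3 p tau x y z : R) :
  0 < M -> p < 0 -> b3 <= 5/6 -> M + tau * p <= 0 -> x + y + z = 0 ->
  z <= -2 + b3 -> x + tau * y <= 1 -> y <= 1 + b2 -> 0 <= y ->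
  [/\ tau < 1, 1 - b3 <= (1 - tau) * y & M * (1 + b2) <= - p * (b2 + b3)].
Proof.
move=> M0 p0 b3l tM s0 zl xl yl y0.
have h : 1 - b3 <= (1 - tau) * y by nra.
have y1 : 0 < y by rewrite lt_neqAle y0 andbT; apply/eqP => y00; move: h; rewrite -y00; lra.
have t1 : tau < 1 by nra.
split => //.
have h2 : tau * (1 + b2) <= b2 + b3 by nra.
nra.
Qed.

(** Adding the two half-window bounds gives [2 * M <= b2 + b3]. As [M] is the largest excess, every
    inequality used is an equality. *)
Lemma window_eq (M p q b2 b3 : R) :
  0 < M -> p + q = - 1 - M -> b2 <= M -> b3 <= M -> p < 0 -> q < 0 ->
  M * (1 + b2) <= - p * (b2 + b3) -> M * (1 + b3) <= - q * (b3 + b2) ->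
  [/\ b2 = M, b3 = M, - 2 * p = 1 + M & - 2 * q = 1 + M].
Proof.
move=> M0 pq l2 l3 p0 q0 h1 h2.
have s : 2 * M <= b2 + b3.
  have : M * (1 + b2) + M * (1 + b3) <= (1 + M) * (b2 + b3).
    have -> : (1 + M) * (b2 + b3) = - p * (b2 + b3) + - q * (b3 + b2).
      have -> : q = - 1 - M - p by lra.
      by ring.
    exact: lerD.
  by nra.
have e2 : b2 = M by lra.
have e3 : b3 = M by lra.
subst b2 b3.
have k1 : 1 + M <= - 2 * p by nra.
have k2 : 1 + M <= - 2 * q by nra.
split=> //; lra.
Qed.

(** Here [tau >= 2 * M / (1 + M)], so the lower bound on [(1 - tau) * y] already pushes [y] up to
    its maximum [1 + M]. *)
Lemma window_corner (M p tau x y z : R) :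
  0 < M -> M <= 5/6 -> - 2 * p = 1 + M -> M + tau * p <= 0 -> x + y + z = 0 ->
  z <= -2 + M -> x + tau * y <= 1 -> y <= 1 + M -> tau < 1 ->
  1 - M <= (1 - tau) * y -> x = 1 - 2 * M /\ y = 1 + M.
Proof.
move=> M0 Ml pE tM s0 zl xl yl t1 h.
have t2 : 2 * M <= tau * (1 + M) by nra.
have y1 : 1 + M <= y by nra.
have yE : y = 1 + M by lra.
subst y; split => //.
nra.
Qed.

(** The corner points tilt the lines at [(0, 1, -1)] and [(0, -1, 1)]. Adding these lines gives
    [- x <= 2 * (1 - 2 * M)], less than the required [2 - M]. *)
Lemma window_end (M s1 s2 x y z : R) :
  0 < M -> M <= 5/6 -> 0 <= 1 - 2 * M ->
  M + s1 * (1 - 2 * M) <= 0 -> M + s2 * (1 - 2 * M) <= 0 ->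
  x <= -2 + M -> x + y + z = 0 -> y + s1 * x <= 1 -> z + s2 * x <= 1 -> False.
Proof.
move=> M0 Ml Mh h1 h2 xl s0 k1 k2.
have k : - x * (1 - s1 - s2) <= 2 by lra.
have : - x * ((1 - s1 - s2) * (1 - 2 * M)) <= 2 * (1 - 2 * M) by nra.
have : 1 <= (1 - s1 - s2) * (1 - 2 * M) by lra.
nra.
Qed.

(** Both sides are affine in [t1], so the endpoints decide: [e0] is the case [t1 = 0], [h2] the case
    [t1 = t], and they are combined with weights [t - t1] and [t1]. *)
Lemma triangle_poly (t1 y t : R) : 0 <= t1 -> 0 <= y -> t1 <= t -> y <= t -> 0 < t -> t < 1 ->
  t1 * (1 - y) * (1 + t + y * t) < (2 * t + 2 * y * t - y) * (1 + y + t1 * y).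
Proof.
move=> t10 y0 t1t yt t0 tl.
have yt0 : 0 <= y * t by nra.
have c0 : 0 < 2 * t + 2 * y * t - y by nra.
have e0 : 0 < (2 * t + 2 * y * t - y) * (1 + y) by apply: mulr_gt0 => //; lra.
have h2 : t * (1 - y) * (1 + t + y * t) < (2 * t + 2 * y * t - y) * (1 + y + t * y).
  have d : 0 < (t - y) * (1 - (t - y)) + 3 * (y * t).
    have d0 : 0 <= (t - y) * (1 - (t - y)) by apply: mulr_ge0; lra.
    have [->|yp] : y = 0 \/ 0 < y by case: (ltrgtP y 0) => h; [lra|right|left].
      by nra.
    have : 0 < y * t by exact: mulr_gt0.
    lra.
  have : 0 <= y * (y * t) by exact: mulr_ge0.
  have : 0 <= t * (y * t) by apply: mulr_ge0 => //; exact: ltW.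
  have : 0 <= (y * t) * (y * t) by exact: mulr_ge0.
  lra.
have a : 0 <= t1 * ((2 * t + 2 * y * t - y) * (1 + y + t * y) - t * (1 - y) * (1 + t + y * t)).
  by apply: mulr_ge0 => //; rewrite subr_ge0 ltW.
have b : 0 <= (t - t1) * ((2 * t + 2 * y * t - y) * (1 + y)).
  by apply: mulr_ge0; [lra|exact: ltW].
rewrite -(ltr_pM2l t0).
have [l|e] : t1 < t \/ t1 = t by case: (ltrgtP t1 t) => h; [left|lra|right].
  have {}b : 0 < (t - t1) * ((2 * t + 2 * y * t - y) * (1 + y)).
    by apply: mulr_gt0; [lra|].
  lra.
subst t1; rewrite ltr_pM2l //.
Qed.

(** [A] and [C] bound the first coordinate by its values at two vertices of the triangle cut out by
    the three tilted lines: the maximum where the first two meet, the minimum where the last two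
    meet. With [t3] the largest slope the difference stays below 3, which is [triangle_poly] after
    clearing denominators. *)
Lemma triangle_alg (t1 t2 t3 b1 a1 a2 a3 c1 c2 c3 : R) :
  0 <= t1 -> 0 <= t2 -> t1 <= t3 -> t2 <= t3 -> 0 < t3 -> b1 <= 5/6 ->
  a1 + a2 + a3 = 0 -> c1 + c2 + c3 = 0 ->
  a1 <= 1 + t1 * a2 -> a2 <= 1 + t2 * a3 ->
  c2 <= 1 + t2 * c3 -> c3 <= 1 + t3 * c1 ->
  c1 <= -2 + b1 -> 3 <= a1 - c1 -> False.
Proof.
move=> t10 t20 t13 t23 t30 bl sa sc ha1 ha2 hc2 hc3 cl w.
have A : a1 * (1 + t2 + t1 * t2) <= 1 + t1 + t2.
  have : a2 * (1 + t2) <= 1 - t2 * a1 by nra.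
  nra.
have C : - c1 * (1 + t3 + t2 * t3) <= 2 + t2.
  have : 0 <= (1 + t2) * (1 + t3 * c1 - c3) by apply: mulr_ge0; lra.
  lra.
(* For [t3 >= 1], [C] gives [- c1 <= 1], against [- c1 >= 2 - 5/6]. *)
have l1 : t3 < 1.
  clear A ha1 ha2 hc2 hc3 w sa sc t10 t13 t23.
  rewrite ltNge; apply/negP => t31.
  have q : 0 <= (t3 - 1) * (1 + t2) by apply: mulr_ge0; lra.
  have q2 : 0 <= t2 * t3 by apply: mulr_ge0 => //; exact: ltW.
  have : 7/6 * (1 + t3 + t2 * t3) <= - c1 * (1 + t3 + t2 * t3) by rewrite ler_wpM2r; lra.
  lra.
have : (a1 - c1) * ((1 + t2 + t1 * t2) * (1 + t3 + t2 * t3)) <=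
  (1 + t1 + t2) * (1 + t3 + t2 * t3) + (2 + t2) * (1 + t2 + t1 * t2).
  have q1 : 0 <= t1 * t2 by exact: mulr_ge0.
  have q2 : 0 <= t2 * t3 by apply: mulr_ge0 => //; exact: ltW.
  have p1 : 0 <= 1 + t3 + t2 * t3 by lra.
  have p2 : 0 <= 1 + t2 + t1 * t2 by lra.
  have := ler_wpM2r p1 A; have := ler_wpM2r p2 C; lra.
have pos : 0 < (1 + t2 + t1 * t2) * (1 + t3 + t2 * t3).
  have q1 : 0 <= t1 * t2 by exact: mulr_ge0.
  have q2 : 0 <= t2 * t3 by apply: mulr_ge0 => //; exact: ltW.
  by apply: mulr_gt0; lra.
move=> h.
have := triangle_poly t10 t20 t13 t23 t30 l1.
have : 0 <= (a1 - c1 - 3) * ((1 + t2 + t1 * t2) * (1 + t3 + t2 * t3)).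
  by apply: mulr_ge0; [lra|exact: ltW].
lra.
Qed.

(** The tilt [t] pushes a point with very negative [y] towards large [z]. Since [z] is bounded as
    well, this is what caps [t] in all the turn cases. *)
Lemma turn_far (t b x y z : R) : 0 <= t -> y <= -2 + b -> x + y + z = 0 ->
  x <= 1 + t * y -> (1 + t) * (2 - b) <= 1 + z.
Proof. by move=> t0 yl s h; nra. Qed.

Lemma slope_ge (M t p r : R) : 0 <= t -> M <= t * p -> p <= r -> M <= t * r.
Proof. by move=> t0 h pr; nra. Qed.

Lemma turn_contra (M t b : R) : 0 < M -> M <= 5/6 -> b <= M -> M <= t ->
  (1 + t) * (2 - b) <= 2 -> False.
Proof.
move=> M0 Ml bM tM h.
have : (1 + M) * (2 - b) <= 2 by nra.
nra.
Qed.

Lemma turn_flat (M t b : R) : 0 < M -> b <= M -> M <= t ->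
  (1 + t) * 2 <= 2 + b -> False.
Proof. by move=> M0 bM tM h; lra. Qed.

Lemma turn_window (M t p s a b2 b3 : R) : 0 < M -> M <= 5/6 -> 0 < b2 -> b2 <= M -> b3 <= M ->
  0 <= t -> M <= t * p -> p + s * (1 + M) <= 1 -> 0 <= s -> - 1 - b2 <= a ->
  b2 + s * a <= 0 -> (1 + t) * (2 - b2) <= 2 + b3 -> False.
Proof.
move=> M0 Ml b20 b2M b3M t0 tp ps s0 al sa h.
have s1 : b2 <= s * (1 + b2) by nra.
have p1 : p * (1 + b2) <= 1 - b2 * M by nra.
have t1 : M * (1 + b2) <= t * (1 - b2 * M).
  have : 0 <= (t * p - M) * (1 + b2) by apply: mulr_ge0; lra.
  have : 0 <= t * (1 - b2 * M - p * (1 + b2)) by rewrite mulr_ge0 ?subr_ge0.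
  lra.
have b2M1 : 0 < 1 - b2 * M by nra.
have h1 : (1 - b2 * M + M * (1 + b2)) * (2 - b2) <= (2 + b3) * (1 - b2 * M) by nra.
have : 0 <= (M - b3) * (1 - b2 * M) by rewrite mulr_ge0 ?subr_ge0 // -subr_ge0 ltW.
have q : 0 < b2 * M by exact: mulr_gt0.
have : 0 < b2 * M * M by exact: mulr_gt0.
lra.
Qed.

(** The lines at [(0, 1, -1)] and [(0, -1, 1)] add up to [(2 - M) * (1 + b2 + b3) <= 2], so [b2] and
    [b3] are too small for the last bound on [t]. *)
Lemma turn_corner_mid (M t s r b2 b3 x y z : R) : 0 < M -> M <= 5/6 ->
  0 <= b2 -> b2 <= M -> 0 <= b3 -> b3 <= M -> M <= t -> b2 <= s -> b3 <= r ->
  (1 + t) * (2 - b2) <= 2 + b3 ->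
  x <= -2 + M -> x + y + z = 0 -> y <= 1 + s * x -> z <= 1 + r * x -> False.
Proof.
move=> M0 Ml b20 b2M b30 b3M tM sb rb h xl s0 yl zl.
have h1 : (2 - M) * (1 + b2 + b3) <= 2 by nra.
have h2 : (1 + M) * (2 - b2) <= 2 + b3 by nra.
nra.
Qed.

(** Here the line at [(1, 1, -2)] has slope [kp] and replaces the one at [(0, 1, -1)]. It caps [p]
    by [1 + kp * M], while the far point of the first coordinate forces [kp] itself to be small. *)
Lemma turn_corner_low (M t kp r b2 b3 p x y z : R) : 0 < M -> M <= 5/6 ->
  0 <= b2 -> 0 <= b3 -> b3 <= M -> 0 <= t -> 0 <= kp -> kp <= 1 -> b2 <= kp * M ->
  M <= t * p -> p <= 1 + kp * M -> b3 <= r ->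
  (1 + t) * (2 - b2) <= 2 + b3 ->
  x <= -2 + M -> x + y + z = 0 -> y <= 1 + kp * (x - 1) -> z <= 1 + r * x -> False.
Proof.
move=> M0 Ml b20 b30 b3M t0 k0 k1 b2k tp pl rb h xl s0 yl zl.
have h1 : (2 - M) * (1 + kp + b3) <= 2 - kp by nra.
have h2 : kp * (3 - M) + b3 * (2 - M) <= M by lra.
clear rb xl s0 yl zl h1.
pose k := kp * M.
have kE : k = kp * M by [].
have t1 : M <= t * (1 + k).
  have : 0 <= t * (1 + kp * M - p) by rewrite mulr_ge0 // subr_ge0.
  by rewrite kE; lra.
have k0' : 0 <= k by rewrite mulr_ge0 // ltW.
have q1 : 0 <= b3 * (5/6 - M) by rewrite mulr_ge0 // subr_ge0.
have q2 : 0 <= M * (5/6 - M) by rewrite mulr_ge0 ?subr_ge0 // ltW.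
have q3 : 0 <= k * (5/6 - M) by rewrite mulr_ge0 // subr_ge0.
have kM : k <= M by rewrite kE ger_pMl.
have h3 : (1 + k + M) * (2 - k) <= (2 + b3) * (1 + k).
  have t2 : 0 <= (1 + t) * (k - b2) by apply: mulr_ge0; lra.
  have : 0 <= (2 + b3 - (1 + t) * (2 - k)) * (1 + k) by apply: mulr_ge0; lra.
  have : 0 <= (t * (1 + k) - M) * (2 - k) by apply: mulr_ge0; lra.
  lra.
clear t1 tp pl h b2k b20 t0.
have M2 : 0 <= 2 - M by lra.
(* At [M = 5/6] one has [2 - M = 7/6] and [3 - M = 13/6]; these are the 7 here and the 13 below. *)
have b3b : b3 * 7 <= 6 * M.
  have : 0 <= kp * (3 - M) by apply: mulr_ge0; lra.
  lra.
have kb : k * 13 <= 5 * M.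
  have : 0 <= M * (M - kp * (3 - M) - b3 * (2 - M)) by apply: mulr_ge0; lra.
  have : 0 <= M * (b3 * (2 - M)) by rewrite !mulr_ge0 // ltW.
  by move: q2 q3; rewrite kE; clear; lra.
have kb2 : k <= 1/3 by lra.
have : 0 <= k * (1/3 - k) by rewrite mulr_ge0 // subr_ge0.
have : 0 <= M * (1/3 - k) by rewrite mulr_ge0 ?subr_ge0 // ltW.
have : 0 <= (6 * M - b3 * 7) * (1 + k) by rewrite mulr_ge0 ?subr_ge0 ?addr_ge0.
by move: h3 kb M0; clear; lra.
Qed.

Lemma turn_corner_out (M t kp b2 b3 p x y z : R) : 0 < M -> M <= 5/6 ->
  0 <= b2 -> 0 <= b3 -> b3 <= M -> 0 <= t -> 0 <= kp -> kp <= 1 -> b2 <= kp * M ->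
  M <= t * p -> p <= 1 + kp * M ->
  (1 + t) * (2 - b2) <= 2 ->
  x <= -2 + M -> x + y + z = 0 -> y <= 1 + kp * (x - 1) -> z <= 1 + b3 -> False.
Proof.
move=> M0 Ml b20 b30 b3M t0 k0 k1 b2k tp pl h xl s0 yl zl.
have h1 : (2 - M) * (1 + kp) <= 2 - kp + b3 by nra.
have h2 : kp * (3 - M) <= 2 * M by lra.
clear xl s0 yl zl h1.
pose k := kp * M.
have kE : k = kp * M by [].
have t1 : M <= t * (1 + k).
  have : 0 <= t * (1 + kp * M - p) by rewrite mulr_ge0 // subr_ge0.
  by rewrite kE; lra.
have k0' : 0 <= k by rewrite mulr_ge0 // ltW.
have kM : k <= M by rewrite kE ger_pMl.
have h3 : (1 + k + M) * (2 - k) <= 2 * (1 + k).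
  have t2 : 0 <= (1 + t) * (k - b2) by apply: mulr_ge0; lra.
  have : 0 <= (2 - (1 + t) * (2 - k)) * (1 + k) by apply: mulr_ge0; lra.
  have : 0 <= (t * (1 + k) - M) * (2 - k) by apply: mulr_ge0; lra.
  lra.
clear t1 tp pl h b2k b20 t0 b30 b3M.
have kb : k * 13 <= 10 * M.
  have : 0 <= M * (2 * M - kp * (3 - M)) by apply: mulr_ge0; lra.
  have : 0 <= M * (5/6 - M) by rewrite mulr_ge0 ?subr_ge0 // ltW.
  have : 0 <= k * (5/6 - M) by rewrite mulr_ge0 // subr_ge0.
  by rewrite kE; clear; lra.
(* [25/39] is [10/13 * 5/6], the bound on [k] from [kb] and [M <= 5/6]. *)
have : 0 <= (25/39 - k) * (k + M) by apply: mulr_ge0; lra.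
by move: h3 kb M0; clear; lra.
Qed.
End Algebra.

(** * Excesses of three functionals over the triangle *)

Section Frame.
Variable R : realFieldType.
Implicit Types T : R -> R -> R -> Prop.

(* For u1 = y, u2 = - x, u3 = x - y on a body whose only interior lattice point
   is 0, the first two functionals are supporting lines at the lattice points
   with (u_i, u_j) = (1, 0) and (1, 1). *)
Definition side T : Prop :=
  [/\ exists tau, forall a b c, T a b c -> a + tau * b <= 1,
      exists psi, forall a b c, T a b c -> psi * a + (1 - psi) * b <= 1,
      forall a b c, T a b c -> a <= 11/6,
      forall a b c, T a b c -> a <= - (7/6) -> 0 <= b &
      exists a b c a' b' c', [/\ T a b c, T a' b' c', 3 <= a - a' &
        forall x y z, T x y z -> x <= a]].

(** The first slot of [rot3 T] is the second coordinate of [T]; rotating twice brings the third one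
    to the front. *)
Definition rot3 T : R -> R -> R -> Prop := fun a b c => T c a b.
Definition swap3 T : R -> R -> R -> Prop := fun a b c => T a c b.

Definition frame T : Prop :=
  [/\ forall a b c, T a b c -> a + b + c = 0,
      side T /\ side (swap3 T),
      side (rot3 T) /\ side (swap3 (rot3 T)) &
      side (rot3 (rot3 T)) /\ side (swap3 (rot3 (rot3 T)))].

Lemma frame_rot T : frame T -> frame (rot3 T).
Proof.
move=> [s0 s1 s2 s3]; split=> // a b c /s0; lra.
Qed.

Lemma frame_swap T : frame T -> frame (swap3 T).
Proof.
by move=> [s0 [s1 s2] [s3 s4] [s5 s6]]; split=> // a b c /s0; lra.
Qed.

(** [b] is the positive part of the maximum of the first coordinate minus 1. The point at or below
    [-2 + b] is what width 3 then provides. *)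
Definition excess T (b : R) : Prop :=
  [/\ 0 <= b, b <= 5/6, forall x y z, T x y z -> x <= 1 + b,
      exists x y z, T x y z /\ x <= -2 + b &
      b = 0 \/ exists y z, T (1 + b) y z].

Lemma excess_ex T : side T -> exists b, excess T b.
Proof.
move=> [_ _ le _ [a [b [c [a' [b' [c' [Ta Ta' w mx]]]]]]]].
have [a1|a1] := leP a 1.
  exists 0; split; [lra|lra| |by exists a', b', c'; split=> //; lra|by left].
  by move=> x y z /mx; lra.
exists (a - 1); split.
- lra.
- by have := le _ _ _ Ta; lra.
- by move=> x y z /mx; lra.
- by exists a', b', c'; split=> //; lra.
- by right; exists b, c; rewrite (_ : 1 + (a - 1) = a) //; lra.
Qed.

(** Both other coordinates of the extremal point are negative, so the two lines at [(1, 0, -1)] and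
    [(1, -1, 0)] both tilt. Each gives one half-window bound; the resulting equality case fixes two
    corners, and [window_end] rules these out. *)
Lemma excess_window T M b2 b3 p q : frame T -> excess T M ->
  excess (rot3 T) b2 -> excess (rot3 (rot3 T)) b3 -> 0 < M -> b2 <= M -> b3 <= M ->
  T (1 + M) p q -> p < 0 -> q < 0 -> False.
Proof.
move=> [s0 [s1 s1'] [s2 s2'] [s3 s3']].
move=> [_ M56 _ [x1 [y1 [z1 [B1 x1l]]]] _].
move=> [b20 _ le2 [y2 [z2 [x2 [B2 y2l]]]] _].
move=> [b30 _ le3 [z3 [x3 [y3 [B3 z3l]]]] _].
rewrite /rot3 in B2 le2 B3 le3 => M0 b2M b3M TA p0 q0.
case: s1 => [[ta f12] _ _ _ _]; case: s1' => [[tb f13] _ _ _ _].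
case: s2' => [[tc f21] _ _ _ _]; case: (s3) => [[td f31] _ _ _ _].
case: (s2) => [_ _ _ tame2 _]; case: s3' => [_ _ _ tame3 _].
have {}f21 x y z : T x y z -> y + tc * x <= 1 by move=> h; apply: (f21 _ _ z).
have {}f31 x y z : T x y z -> z + td * x <= 1 by move=> h; apply: (f31 _ _ y).
have {}f13 x y z : T x y z -> x + tb * z <= 1 by move=> h; apply: (f13 _ _ y).
have sA := s0 _ _ _ TA; have sB3 := s0 _ _ _ B3; have sB2 := s0 _ _ _ B2.
have hA2 : M + ta * p <= 0 by have := f12 _ _ _ TA; lra.
have hA3 : M + tb * q <= 0 by have := f13 _ _ _ TA; lra.
(* The sign clause of [side] applies because [-2 + b3 <= -2 + 5/6 = -7/6]. *)
have y30 : 0 <= y3 by apply: (tame3 z3 y3 x3 B3); move: z3l b3M M56; clear; lra.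
have z20 : 0 <= z2 by apply: (tame2 y2 z2 x2 B2); move: y2l b2M M56; clear; lra.
have b35 : b3 <= 5/6 by exact: le_trans M56.
have b25 : b2 <= 5/6 by exact: le_trans M56.
have [t1 h1 k1] := window_half M0 p0 b35 hA2 sB3 z3l (f12 _ _ _ B3) (le2 _ _ _ B3) y30.
have sB2' : x2 + z2 + y2 = 0 by move: sB2; clear; lra.
have [t2 h2 k2] := window_half M0 q0 b25 hA3 sB2' y2l (f13 _ _ _ B2) (le3 _ _ _ B2) z20.
have pq : p + q = - 1 - M by move: sA; clear; lra.
have [e2 e3 ep eq] := window_eq M0 pq b2M b3M p0 q0 k1 k2; subst b2 b3.
have [ex3 ey3] := window_corner M0 M56 ep hA2 sB3 z3l (f12 _ _ _ B3) (le2 _ _ _ B3) t1 h1.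
have [ex2 ez2] := window_corner M0 M56 eq hA3 sB2' y2l (f13 _ _ _ B2) (le3 _ _ _ B2) t2 h2.
case: s3 => [_ _ _ tame31 _].
have x30 : 0 <= x3 by apply: (tame31 z3 x3 y3 B3); move: z3l M56; clear; lra.
have m1 : 0 <= 1 - 2 * M by rewrite -ex3.
apply: (window_end (s1 := tc) (s2 := td) M0 M56 m1 _ _ x1l (s0 _ _ _ B1) (f21 _ _ _ B1) (f31 _ _ _ B1)).
  by move: (f21 _ _ _ B3); rewrite ex3 ey3; clear; lra.
by move: (f31 _ _ _ B2); rewrite ex2 ez2; clear; lra.
Qed.

Lemma triangle_last T t1 t2 t3 : frame T -> 0 <= t1 -> 0 <= t2 -> 0 < t3 ->
  t1 <= t3 -> t2 <= t3 ->
  (forall x y z, T x y z -> x <= 1 + t1 * y) ->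
  (forall x y z, T x y z -> y <= 1 + t2 * z) ->
  (forall x y z, T x y z -> z <= 1 + t3 * x) -> False.
Proof.
move=> [s0 [s1 _] _ _] t10 t20 t30 t13 t23 h1 h2 h3.
case: s1 => _ _ le _ [a1 [a2 [a3 [c1 [c2 [c3 [TA TC w _]]]]]]].
have le1 := le _ _ _ TA.
apply: (triangle_alg (b1 := 5/6) t10 t20 t13 t23 t30 _ (s0 _ _ _ TA) (s0 _ _ _ TC)
  (h1 _ _ _ TA) (h2 _ _ _ TA) (h2 _ _ _ TC) (h3 _ _ _ TC) _ w); lra.
Qed.

(** The hypotheses are invariant under rotation, so the largest slope can be brought to the last
    place. *)
Lemma triangle_no T t1 t2 t3 : frame T -> 0 < t1 -> 0 < t2 -> 0 < t3 ->
  (forall x y z, T x y z -> x <= 1 + t1 * y) ->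
  (forall x y z, T x y z -> y <= 1 + t2 * z) ->
  (forall x y z, T x y z -> z <= 1 + t3 * x) -> False.
Proof.
move=> F t10 t20 t30 h1 h2 h3.
have F1 := frame_rot F; have F2 := frame_rot F1.
have l1 := ltW t10; have l2 := ltW t20; have l3 := ltW t30.
have [a|a] := leP t1 t3; have [b|b] := leP t2 t3.
- exact: (triangle_last F l1 l2 t30 a b h1 h2 h3).
- apply: (triangle_last F2 l3 l1 t20 _ _ _ _ _); [lra|lra| | |].
  + by move=> x y z; rewrite /rot3 => /h3.
  + by move=> x y z; rewrite /rot3 => /h1.
  + by move=> x y z; rewrite /rot3 => /h2.
- apply: (triangle_last F1 l2 l3 t10 _ _ _ _ _); [lra|lra| | |].
  + by move=> x y z; rewrite /rot3 => /h2.
  + by move=> x y z; rewrite /rot3 => /h3.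
  + by move=> x y z; rewrite /rot3 => /h1.
- have [c|c] := leP t1 t2.
    apply: (triangle_last F2 l3 l1 t20 _ _ _ _ _); [lra|lra| | |].
    + by move=> x y z; rewrite /rot3 => /h3.
    + by move=> x y z; rewrite /rot3 => /h1.
    + by move=> x y z; rewrite /rot3 => /h2.
  apply: (triangle_last F1 l2 l3 t10 _ _ _ _ _); [lra|lra| | |].
  + by move=> x y z; rewrite /rot3 => /h2.
  + by move=> x y z; rewrite /rot3 => /h3.
  + by move=> x y z; rewrite /rot3 => /h1.
Qed.

(** The extremal point tilts the line at [(1, 0, -1)] to [x <= 1 + t * y] with [t * p >= M]. The
    extremal point [(a, 1 + b2, c)] of the second coordinate decides the case. If [c >= 0], the turn
    continues cyclically. If [a] and [c] are negative, there is a window. If [a > 0], both extremal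
    points lie around [(1, 1, -2)], and the slope of the line there separates the subcases. *)
Lemma excess_turn T M b2 b3 p q : frame T -> excess T M ->
  excess (rot3 T) b2 -> excess (rot3 (rot3 T)) b3 -> 0 < M -> b2 <= M -> b3 <= M ->
  T (1 + M) p q -> 0 <= p -> False.
Proof.
move=> F; case: (F) => [s0 [s1 s1'] [s2 s2'] [s3 s3']].
move=> [_ M56 le1 [x1 [y1 [z1 [B1 x1l]]]] _].
move=> [b20 _ le2 [y2 [z2 [x2 [B2 y2l]]]] at2].
move=> [b30 _ le3 _ at3].
rewrite /rot3 in B2 le2 le3 at2 at3 => M0 b2M b3M TA p0.
case: s1 => [[ta f12] [psi v12] _ _ _].
case: (s2) => [[te f23] _ _ _ _].
case: s2' => [[tc f21] _ _ tame21 _]; case: (s3) => [[td f31] _ _ _ _].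
have {}f21 x y z : T x y z -> y + tc * x <= 1 by move=> h; apply: (f21 _ _ z).
have {}f31 x y z : T x y z -> z + td * x <= 1 by move=> h; apply: (f31 _ _ y).
have {}f23 x y z : T x y z -> y + te * z <= 1 by move=> h; apply: (f23 _ _ x).
have {}le2 x y z : T x y z -> y <= 1 + b2 by exact: le2.
have {}le3 x y z : T x y z -> z <= 1 + b3 by exact: le3.
have sA := s0 _ _ _ TA; have sB1 := s0 _ _ _ B1; have sB2 := s0 _ _ _ B2.
have hA := f12 _ _ _ TA.
have pp : 0 < p.
  rewrite lt_neqAle p0 andbT; apply/eqP => e; rewrite -e in hA.
  by move: hA M0; clear; lra.
pose t := - ta.
have tp : M <= t * p by rewrite /t; lra.
have t0 : 0 < t by rewrite -(pmulr_lgt0 _ pp); lra.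
have t0' := ltW t0.
have {}f12 x y z : T x y z -> x <= 1 + t * y by move=> /f12; rewrite /t; lra.
have far := turn_far t0' y2l sB2 (f12 _ _ _ B2).
have x20 : 0 <= x2 by apply: (tame21 y2 x2 z2 B2); lra.
(* The third coordinate is either harmless at the far point [(x2, y2, z2)] or has its own line of
   positive slope. When its extremal point has [a < 0], then [td >= 0], and [x2 >= 0] gives
   [z2 <= 1]. *)
have sd3 : z2 <= 1 \/ exists r, [/\ 0 < r, b3 <= r & forall x y z, T x y z -> z <= 1 + r * x].
  case: at3 => [e|[a [b A3]]]; first by left; have := le3 _ _ _ B2; lra.
  have h := f31 _ _ _ A3; have s := s0 _ _ _ A3.
  have [b3e|b3p] := le_lt_cases b3 0; first by left; move: (le3 _ _ _ B2) b3e; clear; lra.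
  have [a0|a0] := le_lt_cases 0 a; last first.
    left; have td0 : 0 <= td.
      by rewrite leNgt; apply/negP => h0; move: h a0 h0 b3p; clear; nra.
    by move: (f31 _ _ _ B2) td0 x20; clear; nra.
  right; exists (- td).
  have ap : 0 < a.
    rewrite lt_neqAle a0 andbT; apply/eqP => e; rewrite -e in h.
    by move: h b3p; clear; lra.
  have r0 : 0 < - td by rewrite -(pmulr_lgt0 _ ap); move: h b3p; clear; lra.
  have a1 : a <= 1 by move: s b30 ap t0' (f12 _ _ _ A3); clear; nra.
  split=> //; first by move: h b3p a1 ap r0; clear; nra.
  by move=> x y z /f31; clear; lra.
have tM (p1 : p <= 1) : M <= t by move: (slope_ge t0' tp p1); clear; lra.
have far3 : (1 + t) * (2 - b2) <= 2 + b3 by move: far (le3 _ _ _ B2); clear; lra.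
have [b2e|b2p] := le_lt_cases b2 0.
  have b2E : b2 = 0 by apply/le_anti; rewrite b2e.
  rewrite b2E subr0 in far3.
  apply: (turn_flat M0 b3M _ far3); apply: tM.
  by move: (le2 _ _ _ TA) b2E; clear; lra.
case: at2 => [|[c [a A2]]]; first by move: b2p; clear; lra.
have sA2 := s0 _ _ _ A2.
have out (p1 : p <= 1) (zz : z2 <= 1) : False.
  by apply: (turn_contra M0 M56 b2M (tM p1)); move: far zz; clear; lra.
have [c0|c0] := le_lt_cases 0 c.
  have h := f23 _ _ _ A2.
  have cp : 0 < c.
    rewrite lt_neqAle c0 andbT; apply/eqP => e; rewrite -e in h.
    by move: h b2p; clear; lra.
  have s_0 : 0 < - te by rewrite -(pmulr_lgt0 _ cp); move: h b2p; clear; lra.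
  (* The line with [te < 0] is applied to the first extremal point, whose last coordinate
     [q = - 1 - M - p] is negative. *)
  have p1 : p <= 1 by move: (f23 _ _ _ TA) sA M0 pp s_0; clear; nra.
  case: sd3 => [zz|[r [r0 _ fr]]]; first exact: out.
  by apply: (triangle_no F t0 s_0 r0 f12 _ fr) => x y z /f23; clear; lra.
have hA2 := f21 _ _ _ A2.
have [a0|a0] := le_lt_cases 0 a; last first.
  have tc0 : 0 <= tc.
    by rewrite leNgt; apply/negP => h0; move: hA2 a0 h0 b2p; clear; nra.
  have pl : p + tc * (1 + M) <= 1 by exact: (f21 _ _ _ TA).
  have al : - 1 - b2 <= a by move: sA2 c0; clear; lra.
  have sa : b2 + tc * a <= 0 by move: hA2; clear; lra.
  exact: (turn_window M0 M56 b2p b2M b3M t0' tp pl tc0 al sa far3).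
have ap : 0 < a.
  rewrite lt_neqAle a0 andbT; apply/eqP => e; rewrite -e in hA2.
  by move: hA2 b2p; clear; lra.
have [s sE] : exists s, tc = - s by exists (- tc); rewrite opprK.
have sa : b2 <= s * a by move: hA2; rewrite sE; clear; lra.
have s_0 : 0 < s by rewrite -(pmulr_lgt0 _ ap); move: sa b2p; clear; lra.
have {}f21 x y z : T x y z -> y <= 1 + s * x by move=> /f21; rewrite sE; clear; lra.
have vA := v12 _ _ _ TA; have vA2 := v12 _ _ _ A2.
have [ps0|ps0] := le_lt_cases 0 psi; last first.
  have d0 : 0 < 1 - psi by move: ps0; clear; lra.
  (* [kp] is the slope of the line at [(1, 1, -2)] solved for [y]; it lies between 0 and 1 because
     [psi < 0]. *)
  have [kp kpE] : exists kp, kp * (1 - psi) = - psi.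
    by exists (- psi / (1 - psi)); rewrite mulfVK // gt_eqF.
  have k0 : 0 <= kp by rewrite -(pmulr_lge0 _ d0) kpE; move: ps0; clear; lra.
  have k1 : kp <= 1 by rewrite -(ler_pM2r d0) kpE; clear; lra.
  have fk x y z : T x y z -> y <= 1 + kp * (x - 1).
    move=> /v12 h; rewrite -(ler_pM2r d0).
    have -> : (1 + kp * (x - 1)) * (1 - psi) = (1 - psi) + kp * (1 - psi) * (x - 1) by ring.
    by rewrite kpE; move: h; clear; lra.
  have pk : p <= 1 + kp * M by move: (fk _ _ _ TA); clear; lra.
  have bk : b2 <= kp * M.
    by move: (fk _ _ _ A2) (le1 _ _ _ A2) k0; clear; nra.
  case: sd3 => [zz|[r [r0 br fr]]].
    have h : (1 + t) * (2 - b2) <= 2 by move: far zz; clear; lra.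
    exact: (turn_corner_out M0 M56 b20 b30 b3M t0' k0 k1 bk tp pk h x1l sB1 (fk _ _ _ B1) (le3 _ _ _ B1)).
  exact: (turn_corner_low M0 M56 b20 b30 b3M t0' k0 k1 bk tp pk br far3 x1l sB1 (fk _ _ _ B1) (fr _ _ _ B1)).
have psip : 0 < psi.
  rewrite lt_neqAle ps0 andbT; apply/eqP => e; rewrite -e in vA2.
  by move: vA2 b2p; clear; lra.
have [ps1|ps1] := le_lt_cases 1 psi.
  (* Since [p <= 1 + M], the left side of [vA] would be at least [1 + M]. *)
  by move: (le2 _ _ _ TA) vA M0 b2M M56 ps1; clear; nra.
have p1 : p <= 1 by move: vA ps1 psip M0; clear; nra.
have a1 : a <= 1 by move: vA2 ps1 psip b2p; clear; nra.
case: sd3 => [zz|[r [r0 br fr]]]; first exact: out.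
have bs : b2 <= s by move: (slope_ge (ltW s_0) sa a1); clear; lra.
exact: (turn_corner_mid M0 M56 b20 b2M b30 b3M (tM p1) bs br far3 x1l sB1 (f21 _ _ _ B1) (fr _ _ _ B1)).
Qed.

(** The signs of the two remaining coordinates at the extremal point choose between window and turn;
    a turn towards the third coordinate is the mirror image under [swap3]. *)
Lemma excess_max T M b2 b3 : frame T -> excess T M ->
  excess (rot3 T) b2 -> excess (rot3 (rot3 T)) b3 -> b2 <= M -> b3 <= M -> M = 0.
Proof.
move=> F E1 E2 E3 l2 l3.
have [//|[p [q TA]]] : M = 0 \/ exists y z, T (1 + M) y z by case: E1.
have [M0|M0] := leP M 0; first by case: E1; lra.
have [p0|p0] := leP 0 p; first by case: (excess_turn F E1 E2 E3 M0 l2 l3 TA p0).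
have [q0|q0] := leP 0 q; last by case: (excess_window F E1 E2 E3 M0 l2 l3 TA p0 q0).
have sw (S : R -> R -> R -> Prop) b : excess S b -> excess (swap3 S) b.
  move=> [a1 a2 a3 [x [y [z [a4 a5]]]] a6]; split=> //.
  - by move=> u v w /a3.
  - by exists x, z, y.
  - by case: a6 => [|[u [v h]]]; [left|right; exists v, u].
exfalso; apply: (excess_turn (M := M) (b2 := b3) (b3 := b2) (frame_swap F) _ _ _ M0 l3 l2 TA q0).
- exact: sw.
- exact (sw (rot3 (rot3 T)) b3 E3).
- exact (sw (rot3 T) b2 E2).
Qed.

Lemma frame_le T : frame T -> forall a b c, T a b c -> [/\ a <= 1, b <= 1 & c <= 1].
Proof.
move=> F a b c Tabc; case: (F) => _ [s1 _] [s2 _] [s3 _].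
have F1 := frame_rot F; have F2 := frame_rot F1.
have [m1 E1] := excess_ex s1; have [m2 E2] := excess_ex s2; have [m3 E3] := excess_ex s3.
have m0 : [/\ m1 <= 0, m2 <= 0 & m3 <= 0].
  have [h12|h12] := leP m2 m1; have [h13|h13] := leP m3 m1.
  - by have := excess_max F E1 E2 E3 h12 h13; split; lra.
  - have := excess_max F2 E3 E1 E2 (ltW h13) _; case: E1 => ? _ _ _ _.
    by move=> h; have := h ltac:(lra); split; lra.
  - have := excess_max F1 E2 E3 E1 _ (ltW h12); case: E1 => ? _ _ _ _.
    by move=> h; have := h ltac:(lra); split; lra.
  - have [h23|h23] := leP m3 m2.
      have := excess_max F1 E2 E3 E1 h23 (ltW h12); case: E1 => ? _ _ _ _.
      by split; lra.
    have := excess_max F2 E3 E1 E2 (ltW h13) (ltW h23); case: E1 => ? _ _ _ _.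
    by split; lra.
case: m0 => m10 m20 m30.
case: E1 => _ _ e1 _ _; case: E2 => _ _ e2 _ _; case: E3 => _ _ e3 _ _.
have := e1 _ _ _ Tabc; have := e2 _ _ _ Tabc; have := e3 _ _ _ Tabc.
by split; lra.
Qed.
End Frame.

(** * Planar convex sets and affine pullbacks *)

Section Plane.
Variable R : realType.
Implicit Types S : R -> R -> Prop.

Definition pconvex S := forall x1 y1 x2 y2 t, S x1 y1 -> S x2 y2 ->
  0 <= t -> t <= 1 -> S ((1 - t) * x1 + t * x2) ((1 - t) * y1 + t * y2).

Definition inner S x y := exists2 e, 0 < e &
  forall x' y', `|x' - x| <= e -> `|y' - y| <= e -> S x' y'.

(* The two attainment clauses are the consequences of compactness in use. *)
Definition pbody S := [/\ pconvex S, exists x y, inner S x y,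
  forall a b, exists x y, S x y /\
    forall x' y', S x' y' -> a * x' + b * y' <= a * x + b * y &
  forall a b, a != 0 \/ b != 0 -> exists x y l,
    [/\ S x y, S (x + l * a) (y + l * b) &
      forall x' y' m, S x' y' -> S (x' + m * a) (y' + m * b) -> m <= l]].

(** The homothety of ratio [1 - t] centred at [(x, y)] carries a square around the inner point to a
    square around the new one. *)
Lemma inner_segment S o1 o2 x y t : pconvex S -> inner S o1 o2 -> S x y ->
  0 <= t -> t < 1 -> inner S ((1 - t) * o1 + t * x) ((1 - t) * o2 + t * y).
Proof.
move=> cS [e e0 he] Sxy t0 t1.
have u0 : 0 < 1 - t by lra.
exists ((1 - t) * e); first exact: mulr_gt0.
move=> x' y' hx hy.
have ex : x' = (1 - t) * ((x' - t * x) / (1 - t)) + t * x.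
  by rewrite mulrC divfK ?gt_eqF //; lra.
have ey : y' = (1 - t) * ((y' - t * y) / (1 - t)) + t * y.
  by rewrite mulrC divfK ?gt_eqF //; lra.
rewrite ex ey; apply: cS => //; last exact: ltW.
have k (v w z : R) : `|z - ((1 - t) * v + t * w)| <= (1 - t) * e ->
    `|(z - t * w) / (1 - t) - v| <= e.
  move=> h; rewrite -(ler_pM2l u0) -{1}(gtr0_norm u0) -normrM.
  by rewrite mulrBr mulrCA divff ?gt_eqF // mulr1 (_ : z - t * w - (1 - t) * v = z - ((1 - t) * v + t * w)) //; ring.
by apply: he; apply: k.
Qed.

Definition supp S x y := exists a b, (a != 0 \/ b != 0) /\
  forall x' y', S x' y' -> a * x' + b * y' <= a * x + b * y.

(* In coordinates (s, t) along and across the direction from the point z to an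
   inner point, S meets no point with t = 0, s < 0; separating the slopes s / t
   of the two sides t > 0 and t < 0 by a real number gives the line. *)
Lemma supp_not_inner S o1 o2 z1 z2 : pconvex S -> inner S o1 o2 ->
  ~ inner S z1 z2 -> supp S z1 z2.
Proof.
move=> cS Io nIz.
pose d1 := o1 - z1; pose d2 := o2 - z2.
pose s x y : R := (x - z1) * d1 + (y - z2) * d2.
pose t x y : R := (y - z2) * d1 - (x - z1) * d2.
have d0 : 0 < d1 ^+ 2 + d2 ^+ 2.
  rewrite lt_neqAle addr_ge0 ?sqr_ge0 // andbT eq_sym; apply/negP.
  rewrite paddr_eq0 ?sqr_ge0 // !sqrf_eq0 => /andP[/eqP e1 /eqP e2].
  apply: nIz; suff [<- <-] : o1 = z1 /\ o2 = z2 by [].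
  by split; apply/eqP; rewrite -subr_eq0; apply/eqP.
have axis x y : S x y -> t x y = 0 -> 0 <= s x y.
  move=> Sxy txy; rewrite leNgt; apply/negP => sxy; apply: nIz.
  pose D := d1 ^+ 2 + d2 ^+ 2.
  pose r := D / (D - s x y).
  have E0 : 0 < D - s x y by rewrite subr_gt0 (lt_trans sxy).
  have r0 : 0 <= r by rewrite divr_ge0 ?ltW.
  have r1 : r < 1 by rewrite ltr_pdivrMr // mul1r ltrBrDr gtrDl.
  have k1 : (x - z1) * D = s x y * d1.
    have -> : (x - z1) * D = s x y * d1 - t x y * d2 by rewrite /s /t /D; ring.
    by rewrite txy mul0r subr0.
  have k2 : (y - z2) * D = s x y * d2.
    have -> : (y - z2) * D = s x y * d2 + t x y * d1 by rewrite /s /t /D; ring.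
    by rewrite txy mul0r addr0.
  have rE : r * (D - s x y) = D by rewrite /r divfK ?gt_eqF.
  have u : (1 - r) * D = - r * s x y by lra.
  have Dn : D != 0 by rewrite gt_eqF.
  suff [-> ->] : z1 = (1 - r) * o1 + r * x /\ z2 = (1 - r) * o2 + r * y
    by exact: inner_segment.
  split; apply/eqP; rewrite -subr_eq0 -(mulIr_eq0 _ (mulIf Dn)); apply/eqP.
    have -> : (z1 - ((1 - r) * o1 + r * x)) * D =
      - ((1 - r) * D * d1 + r * ((x - z1) * D)) by rewrite /d1; ring.
    by rewrite u k1; ring.
  have -> : (z2 - ((1 - r) * o2 + r * y)) * D =
    - ((1 - r) * D * d2 + r * ((y - z2) * D)) by rewrite /d2; ring.
  by rewrite u k2; ring.
have cross x y x' y' : S x y -> S x' y' -> 0 < t x y -> t x' y' < 0 ->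
    0 <= s x' y' * t x y - s x y * t x' y'.
  move=> S1 S2 t1 t2.
  pose l := t x y / (t x y - t x' y').
  have E0 : 0 < t x y - t x' y' by lra.
  have l0 : 0 <= l by rewrite divr_ge0 // ltW.
  have l1 : l <= 1 by rewrite ler_pdivrMr // mul1r; lra.
  have := axis _ _ (cS _ _ _ _ _ S1 S2 l0 l1).
  have lE : l * (t x y - t x' y') = t x y by rewrite /l divfK ?gt_eqF.
  have -> : t ((1 - l) * x + l * x') ((1 - l) * y + l * y') =
    t x y - l * (t x y - t x' y') by rewrite /t; ring.
  rewrite lE subrr => /(_ erefl) h.
  have -> : s x' y' * t x y - s x y * t x' y' =
    (t x y - t x' y') * s ((1 - l) * x + l * x') ((1 - l) * y + l * y').
    have -> : s ((1 - l) * x + l * x') ((1 - l) * y + l * y') =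
      s x y + l * (s x' y' - s x y) by rewrite /s; ring.
    transitivity ((t x y - t x' y') * s x y + l * (t x y - t x' y') * (s x' y' - s x y)).
      by rewrite lE; ring.
    by ring.
  by apply: mulr_ge0 => //; exact: ltW.
case: (Io) => e e0 he.
pose q := e / (`|d1| + `|d2| + 1).
have q0 : 0 < q by rewrite divr_gt0 // ltr_wpDl ?addr_ge0.
have qE : q * (`|d1| + `|d2| + 1) = e by rewrite /q divfK // gt_eqF // ltr_wpDl ?addr_ge0.
have qd (v : R) : `|v| <= `|d1| + `|d2| + 1 -> `|q * v| <= e.
  by move=> h; rewrite normrM gtr0_norm // -qE ler_pM2l.
have nd1 : `|d1| <= `|d1| + `|d2| + 1 by rewrite -addrA lerDl addr_ge0.
have nd2 : `|d2| <= `|d1| + `|d2| + 1 by rewrite addrAC lerDr addr_ge0.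
have [a1 [a2 [Sa ta]]] : exists a1 a2, S a1 a2 /\ 0 < t a1 a2.
  exists (o1 - q * d2), (o2 + q * d1); split.
    by apply: he; [rewrite addrAC subrr add0r normrN|rewrite addrAC subrr add0r]; exact: qd.
  have -> : t (o1 - q * d2) (o2 + q * d1) = q * (d1 ^+ 2 + d2 ^+ 2) by rewrite /t /d1 /d2; ring.
  exact: mulr_gt0.
have [b1 [b2 [Sb tb]]] : exists b1 b2, S b1 b2 /\ t b1 b2 < 0.
  exists (o1 + q * d2), (o2 - q * d1); split.
    by apply: he; [rewrite addrAC subrr add0r|rewrite addrAC subrr add0r normrN]; exact: qd.
  have -> : t (o1 + q * d2) (o2 - q * d1) = - (q * (d1 ^+ 2 + d2 ^+ 2)) by rewrite /t /d1 /d2; ring.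
  by rewrite oppr_lt0; exact: mulr_gt0.
pose U : set R := [set k | exists x y, [/\ S x y, 0 < t x y & k = - (s x y / t x y)]]%classic.
have lb x y x' y' : S x y -> S x' y' -> 0 < t x y -> t x' y' < 0 ->
    - (s x y / t x y) <= - (s x' y' / t x' y').
  move=> S1 S2 t1 t2; have h := cross _ _ _ _ S1 S2 t1 t2.
  rewrite lerN2 -(ler_nM2r t2) divfK ?lt_eqF // -(ler_pM2r t1) mulrAC divfK ?gt_eqF //.
  by rewrite -subr_ge0; move: h; clear; lra.
have hU : has_sup U.
  split; first by exists (- (s a1 a2 / t a1 a2)), a1, a2.
  by exists (- (s b1 b2 / t b1 b2)) => k [x [y [Sxy txy ->]]]; exact: lb.
pose k := sup U.
exists (- (d1 - k * d2)), (- (d2 + k * d1)); split.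
  have [e1|] := eqVneq (d1 - k * d2) 0; last by left; rewrite oppr_eq0.
  right; rewrite oppr_eq0; apply/eqP => e2.
  have : d1 ^+ 2 + d2 ^+ 2 = d1 * (d1 - k * d2) + d2 * (d2 + k * d1) by ring.
  by rewrite e1 e2 !mulr0 addr0 => e3; rewrite e3 ltxx in d0.
move=> x y Sxy.
suff : 0 <= s x y + k * t x y by rewrite /s /t; clear; lra.
have [tn|tp|t0] := ltrgtP (t x y) 0.
- have : k <= - (s x y / t x y).
    by apply: ge_sup; [case: hU|move=> _ [x' [y' [S' t' ->]]]; exact: lb].
  by rewrite -(ler_nM2r tn) mulNr divfK ?lt_eqF //; clear; lra.
- have : - (s x y / t x y) <= k by apply: ub_le_sup; [case: hU|exists x, y].
  by rewrite -(ler_pM2r tp) mulNr divfK ?gt_eqF //; clear; lra.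
- by rewrite t0 mulr0 addr0; exact: axis.
Qed.

End Plane.

(** * Affine and unimodular pullbacks *)

Section Pull.
Variable R : realType.
Implicit Types S : R -> R -> Prop.

Definition apull S (a b c d e f : R) : R -> R -> Prop :=
  fun x y => S (a * x + b * y + e) (c * x + d * y + f).

Lemma pconvex_apull S a b c d e f : pconvex S -> pconvex (apull S a b c d e f).
Proof.
move=> cS x1 y1 x2 y2 t S1 S2 t0 t1; rewrite /apull.
have -> : a * ((1 - t) * x1 + t * x2) + b * ((1 - t) * y1 + t * y2) + e =
  (1 - t) * (a * x1 + b * y1 + e) + t * (a * x2 + b * y2 + e) by ring.
have -> : c * ((1 - t) * x1 + t * x2) + d * ((1 - t) * y1 + t * y2) + f =
  (1 - t) * (c * x1 + d * y1 + f) + t * (c * x2 + d * y2 + f) by ring.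
exact: cS.
Qed.

Lemma inner_apullW S a b c d e f x y :
  inner S (a * x + b * y + e) (c * x + d * y + f) -> inner (apull S a b c d e f) x y.
Proof.
move=> [r r0 h]; pose N := `|a| + `|b| + `|c| + `|d| + 1.
have [a0 b0 c0 d0] := And4 (normr_ge0 a) (normr_ge0 b) (normr_ge0 c) (normr_ge0 d).
have N0 : 0 < N by rewrite /N; lra.
have rN : r / N * N = r by rewrite divfK // gt_eqF.
have q0 : 0 <= r / N by rewrite divr_ge0 // ltW.
exists (r / N); first exact: divr_gt0.
have k (u v w x1 y1 x2 y2 : R) : `|u| + `|v| <= N -> `|x2 - x1| <= r / N ->
    `|y2 - y1| <= r / N -> `|u * x2 + v * y2 + w - (u * x1 + v * y1 + w)| <= r.
  move=> uv hx hy.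
  have -> : u * x2 + v * y2 + w - (u * x1 + v * y1 + w) =
    u * (x2 - x1) + v * (y2 - y1) by ring.
  apply: (le_trans (ler_normD _ _)); rewrite !normrM.
  apply: (@le_trans _ _ (`|u| * (r / N) + `|v| * (r / N))).
    by apply: lerD; apply: ler_wpM2l.
  by rewrite -mulrDl -{2}rN mulrC ler_wpM2l.
by move=> x' y' hx hy; apply: h; apply: k => //; rewrite /N; lra.
Qed.

Section Det.
Variables a b c d e f : R.
Hypothesis D0 : a * d - b * c != 0.
Let D := a * d - b * c.

Lemma apull_onto X Y : exists x y, X = a * x + b * y + e /\ Y = c * x + d * y + f.
Proof.
exists ((d * (X - e) - b * (Y - f)) / D), ((a * (Y - f) - c * (X - e)) / D).
by split; rewrite /D; field.
Qed.

(** The forward direction applies [inner_apullW] to a second pullback, by the inverse map. *)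
Lemma inner_apull S x y :
  inner (apull S a b c d e f) x y <-> inner S (a * x + b * y + e) (c * x + d * y + f).
Proof.
split; last exact: inner_apullW.
move=> h; set X := a * x + b * y + e; set Y := c * x + d * y + f.
have : inner (apull (apull S a b c d e f) (d / D) (- b / D) (- c / D) (a / D)
    ((b * f - d * e) / D) ((c * e - a * f) / D)) X Y.
  apply: inner_apullW.
  have -> : d / D * X + - b / D * Y + (b * f - d * e) / D = x.
    by rewrite /X /Y /D; field.
  have -> : - c / D * X + a / D * Y + (c * e - a * f) / D = y.
    by rewrite /X /Y /D; field.
  exact: h.
move=> [r r0 k]; exists r => // x' y' hx hy; have := k _ _ hx hy; rewrite /apull.
rewrite (_ : a * _ + _ + _ = x'); last by rewrite /D; field.
by rewrite (_ : c * _ + _ + _ = y') //; rewrite /D; field.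
Qed.

Lemma pbody_apull S : pbody S -> pbody (apull S a b c d e f).
Proof.
move=> [cS [X [Y iS]] mS lS]; split.
- exact: pconvex_apull.
- have [x [y [eX eY]]] := apull_onto X Y; exists x, y; apply/inner_apull.
  by rewrite -eX -eY.
- move=> p q; have [X' [Y' [S' mx]]] := mS ((p * d - q * c) / D) ((q * a - p * b) / D).
  have [x [y [eX eY]]] := apull_onto X' Y'; exists x, y.
  (* Functionals are transported by the inverse transpose, up to an additive constant. *)
  have k x1 y1 : (p * d - q * c) / D * (a * x1 + b * y1 + e) +
     (q * a - p * b) / D * (c * x1 + d * y1 + f) =
     p * x1 + q * y1 + ((p * d - q * c) * e + (q * a - p * b) * f) / D.
    by rewrite /D; field.
  split; first by rewrite /apull -eX -eY.
  by move=> x1 y1 /mx; rewrite eX eY !k; lra.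
- move=> p q pq.
  have pq' : a * p + b * q != 0 \/ c * p + d * q != 0.
    have [e1|] := eqVneq (a * p + b * q) 0; last by left.
    right; apply/eqP => e2.
    have p0 : D * p = 0.
      by transitivity (d * (a * p + b * q) - b * (c * p + d * q)); [rewrite /D; ring|rewrite e1 e2; ring].
    have q0 : D * q = 0.
      by transitivity (a * (c * p + d * q) - c * (a * p + b * q)); [rewrite /D; ring|rewrite e1 e2; ring].
    move/eqP: p0; move/eqP: q0; rewrite !mulf_eq0 (negbTE D0) /= => /eqP q0 /eqP p0.
    by case: pq; rewrite ?p0 ?q0 eqxx.
  have [X' [Y' [l [S1 S2 mx]]]] := lS _ _ pq'.
  have [x [y [eX eY]]] := apull_onto X' Y'; exists x, y, l.
  have k1 x1 y1 m : a * (x1 + m * p) + b * (y1 + m * q) + e =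
     a * x1 + b * y1 + e + m * (a * p + b * q) by ring.
  have k2 x1 y1 m : c * (x1 + m * p) + d * (y1 + m * q) + f =
     c * x1 + d * y1 + f + m * (c * p + d * q) by ring.
  split; rewrite /apull; first by rewrite -eX -eY.
    by rewrite k1 k2 -eX -eY.
  by move=> x1 y1 m T1; rewrite k1 k2; exact: mx.
Qed.
End Det.

Definition lat S (m n : int) := inner S m%:~R n%:~R.

(* The lattice width is at least [w]. *)
Definition wid S (w : R) := forall m n : int, m != 0 \/ n != 0 ->
  exists x y x' y', [/\ S x y, S x' y' & w <= m%:~R * (x - x') + n%:~R * (y - y')].

Definition tri (x y : R) := [/\ 0 <= x, 0 <= y & x + y <= 3].

Definition ipull S (a b c d e f : int) :=
  apull S a%:~R b%:~R c%:~R d%:~R e%:~R f%:~R.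

(** The integer map sends [S] onto the triangle, so it is inverse to the map of [unimodular_equiv];
    determinant with square 1 is invertibility over Z. *)
Definition equi S := exists a b c d e f : int,
  (a * d - b * c) ^+ 2 = 1 /\ forall x y, S x y <-> ipull tri a b c d e f x y.

Section IntPull.
Variables a b c d e f : int.
Hypothesis D1 : (a * d - b * c) ^+ 2 = 1.

Lemma idet_neq0 : a%:~R * d%:~R - b%:~R * c%:~R != 0 :> R.
Proof.
rewrite -!intrM -intrB intr_eq0; apply/eqP => h; move: D1; by rewrite h expr0n.
Qed.

Lemma pbody_ipull S : pbody S -> pbody (ipull S a b c d e f).
Proof. exact: (pbody_apull _ _ idet_neq0). Qed.

Lemma lat_ipull S m n :
  lat (ipull S a b c d e f) m n <-> lat S (a * m + b * n + e) (c * m + d * n + f).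
Proof.
rewrite /lat (inner_apull _ _ idet_neq0).
by rewrite !intrD !intrM.
Qed.

Lemma wid_ipull S w : wid S w -> wid (ipull S a b c d e f) w.
Proof.
move=> wS m n mn.
pose D := a * d - b * c.
have DE : (D%:~R * D%:~R = 1 :> R) by rewrite -intrM -expr2 /D D1.
(* Since [D ^+ 2 = 1], multiplying by [D] divides by the determinant: this is the inverse transpose
   applied to [(m, n)]. *)
pose m' := D * (m * d - n * c); pose n' := D * (n * a - m * b).
have mE : m = a * m' + c * n'.
  transitivity (m * D ^+ 2); [by rewrite /D D1 mulr1|rewrite /m' /n' /D; ring].
have nE : n = b * m' + d * n'.
  transitivity (n * D ^+ 2); [by rewrite /D D1 mulr1|rewrite /m' /n' /D; ring].
have mn' : m' != 0 \/ n' != 0.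
  have [e1|] := eqVneq m' 0; last by left.
  have [e2|] := eqVneq n' 0; last by right.
  by case: mn; rewrite ?mE ?nE e1 e2 !mulr0 addr0 eqxx.
have [X [Y [X' [Y' [S1 S2 h]]]]] := wS _ _ mn'.
have [x [y [eX eY]]] := apull_onto e%:~R f%:~R idet_neq0 X Y.
have [x' [y' [eX' eY']]] := apull_onto e%:~R f%:~R idet_neq0 X' Y'.
exists x, y, x', y'; split; rewrite /ipull /apull -?eX -?eY -?eX' -?eY' //.
apply: le_trans h _; rewrite eX eY eX' eY' mE nE !intrD !intrM; lra.
Qed.

Lemma equi_ipull S : equi (ipull S a b c d e f) -> equi S.
Proof.
move=> [a' [b' [c' [d' [e' [f' [D' h]]]]]]].
have [D DD] : exists D, D = a * d - b * c by eexists.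
have [A AE] : exists A, A = D * d by eexists.
have [B BE] : exists B, B = - D * b by eexists.
have [C CE] : exists C, C = - D * c by eexists.
have [E EE] : exists E, E = D * a by eexists.
have [F FE] : exists F, F = D * (b * f - d * e) by eexists.
have [G GE] : exists G, G = D * (c * e - a * f) by eexists.
(* The given map onto the triangle composed with the inverse of the pullback map, written as [D]
   times the adjugate. *)
exists (a' * A + b' * C), (a' * B + b' * E), (c' * A + d' * C), (c' * B + d' * E),
  (a' * F + b' * G + e'), (c' * F + d' * G + f'); split.
  transitivity ((a' * d' - b' * c') ^+ 2 * ((D ^+ 2) * D) ^+ 2).
    by rewrite AE BE CE EE DD; ring.
  by rewrite D' DD D1 !mul1r D1.
have DE : (D%:~R * D%:~R = 1 :> R) by rewrite -intrM -expr2 DD D1.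
have DE' : (D%:~R = a%:~R * d%:~R - b%:~R * c%:~R :> R) by rewrite DD intrB !intrM.
move=> X Y; have [x [y [eX eY]]] := apull_onto e%:~R f%:~R idet_neq0 X Y.
rewrite [X in S X]eX [Y in S _ Y]eY.
have -> : S (a%:~R * x + b%:~R * y + e%:~R) (c%:~R * x + d%:~R * y + f%:~R) =
  ipull S a b c d e f x y by [].
rewrite h.
have ex : A%:~R * X + B%:~R * Y + F%:~R = x.
  transitivity (D%:~R * D%:~R * x); last by rewrite DE mul1r.
  by rewrite eX eY AE BE FE !(intrM, intrN, intrB) DE'; ring.
have ey : C%:~R * X + E%:~R * Y + G%:~R = y.
  transitivity (D%:~R * D%:~R * y); last by rewrite DE mul1r.
  by rewrite eX eY CE EE GE !(intrM, intrN, intrB) DE'; ring.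
rewrite /ipull /apull.
have -> : (a' * A + b' * C)%:~R * X + (a' * B + b' * E)%:~R * Y +
    (a' * F + b' * G + e')%:~R = a'%:~R * x + b'%:~R * y + e'%:~R :> R.
  rewrite -[in RHS]ex -[in RHS]ey !(intrD, intrM); ring.
have -> // : (c' * A + d' * C)%:~R * X + (c' * B + d' * E)%:~R * Y +
    (c' * F + d' * G + f')%:~R = c'%:~R * x + d'%:~R * y + f'%:~R :> R.
rewrite -[in RHS]ex -[in RHS]ey !(intrD, intrM); ring.
Qed.
End IntPull.
End Pull.

(** * Long lattice chords *)

Section Transference.
Variable R : realType.
Implicit Types D S : R -> R -> Prop.

(** The two points lie on opposite sides of the line through 0 and [(p, q)]. The segment between
    them crosses it at [l * (p, q)], where [l] is read off by the functional [(u, v)]; the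
    conclusion is [l <= 1] with denominators cleared. *)
Lemma cross_segment D p q u v x1 y1 x2 y2 : pconvex D ->
  (forall l, 1 < l -> ~ D (l * p) (l * q)) -> u * p + v * q = 1 ->
  D x1 y1 -> D x2 y2 -> 0 <= q * x1 - p * y1 -> q * x2 - p * y2 <= 0 ->
  0 < (q * x1 - p * y1) - (q * x2 - p * y2) ->
  (q * x1 - p * y1) * (u * x2 + v * y2) - (q * x2 - p * y2) * (u * x1 + v * y1)
  <= (q * x1 - p * y1) - (q * x2 - p * y2).
Proof.
move=> cD nD uv D1 D2.
set s1 := q * x1 - p * y1; set s2 := q * x2 - p * y2 => s1p s2n d0.
pose t := s1 / (s1 - s2).
have t0 : 0 <= t by rewrite divr_ge0 // ltW.
have t1 : t <= 1 by rewrite ler_pdivrMr // mul1r; lra.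
have tE : t * (s1 - s2) = s1 by rewrite /t divfK // gt_eqF.
have Dz := cD _ _ _ _ _ D1 D2 t0 t1.
set zx := (1 - t) * x1 + t * x2 in Dz; set zy := (1 - t) * y1 + t * y2 in Dz.
have z0 : q * zx = p * zy.
  apply/eqP; rewrite -subr_eq0; apply/eqP.
  transitivity (s1 - t * (s1 - s2)); last by rewrite tE subrr.
  by rewrite /zx /zy /s1 /s2; ring.
pose l := u * zx + v * zy.
have zxE : zx = l * p.
  transitivity ((u * p + v * q) * zx); first by rewrite uv mul1r.
  by transitivity (u * p * zx + v * (q * zx)); [ring|rewrite z0 /l; ring].
have zyE : zy = l * q.
  transitivity ((u * p + v * q) * zy); first by rewrite uv mul1r.
  by transitivity (u * (p * zy) + v * q * zy); [ring|rewrite -z0 /l; ring].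
have l1 : l <= 1 by rewrite leNgt; apply/negP => /nD; rewrite -zxE -zyE.
have -> : s1 * (u * x2 + v * y2) - s2 * (u * x1 + v * y1) = (s1 - s2) * l.
  transitivity ((s1 - s2) * (u * x1 + v * y1) +
     t * (s1 - s2) * ((u * x2 + v * y2) - (u * x1 + v * y1))).
    by rewrite tE; ring.
  by rewrite /l /zx /zy; ring.
by rewrite -{2}(mulr1 (s1 - s2)) ler_pM2l.
Qed.

(** At [r = 4/3], [r ^+ 2 - r] is [4/9]. So [b * (1 - y)] and [y * (1 - b)] exceed [4/9]; weighted
    by [y] and [1 - y] they add up to [y * (1 - y)], which is at most [1/4]. *)
Lemma transference_side (r b y : R) : 4/3 < r -> 0 <= b -> 0 <= y ->
  r ^+ 2 + b * y <= r + b -> r ^+ 2 + b * y <= r + y -> False.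
Proof.
move=> r0 b0 y0 h1 h2.
have e : 4/9 < r ^+ 2 - r by nra.
have k1 : 4/9 < b * (1 - y) by lra.
have k2 : 4/9 < y * (1 - b) by lra.
have y1 : 0 < 1 - y by nra.
have b1 : 0 < 1 - b by nra.
have yp : 0 < y by nra.
have : 4/9 * y <= b * (1 - y) * y by rewrite ler_pM2r // ltW.
have : 4/9 * (1 - y) <= y * (1 - b) * (1 - y) by rewrite ler_pM2r // ltW.
nra.
Qed.

Lemma harmonic_mean (d x y : R) : 0 < d -> 0 < x -> 0 < y ->
  d * (x + y) <= x * y -> x^-1 + y^-1 <= d^-1.
Proof.
move=> d0 x0 y0 h; rewrite -(ler_pM2l d0) -(ler_pM2r (mulr_gt0 x0 y0)).
have -> : d * (x^-1 + y^-1) * (x * y) = d * (x + y).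
  by field; rewrite !gt_eqF.
by rewrite divff ?mul1r // gt_eqF.
Qed.

Lemma sum_inv_ge (r x : R) : 0 < x -> x < r -> 4 / r <= x^-1 + (r - x)^-1.
Proof.
move=> x0 xr; have y0 : 0 < r - x by lra.
have r0 : 0 < r by lra.
rewrite -subr_ge0.
have -> : x^-1 + (r - x)^-1 - 4 / r = (r - 2 * x) ^+ 2 / (r * x * (r - x)).
  by field; rewrite ?gt_eqF //; lra.
by rewrite divr_ge0 ?sqr_ge0 // ?mulr_ge0 // ltW.
Qed.

(** Each of [a], [b], [c] occurs once as itself and once as its complement to [r]. Adding the three
    reciprocal bounds gives [12 / r <= 3 / (r - 1)], that is [r <= 4/3]. *)
Lemma transference_main (r a b c : R) : 4/3 < r -> 0 < a -> a < r -> 0 < b -> b < r ->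
  0 < c -> c < r ->
  (r - 1) * (a + b) <= a * b -> (r - 1) * (c + (r - a)) <= c * (r - a) ->
  (r - 1) * ((r - b) + (r - c)) <= (r - b) * (r - c) -> False.
Proof.
move=> r0 a0 ar b0 br c0 cr h1 h2 h3.
have d0 : 0 < r - 1 by lra.
have a1 : 0 < r - a by lra. have b1 : 0 < r - b by lra. have c1 : 0 < r - c by lra.
have := harmonic_mean d0 a0 b0 h1.
have := harmonic_mean d0 c0 a1 h2.
have := harmonic_mean d0 b1 c1 h3.
have := sum_inv_ge a0 ar; have := sum_inv_ge b0 br; have := sum_inv_ge c0 cr.
have : 3 * (r - 1)^-1 < 12 / r.
  have rp : 0 < r by lra.
  rewrite -subr_gt0 (_ : _ - _ = (9 * r - 12) / (r * (r - 1))).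
    by rewrite divr_gt0 ?mulr_gt0 //; lra.
  by field; rewrite !gt_eqF //; lra.
lra.
Qed.

(** The three given points reach [r] for the functionals [y], [x] and [x + y]. Segments between them
    and their negatives cross the lines through [(1, 0)], [(0, 1)] and [(-1, 1)] within parameter 1.
    [transference_main] is the generic position, [transference_side] covers [y3 >= 0] and
    [a >= r]. *)
Lemma transference_normal D r b y3 a : pconvex D ->
  (forall x y, D x y -> D (- x) (- y)) -> D 1 0 ->
  (forall l, 1 < l -> [/\ ~ D l 0, ~ D 0 l & ~ D (- l) l]) ->
  4/3 < r -> - r <= b -> b <= 0 -> D b r -> D r y3 -> D a (r - a) -> False.
Proof.
move=> cD sD D10 nD r0 br b0 Ab Ax Aa.
have n10 l : 1 < l -> ~ D (l * 1) (l * 0) by move=> /nD[+ _ _]; rewrite mulr1 mulr0.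
have n01 l : 1 < l -> ~ D (l * 0) (l * 1) by move=> /nD[_ + _]; rewrite mulr1 mulr0.
have nm1 l : 1 < l -> ~ D (l * -1) (l * 1) by move=> /nD[_ _ +]; rewrite mulrN mulr1.
have n1m l : 1 < l -> ~ D (l * 1) (l * -1).
  by move=> /nD[_ _ h] /sD; rewrite mulrN mulr1 opprK.
have nm0 l : 1 < l -> ~ D (l * -1) (l * 0).
  by move=> /nD[h _ _] /sD; rewrite mulrN mulr1 opprK mulr0 oppr0.
have r1 : 1 < r by lra.
have b1 : b < 0.
  rewrite lt_neqAle b0 andbT; apply/eqP => e; have [_ + _] := nD _ r1.
  by rewrite -e in Ab *.
have b2 : - r < b.
  rewrite lt_neqAle br andbT; apply/eqP => e; have [_ _] := nD _ r1.
  by rewrite -e in Ab *.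
have u1 : 0 * 0 + 1 * 1 = 1 :> R by ring.
have u2 : 1 * 1 + 0 * 0 = 1 :> R by ring.
have u3 : 0 * -1 + 1 * 1 = 1 :> R by ring.
have u4 : 1 * 1 + 0 * -1 = 1 :> R by ring.
have u5 : -1 * -1 + 0 * 0 = 1 :> R by ring.
have Dm10 : D (- 1) 0 by have := sD _ _ D10; rewrite oppr0.
have [y30|y30] := leP 0 y3.
  have h1 := cross_segment cD n01 u1 Ax Ab.
  have h2 := cross_segment cD n10 u2 (sD _ _ Ab) Ax.
  apply: (transference_side (b := - b) (y := y3) r0);
    move: r0 b1 y30 h1 h2; clear; lra.
have [y3r|y3r] := leP y3 (- r).
  have h := cross_segment cD nm1 u3 (sD _ _ Ax) Dm10.
  lra.
have [a0|a0] := leP a 0.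
  have h := cross_segment cD n01 u1 D10 Aa.
  lra.
have [ar|ar] := leP r a.
  have h1 := cross_segment cD nm1 u3 Ab (sD _ _ Aa).
  have h2 := cross_segment cD nm0 u5 (sD _ _ Aa) (sD _ _ Ab).
  apply: (transference_side (b := r + b) (y := a - r) r0);
    move: r0 b2 ar h1 h2; clear; lra.
have h1 := cross_segment cD n01 u1 Aa Ab.
have h2 := cross_segment cD n10 u2 Ax Aa.
have h3 := cross_segment cD n1m u4 (sD _ _ Ab) Ax.
apply: (transference_main (a := a) (b := - b) (c := - y3) r0);
  move: r0 a0 ar b1 b2 y30 y3r h1 h2 h3; clear; lra.
Qed.

(* Applied to [D = (S - S) / L], where [L] is the length of the longest lattice
   chord of [S]. *)
Lemma transference D r : pconvex D ->
  (forall x y, D x y -> D (- x) (- y)) -> D 1 0 ->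
  (forall (m n : int) l, m != 0 \/ n != 0 -> 1 < l -> ~ D (l * m%:~R) (l * n%:~R)) ->
  (forall m n : int, m != 0 \/ n != 0 -> exists x y, D x y /\ r <= m%:~R * x + n%:~R * y) ->
  r <= 4/3.
Proof.
move=> cD sD D10 nD wD; rewrite leNgt; apply/negP => r43.
have r0 : 0 < r by lra.
have D00 : D 0 0.
  have h0 : 0 <= 2^-1 :> R by lra.
  have h1 : 2^-1 <= 1 :> R by lra.
  have := cD _ _ _ _ _ D10 (sD _ _ D10) h0 h1.
  have -> : (1 - 2^-1) * 1 + 2^-1 * -1 = 0 :> R by lra.
  by have -> : (1 - 2^-1) * 0 + 2^-1 * - 0 = 0 :> R by lra.
have ex (m n : int) : m != 0 \/ n != 0 ->
    exists x y, D x y /\ m%:~R * x + n%:~R * y = r.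
  move=> mn; have [x [y [Dxy h]]] := wD _ _ mn.
  set w := m%:~R * x + n%:~R * y in h.
  have w0 : 0 < w by lra.
  have h0 : 0 <= r / w by rewrite divr_ge0 // ltW.
  have h1 : r / w <= 1 by rewrite ler_pdivrMr // mul1r.
  exists (r / w * x), (r / w * y); split.
    by have := cD _ _ _ _ _ D00 Dxy h0 h1; rewrite !mulr0 !add0r.
  by transitivity (r / w * w); [rewrite /w; ring|rewrite divfK // gt_eqF].
have [b0 [r' [Db]]] := ex 0 1 (or_intror isT); rewrite mul0r add0r mul1r => e; subst r'.
(* The shear bringing the point at height [r] to an abscissa between [- r] and 0. *)
pose k := - Num.ceil (b0 / r).
have [kl kr] : - r <= b0 + k%:~R * r /\ b0 + k%:~R * r <= 0.
  have /andP[] := ceil_itv (b0 / r).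
  rewrite /k intrB intrN; move: (Num.ceil (b0 / r))%:~R => z.
  by rewrite ltr_pdivlMr // ler_pdivrMr //; lra.
pose D' := apull D 1 (- k%:~R) 0 1 0 0.
have D'E x y : D' x y = D (x - k%:~R * y) y.
  by rewrite /D' /apull; congr D; ring.
have cD' : pconvex D' by exact: pconvex_apull.
have sD' x y : D' x y -> D' (- x) (- y).
  by rewrite !D'E => /sD; rewrite (_ : - (x - _) = - x - k%:~R * - y) //; ring.
have D'10 : D' 1 0 by rewrite D'E mulr0 subr0.
have nD' l : 1 < l -> [/\ ~ D' l 0, ~ D' 0 l & ~ D' (- l) l].
  move=> l1; rewrite !D'E; split.
  - by have := nD 1 0 l (or_introl isT) l1; rewrite !mulr0 subr0 mulr1.
  - have := nD (- k) 1 l (or_intror isT) l1.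
    by rewrite mulr1 intrN (_ : 0 - _ = l * - k%:~R) //; ring.
  - have := nD (- 1 - k) 1 l (or_intror isT) l1.
    by rewrite mulr1 intrB intrN (_ : - l - _ = l * (- 1%:~R - k%:~R)) //; ring.
have D'b : D' (b0 + k%:~R * r) r by rewrite D'E addrK.
(* In sheared coordinates these two functionals are [x] and [x + y]. *)
have [x1 [y1 [D1 e1]]] := ex 1 k (or_introl isT).
have [x2 [y2 [D2 e2]]] := ex 1 (k + 1) (or_introl isT).
apply: (transference_normal (D := D') (r := r) (b := b0 + k%:~R * r) (y3 := y1)
  (a := r - y2)) => //.
  by rewrite D'E -e1 mul1r addrK.
rewrite D'E; have -> : r - (r - y2) = y2 by ring.
have -> // : r - y2 - k%:~R * y2 = x2.
by rewrite -e2 intrD mul1r; ring.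
Qed.

End Transference.

(** * The longest lattice chord and a basis adapted to it *)

Section LongestChord.
Variable R : realType.
Implicit Types S : R -> R -> Prop.

Lemma ex_max_seq (T : eqType) (s : seq T) (f : T -> R) x0 : x0 \in s ->
  exists2 x, x \in s & forall y, y \in s -> f y <= f x.
Proof.
elim: s x0 => // a [|b s] IH x0 _.
  by exists a; rewrite ?mem_head // => y; rewrite inE => /eqP->.
have [x xs xm] := IH b (mem_head _ _).
have [h|h] := leP (f a) (f x).
  by exists x => [|y]; rewrite inE ?xs ?orbT // => /orP[/eqP->|/xm].
exists a => [|y]; rewrite inE ?eqxx // => /orP[/eqP->//|/xm k].
exact: le_trans k (ltW h).
Qed.

Definition ints (N : nat) : seq int := [seq k%:Z - N%:Z | k <- iota 0 (2 * N).+1].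

Lemma mem_ints N (m : int) : (`|m| <= N%:Z) -> m \in ints N.
Proof.
move=> h; apply/mapP; exists (absz (m + N%:Z)); last by lia.
by rewrite mem_iota; lia.
Qed.

Lemma pbody_bounded S : pbody S -> exists2 B, 0 < B &
  forall x y x' y', S x y -> S x' y' -> `|x - x'| <= B /\ `|y - y'| <= B.
Proof.
move=> [_ _ mS _].
have [x1 [y1 [_ h1]]] := mS 1 0; have [x2 [y2 [_ h2]]] := mS (- 1) 0.
have [x3 [y3 [_ h3]]] := mS 0 1; have [x4 [y4 [_ h4]]] := mS 0 (- 1).
exists (`|x1 - x2| + `|y3 - y4| + 1).
  by rewrite ltr_wpDl ?addr_ge0.
move=> x y x' y' s s'.
have := ler_norm (x1 - x2); have := ler_norm (y3 - y4).
have := normr_ge0 (x1 - x2); have := normr_ge0 (y3 - y4).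
have := h1 _ _ s; have := h1 _ _ s'; have := h2 _ _ s; have := h2 _ _ s'.
have := h3 _ _ s; have := h3 _ _ s'; have := h4 _ _ s; have := h4 _ _ s'.
by move=> *; split; rewrite ler_norml; apply/andP; split; lra.
Qed.

(** A maximum over finitely many directions: a direction whose chord is longer than [L0], the one
    along [(1, 0)], has entries at most [B / L0]. *)
Lemma longest_lattice_chord S : pbody S -> exists (a c : int) (L : R),
  [/\ a != 0 \/ c != 0, 0 < L,
    exists x y, S x y /\ S (x + L * a%:~R) (y + L * c%:~R) &
    forall (m n : int) x y l, m != 0 \/ n != 0 -> S x y ->
      S (x + l * m%:~R) (y + l * n%:~R) -> l <= L].
Proof.
move=> bS; have [B B0 hB] := pbody_bounded bS.
case: (bS) => [_ [ o1 [ o2 [e e0 he]]] _ lS].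
have /choice [g gP] (v : int * int) : exists l, v.1 != 0 \/ v.2 != 0 ->
    (exists x y, S x y /\ S (x + l * v.1%:~R) (y + l * v.2%:~R)) /\
    forall x y m, S x y -> S (x + m * v.1%:~R) (y + m * v.2%:~R) -> m <= l.
  have [nz|z] := pselect (v.1 != 0 \/ v.2 != 0); last by exists 0 => /z.
  have nz' : v.1%:~R != 0 :> R \/ v.2%:~R != 0 :> R by rewrite !intr_eq0.
  have [x [y [l [s1 s2 mx]]]] := lS _ _ nz'.
  by exists l => _; split=> //; exists x, y.
pose L0 := g (1, 0).
have L00 : 0 < L0.
  have [_ mx] := gP (1, 0) (or_introl isT).
  apply: (lt_le_trans e0); apply: (mx o1 o2).
    by apply: he; rewrite subrr normr0 ltW.
  apply: he => /=.
    have -> : o1 + e * 1%:~R - o1 = e by ring.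
    by rewrite gtr0_norm.
  have -> : o2 + e * 0%:~R - o2 = 0 by ring.
  by rewrite normr0 ltW.
pose N := Num.Def.archi_bound (B / L0).
have NP : B / L0 < N%:R by apply: archi_boundP; rewrite divr_ge0 // ltW.
pose s := [seq v <- [seq (m, n) | m <- ints N, n <- ints N] | (v.1 != 0) || (v.2 != 0)].
have s0 : (1, 0) \in s.
  rewrite mem_filter; apply/andP; split=> //; apply: allpairs_f.
    apply: mem_ints; rewrite normr1.
    suff : (0 < N)%N by lia.
    by rewrite -(ltr_nat R) (lt_trans _ NP) // divr_gt0.
  by apply: mem_ints; rewrite normr0.
have [v vs vm] := ex_max_seq g s0.
have vnz : v.1 != 0 \/ v.2 != 0 by move: vs; rewrite mem_filter => /andP[/orP].
have [[x [y [S1 S2]]] mxv] := gP v vnz.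
have L0v : L0 <= g v by exact: vm.
exists v.1, v.2, (g v); split=> //; first exact: lt_le_trans L00 L0v.
  by exists x, y.
move=> m n x' y' l mn T1 T2.
have [[x2 [y2 [U1 U2]]] mx2] := gP (m, n) mn.
apply: (le_trans (mx2 _ _ _ T1 T2)).
have [h|h] := leP (g (m, n)) L0; first exact: le_trans h L0v.
apply: vm; rewrite mem_filter; apply/andP; split; first by apply/orP.
have k (z : int) : `|g (m, n) * z%:~R| <= B -> z \in ints N.
  move=> hz; apply: mem_ints; rewrite -(ler_int R) intr_norm.
  apply: le_trans (ltW NP); rewrite ler_pdivlMr //.
  apply: le_trans hz; rewrite normrM mulrC ler_wpM2r //.
  by rewrite gtr0_norm ?ltW // (lt_trans L00).
have [hx hy] := hB _ _ _ _ U2 U1.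
rewrite !(addrAC _ _ (- _)) !subrr !add0r /= in hx hy.
by apply: allpairs_f; apply: k.
Qed.

Lemma chord_basis S w : pbody S -> wid S w -> 0 < w ->
  exists a b c d : int, a * d - b * c = 1 /\
  exists p y L, [/\ ipull S a b c d 0 0 p y, ipull S a b c d 0 0 (p + L) y,
    0 < L & w <= 4/3 * L].
Proof.
move=> bS wS w0.
have [a [c [L [nz L0 [x [y [S1 S2]]] mx]]]] := longest_lattice_chord bS.
(* Otherwise the same chord, measured in the primitive direction, would be longer by the factor
   [gcdz a c]. *)
have g1 : gcdz a c = 1.
  have gn : gcdz a c != 0 by rewrite gcdz_eq0; case: nz => /negbTE->; rewrite ?andbF.
  have gp : 0 <= gcdz a c by [].
  have [a' aE] : exists a', a = a' * gcdz a c by apply/dvdzP; exact: dvdz_gcdl.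
  have [c' cE] : exists c', c = c' * gcdz a c by apply/dvdzP; exact: dvdz_gcdr.
  have nz' : a' != 0 \/ c' != 0.
    have [e1|] := eqVneq a' 0; last by left.
    have [e2|] := eqVneq c' 0; last by right.
    by case: nz => /eqP[]; [rewrite aE e1 mul0r|rewrite cE e2 mul0r].
  have := mx a' c' x y (L * (gcdz a c)%:~R) nz' S1.
  have e1 : L * (gcdz a c)%:~R * a'%:~R = L * a%:~R.
    by rewrite [in RHS]aE intrM; ring.
  have e2 : L * (gcdz a c)%:~R * c'%:~R = L * c%:~R.
    by rewrite [in RHS]cE intrM; ring.
  rewrite e1 e2 => /(_ S2); rewrite -{2}(mulr1 L) ler_pM2l // -[1]/(1%:~R) ler_int.
  by lia.
have [u [v uv]] := Bezoutz a c; rewrite g1 in uv.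
pose b := - v; pose d := u.
have D1 : a * d - b * c = 1 by rewrite /b /d; lia.
have D2 : (a * d - b * c) ^+ 2 = 1 by rewrite D1.
exists a, b, c, d; split=> //.
have [p [q [eX eY]]] := apull_onto 0%:~R 0%:~R (idet_neq0 R D2) x y.
have Sp : ipull S a b c d 0 0 p q by rewrite /ipull /apull -eX -eY.
have SpL : ipull S a b c d 0 0 (p + L) q.
  rewrite /ipull /apull.
  have -> : a%:~R * (p + L) + b%:~R * q + 0%:~R = x + L * a%:~R by rewrite eX; ring.
  by have -> : c%:~R * (p + L) + d%:~R * q + 0%:~R = y + L * c%:~R by rewrite eY; ring.
exists p, q, L; split=> //.
rewrite -ler_pdivrMr //.
pose S' := ipull S a b c d 0 0.
have bS' : pbody S' by exact: pbody_ipull.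
have wS' : wid S' w by exact: wid_ipull.
case: (bS') => cS' _ _ _.
(* The difference body scaled by [1 / L]: the chord becomes [(1, 0)], and maximality says that no
   lattice vector is interior except 0. *)
pose D s t := exists x1 y1 x2 y2,
  [/\ S' x1 y1, S' x2 y2, x1 - x2 = L * s & y1 - y2 = L * t].
apply: (@transference R D).
- move=> s1 t1 s2 t2 l [x1 [y1 [x2 [y2 [T1 T2 e1 e2]]]]] [x3 [y3 [x4 [y4 [T3 T4 e3 e4]]]]] l0 l1.
  exists ((1 - l) * x1 + l * x3), ((1 - l) * y1 + l * y3),
    ((1 - l) * x2 + l * x4), ((1 - l) * y2 + l * y4); split; try exact: cS'.
    by rewrite mulrDr !(mulrCA L) -e1 -e3; ring.
  by rewrite mulrDr !(mulrCA L) -e2 -e4; ring.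
- move=> s t [x1 [y1 [x2 [y2 [T1 T2 e1 e2]]]]]; exists x2, y2, x1, y1; split=> //.
    by rewrite mulrN -e1 opprB.
  by rewrite mulrN -e2 opprB.
- by exists (p + L), q, p, q; split=> //; ring.
- move=> m n l mn l1 [x1 [y1 [x2 [y2 [T1 T2 e1 e2]]]]].
  have mn' : a * m + b * n != 0 \/ c * m + d * n != 0.
    have [f1|] := eqVneq (a * m + b * n) 0; last by left.
    have [f2|] := eqVneq (c * m + d * n) 0; last by right.
    have m0 : m = 0.
      by transitivity (d * (a * m + b * n) - b * (c * m + d * n)); [nia|rewrite f1 f2 !mulr0 subr0].
    have n0 : n = 0.
      by transitivity (a * (c * m + d * n) - c * (a * m + b * n)); [nia|rewrite f1 f2 !mulr0 subr0].
    by case: mn; rewrite ?m0 ?n0.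
  have := mx _ _ (a%:~R * x2 + b%:~R * y2 + 0%:~R) (c%:~R * x2 + d%:~R * y2 + 0%:~R) (L * l) mn' T2.
  have -> : a%:~R * x2 + b%:~R * y2 + 0%:~R + L * l * (a * m + b * n)%:~R =
    a%:~R * x1 + b%:~R * y1 + 0%:~R.
    have -> : x1 = x2 + L * (l * m%:~R) by rewrite -e1; ring.
    have -> : y1 = y2 + L * (l * n%:~R) by rewrite -e2; ring.
    by rewrite intrD !intrM; ring.
  have -> : c%:~R * x2 + d%:~R * y2 + 0%:~R + L * l * (c * m + d * n)%:~R =
    c%:~R * x1 + d%:~R * y1 + 0%:~R.
    have -> : x1 = x2 + L * (l * m%:~R) by rewrite -e1; ring.
    have -> : y1 = y2 + L * (l * n%:~R) by rewrite -e2; ring.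
    by rewrite intrD !intrM; ring.
  move=> /(_ T1); rewrite -{2}(mulr1 L) ler_pM2l // leNgt l1 //.
- move=> m n mn; have [x1 [y1 [x2 [y2 [T1 T2 h]]]]] := wS' _ _ mn.
  exists ((x1 - x2) / L), ((y1 - y2) / L); split.
    by exists x1, y1, x2, y2; split=> //; rewrite mulrC divfK // gt_eqF.
  by rewrite !mulrA -mulrDl ler_pM2r // invr_gt0.
Qed.

End LongestChord.

(** * Lattice points on horizontal lines *)

Section Lines.
Variable R : realType.
Implicit Types S : R -> R -> Prop.

(** Otherwise there is a supporting line through the point. Points of [S] to the left and right
    exclude a slanted one, points above and below a horizontal one. *)
Lemma line_inner S x y x1 x2 u1 v1 u2 v2 : pbody S -> S x1 y -> S x2 y ->
  x1 < x -> x < x2 -> S u1 v1 -> v1 < y -> S u2 v2 -> y < v2 -> inner S x y.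
Proof.
move=> [cS [ o1 [ o2 Io]] _ _] s1 s2 l1 l2 s3 l3 s4 l4.
apply: contrapT => nI; have [a [b [ab h]]] := supp_not_inner cS Io nI.
have := h _ _ s1; have := h _ _ s2; have := h _ _ s3; have := h _ _ s4.
move=> k4 k3 k2 k1.
have [a0|a0|a0] := ltrgtP a 0.
- nra.
- nra.
subst a; case: ab => [/eqP//|/eqP b0].
have [b1|b1|//] := ltrgtP b 0; nra.
Qed.

(** Joining the chord to the top or bottom point gives a triangle, in which horizontal chords shrink
    linearly. The last two hypotheses say that the chord at height [y] is still longer than [t]. *)
Lemma line_wide S p c L tx a bx b t y : pconvex S -> S p c -> S (p + L) c ->
  S tx a -> S bx b -> b <= c -> c <= a -> 0 <= t -> t < L ->
  L * (c - y) < (L - t) * (c - b) -> L * (y - c) < (L - t) * (a - c) ->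
  exists x1 x2, [/\ S x1 y, S x2 y, t < x2 - x1, b < y & y < a].
Proof.
move=> cS s1 s2 s3 s4 bc ca t0 tL h1 h2.
have L0 : 0 < L by lra.
have by_ : b < y.
  rewrite -(ltr_pM2l L0); have : 0 <= t * (c - b) by rewrite mulr_ge0 //; lra.
  lra.
have ya : y < a.
  rewrite -(ltr_pM2l L0); have : 0 <= t * (a - c) by rewrite mulr_ge0 //; lra.
  lra.
have key u v r : S u v -> 0 <= r -> r <= 1 -> r * (v - c) = y - c -> t < (1 - r) * L ->
    exists x1 x2, [/\ S x1 y, S x2 y, t < x2 - x1, b < y & y < a].
  move=> s5 r0 r1 re rt.
  have yE : (1 - r) * c + r * v = y.
    by transitivity (c + r * (v - c)); [ring|rewrite re; ring].
  exists ((1 - r) * p + r * u), ((1 - r) * (p + L) + r * u); split=> //.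
  - by rewrite -yE; exact: cS.
  - by rewrite -yE; exact: cS.
  - by have -> : (1 - r) * (p + L) + r * u - ((1 - r) * p + r * u) = (1 - r) * L by ring.
have [yc|yc] := leP c y.
  have ac : 0 < a - c by lra.
  have rE : (y - c) / (a - c) * (a - c) = y - c by rewrite divfK // gt_eqF.
  apply: (key tx a ((y - c) / (a - c))) => //.
  - by rewrite divr_ge0 ?(ltW ac) //; lra.
  - by rewrite ler_pdivrMr // mul1r; lra.
  - rewrite -(ltr_pM2r ac) -subr_gt0.
    have -> : (1 - (y - c) / (a - c)) * L * (a - c) - t * (a - c) =
      L * (a - c) - L * ((y - c) / (a - c) * (a - c)) - t * (a - c) by ring.
    by rewrite rE; lra.
have ac : 0 < c - b by lra.
have rE : (c - y) / (c - b) * (c - b) = c - y by rewrite divfK // gt_eqF.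
apply: (key bx b ((c - y) / (c - b))) => //.
- by rewrite divr_ge0 ?(ltW ac) //; lra.
- by rewrite ler_pdivrMr // mul1r; lra.
- by rewrite -[b - c]opprB mulrN rE opprB.
- rewrite -(ltr_pM2r ac) -subr_gt0.
  have -> : (1 - (c - y) / (c - b)) * L * (c - b) - t * (c - b) =
    L * (c - b) - L * ((c - y) / (c - b) * (c - b)) - t * (c - b) by ring.
  by rewrite rE; lra.
Qed.

Lemma int_above (x : R) : exists n : int, x < n%:~R /\ n%:~R <= x + 1.
Proof.
exists (Num.floor x + 1).
by have /andP[] := floor_itv x; rewrite intrD; lra.
Qed.

Lemma line_one S p c L tx a bx b (n : int) : pbody S -> S p c -> S (p + L) c ->
  S tx a -> S bx b -> b <= c -> c <= a -> 1 < L ->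
  L * (c - n%:~R) < (L - 1) * (c - b) -> L * (n%:~R - c) < (L - 1) * (a - c) ->
  exists m, lat S m n.
Proof.
move=> bS s1 s2 s3 s4 bc ca L1 h1 h2; case: (bS) => cS _ _ _.
have [x1 [x2 [t1 t2 xx l1 l2]]] := line_wide cS s1 s2 s3 s4 bc ca ler01 L1 h1 h2.
have [m [m1 m2]] := int_above x1; exists m.
by apply: (line_inner bS t1 t2 m1 _ s4 l1 s3 l2); lra.
Qed.

Lemma line_two S p c L tx a bx b (n : int) : pbody S -> S p c -> S (p + L) c ->
  S tx a -> S bx b -> b <= c -> c <= a -> 2 < L ->
  L * (c - n%:~R) < (L - 2) * (c - b) -> L * (n%:~R - c) < (L - 2) * (a - c) ->
  exists m, lat S m n /\ lat S (m + 1) n.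
Proof.
move=> bS s1 s2 s3 s4 bc ca L1 h1 h2; case: (bS) => cS _ _ _.
have t0 : 0 <= 2 :> R by lra.
have [x1 [x2 [t1 t2 xx l1 l2]]] := line_wide cS s1 s2 s3 s4 bc ca t0 L1 h1 h2.
have [m [m1 m2]] := int_above x1; exists m; split.
  by apply: (line_inner bS t1 t2 m1 _ s4 l1 s3 l2); lra.
rewrite /lat intrD.
by apply: (line_inner bS t1 t2 _ _ s4 l1 s3 l2); lra.
Qed.

Lemma vertical_ends S w : pbody S -> wid S w -> exists tx a bx b,
  [/\ S tx a, S bx b, w <= a - b & forall x y, S x y -> b <= y /\ y <= a].
Proof.
move=> [_ _ mS _] wS.
have [tx [a [s1 h1]]] := mS 0 1; have [bx [b [s2 h2]]] := mS 0 (- 1).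
exists tx, a, bx, b; split=> //.
  have [x [y [x' [y' [t1 t2 h]]]]] := wS 0 1 (or_intror isT).
  have := h1 _ _ t1; have := h2 _ _ t2; lra.
by move=> x y s; have := h1 _ _ s; have := h2 _ _ s; split; lra.
Qed.

(** [(L - t) * h / L] is the height of the band where those triangles are wider than [t]; it is at
    least [w - 4/3 * t]. *)
Lemma band_length (L w h t : R) : 0 < L -> w <= 4/3 * L -> w <= h -> 0 <= t -> t <= L ->
  L * (w - 4/3 * t) <= (L - t) * h.
Proof.
move=> L0 wL wh t0 tL.
have : 0 <= (L - t) * (h - w) by rewrite mulr_ge0 //; lra.
have : 0 <= t * (4/3 * L - w) by rewrite mulr_ge0 //; lra.
lra.
Qed.

(** The last bound keeps [n] within 1 of the lower end of the interval, so that for [s = 2] its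
    successor fits as well. *)
Lemma int_between (l1 h1 L s : R) (c : R) : 0 < L -> L * s < l1 + h1 -> 1 <= s ->
  exists n : int, [/\ L * (c - n%:~R) < l1, L * (n%:~R - c) < h1 & n%:~R <= c - l1 / L + 1].
Proof.
move=> L0 hs s1.
have [n [n1 n2]] := int_above (c - l1 / L).
exists n.
have e : L * (l1 / L) = l1 by rewrite mulrC divfK // gt_eqF.
have k1 : L * (c - l1 / L) < L * n%:~R by rewrite ltr_pM2l.
have k2 : L * n%:~R <= L * (c - l1 / L + 1) by rewrite ler_pM2l.
have k3 : L <= L * s by rewrite ler_peMr // ltW.
have k4 : L * (c - l1 / L) = L * c - l1 by rewrite mulrBr e.
have k5 : L * (c - l1 / L + 1) = L * c - l1 + L by rewrite mulrDr k4 mulr1.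
by split; lra.
Qed.

Lemma int_neq_succ (m : int) : m != m + 1.
Proof. by lia. Qed.

Lemma unimodular_inj (a b c d u v u' v' : int) : a * d - b * c = 1 ->
  (a * u + b * v + 0, c * u + d * v + 0) = (a * u' + b * v' + 0, c * u' + d * v' + 0) ->
  u = u' /\ v = v'.
Proof.
move=> D [] e1 e2.
have e3 : a * (u - u') + b * (v - v') = 0 by lia.
have e4 : c * (u - u') + d * (v - v') = 0 by lia.
have e5 : (a * d - b * c) * (u - u') = 0.
  by transitivity (d * (a * (u - u') + b * (v - v')) - b * (c * (u - u') + d * (v - v'))); [ring|rewrite e3 e4; ring].
have e6 : (a * d - b * c) * (v - v') = 0.
  by transitivity (a * (c * (u - u') + d * (v - v')) - c * (a * (u - u') + b * (v - v'))); [ring|rewrite e3 e4; ring].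
by rewrite D !mul1r in e5 e6; split; apply/eqP; rewrite -subr_eq0; apply/eqP.
Qed.

(** The band of lines with chords longer than 1 has height at least [w - 4/3 > 1], so it contains an
    integer height. *)
Lemma flatness S w : pbody S -> wid S w -> 7/3 < w -> exists m n, lat S m n.
Proof.
move=> bS wS w73; have w0 : 0 < w by lra.
have [a [b [c [d [D1 [p [y [L [s1 s2 L0 wL]]]]]]]]] := chord_basis bS wS w0.
have D2 : (a * d - b * c) ^+ 2 = 1 by rewrite D1.
have bS' := pbody_ipull 0 0 D2 bS; have wS' := wid_ipull 0 0 D2 wS.
have [tx [ya [bx [yb [s3 s4 h hh]]]]] := vertical_ends bS' wS'.
have [yb1 ya1] := hh _ _ s1.
have L1 : 1 < L by lra.
have k := band_length L0 wL h ler01 (ltW L1).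
have [|n [h1 h2 _]] := @int_between ((L - 1) * (y - yb)) ((L - 1) * (ya - y)) L 1 y L0 _ (lexx _).
  apply: lt_le_trans (_ : L * (w - 4/3 * 1) <= _); last by lra.
  by rewrite ltr_pM2l //; lra.
have [m] := line_one bS' s1 s2 s3 s4 yb1 ya1 L1 h1 h2.
by move/lat_ipull => /(_ D2) H; eexists; eexists; exact: H.
Qed.

(** The band for length 2 has height at least [w - 8/3 > 1] and gives two points on one line; the
    band for length 1 has height at least [w - 4/3 > 2] and gives a point on another line. *)
Lemma three_points S w : pbody S -> wid S w -> 21/5 <= w ->
  exists p1 p2 p3 : int * int, [/\ uniq [:: p1; p2; p3], lat S p1.1 p1.2,
    lat S p2.1 p2.2 & lat S p3.1 p3.2].
Proof.
move=> bS wS w73; have w0 : 0 < w by lra.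
have [a [b [c [d [D1 [p [y [L [s1 s2 L0 wL]]]]]]]]] := chord_basis bS wS w0.
have D2 : (a * d - b * c) ^+ 2 = 1 by rewrite D1.
have bS' := pbody_ipull 0 0 D2 bS; have wS' := wid_ipull 0 0 D2 wS.
have [tx [ya [bx [yb [s3 s4 h hh]]]]] := vertical_ends bS' wS'.
have [yb1 ya1] := hh _ _ s1.
have L1 : 1 < L by lra. have L2 : 2 < L by lra.
have k := band_length L0 wL h ler01 (ltW L1).
have t2 : 0 <= 2 :> R by lra.
have k2 := band_length L0 wL h t2 (ltW L2).
have [|n [h1 h2 _]] := @int_between ((L - 2) * (y - yb)) ((L - 2) * (ya - y)) L 1 y L0 _ (lexx _).
  apply: lt_le_trans (_ : L * (w - 4/3 * 2) <= _); last by lra.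
  by rewrite ltr_pM2l //; lra.
have [m [i1 i2]] := line_two bS' s1 s2 s3 s4 yb1 ya1 L2 h1 h2.
have s12 : 1 <= 2 :> R by lra.
have [|n1 [h3 h4 h5]] := @int_between ((L - 1) * (y - yb)) ((L - 1) * (ya - y)) L 2 y L0 _ s12.
  apply: lt_le_trans (_ : L * (w - 4/3 * 1) <= _); last by lra.
  by rewrite ltr_pM2l //; lra.
have [n2 [nn i3]] : exists n2, n2 != n /\ exists m2, lat (ipull S a b c d 0 0) m2 n2.
  have [e|ne] := eqVneq n1 n; last first.
    by exists n1; split=> //; exact: (line_one bS' s1 s2 s3 s4 yb1 ya1 L1).
  exists (n1 + 1); split; first by rewrite -e eq_sym int_neq_succ.
  apply: (line_one bS' s1 s2 s3 s4 yb1 ya1 L1); first by rewrite intrD; lra.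
  rewrite intrD.
  have : L * ((n1%:~R : R) - y) <= L * (1 - (L - 1) * (y - yb) / L).
    by rewrite ler_pM2l //; lra.
  have -> : L * (1 - (L - 1) * (y - yb) / L) = L - (L - 1) * (y - yb).
    by field; rewrite gt_eqF.
  have : L * (w - 4/3) > L * 2 by rewrite ltr_pM2l //; lra.
  lra.
case: i3 => m2 i3.
have inj := unimodular_inj D1.
exists (a * m + b * n + 0, c * m + d * n + 0), (a * (m + 1) + b * n + 0, c * (m + 1) + d * n + 0),
  (a * m2 + b * n2 + 0, c * m2 + d * n2 + 0); split.
- rewrite /= !inE !negb_or !andbT; apply/andP; split; first (apply/andP; split).
  + by apply/eqP => /inj[/eqP]; rewrite (negbTE (int_neq_succ m)).
  + by apply/eqP => /inj[_] e; move: nn; rewrite e eqxx.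
  + by apply/eqP => /inj[_] e; move: nn; rewrite e eqxx.
- by apply/(lat_ipull 0 0 D2).
- by apply/(lat_ipull 0 0 D2).
- by apply/(lat_ipull 0 0 D2).
Qed.

End Lines.

(** * A single interior lattice point *)

Section NormalForm.
Variable R : realType.
Implicit Types S : R -> R -> Prop.

Definition tight S := [/\ pbody S, lat S 0 0,
  forall m n, lat S m n -> m = 0 /\ n = 0 & wid S 3].

Lemma tight_ipull S (a b c d : int) : (a * d - b * c) ^+ 2 = 1 -> tight S ->
  tight (ipull S a b c d 0 0).
Proof.
move=> D1 [bS l0 u0 wS]; split.
- exact: pbody_ipull.
- by apply/lat_ipull; rewrite // !mulr0 !addr0.
- move=> m n /(lat_ipull 0 0 D1) /u0 []; rewrite !addr0 => e1 e2.
  have e5 : (a * d - b * c) * m = 0.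
    by transitivity (d * (a * m + b * n) - b * (c * m + d * n)); [ring|rewrite e1 e2; ring].
  have e6 : (a * d - b * c) * n = 0.
    by transitivity (a * (c * m + d * n) - c * (a * m + b * n)); [ring|rewrite e1 e2; ring].
  have e7 : a * d - b * c != 0 by apply/eqP => h; move: D1; rewrite h expr0n.
  by split; apply/eqP; [move/eqP: e5|move/eqP: e6]; rewrite mulf_eq0 (negbTE e7).
- exact: wid_ipull.
Qed.

(* The longest lattice chord is horizontal, from (p, c) to (p + L, c) with c > 0;
   a shear puts a point (z, -1) of S strictly between two lattice points. The
   three inequalities hold because longer chords at heights 1, -1 and -2 would
   contain an interior lattice point. *)
Definition normal_form S (p c L a b z : R) :=
  [/\ tight S, S p c /\ S (p + L) c,
    (exists tx, S tx a) /\ (exists bx, S bx (- b)),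
    (forall x y, S x y -> - b <= y /\ y <= a) /\ (S z (-1) /\ -1 < z < 0) &
    [/\ 9/4 <= L, 0 < c, 3 <= a + b & [/\ (L - 1) * a + c <= L,
      (L - 1) * b <= L + c & (L - 2) * b <= 2 * c]]].

(** Chords longer than 1 at heights 1 or -1 would contain an interior lattice point, and one longer
    than 2 at height 0 would contain two. Stated for [L], [a], [b], [c], these are the inequalities;
    the case of height 0 also excludes [c = 0]. *)
Lemma tight_chord S p c L tx a bx b : tight S -> S p c -> S (p + L) c ->
  S tx a -> S bx b -> b <= c -> c <= a -> 9/4 <= L -> 3 <= a - b ->
  [/\ c != 0, (L - 1) * a + c <= L, (L - 1) * - b <= L + c &
    0 < c -> (L - 2) * - b <= 2 * c].
Proof.
move=> [bS _ u0 _] s1 s2 s3 s4 bc ca L94 ab.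
have L1 : 1 < L by lra. have L2 : 2 < L by lra. have L0 : 0 < L by lra.
have no (n : int) : n != 0 -> L * (c - n%:~R) < (L - 1) * (c - b) ->
    L * (n%:~R - c) < (L - 1) * (a - c) -> False.
  move=> n0 h1 h2; have [m /u0[_ /eqP]] := line_one bS s1 s2 s3 s4 bc ca L1 h1 h2.
  by rewrite (negbTE n0).
have no2 : L * (c - 0) < (L - 2) * (c - b) -> L * (0 - c) < (L - 2) * (a - c) -> False.
  move=> h1 h2.
  have [m [/u0[e1 _] /u0[e2 _]]] := line_two (n := 0) bS s1 s2 s3 s4 bc ca L2 h1 h2.
  by rewrite e1 in e2.
have [n [h1 h2 _]] : exists n : int, [/\ L * (c - n%:~R) < (L - 1) * (c - b),
    L * (n%:~R - c) < (L - 1) * (a - c) & n%:~R <= c - (L - 1) * (c - b) / L + 1].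
  apply: (@int_between _ _ _ L 1) => //.
  have : 0 <= (L - 1) * (a - b - 3) by rewrite mulr_ge0 //; lra.
  lra.
have n0 : n = 0 by apply/eqP; apply/negPn/negP => /no; exact.
rewrite n0 in h1 h2 *; rewrite subr0 in h1; rewrite sub0r in h2.
have k1 : ~ L * (1 - c) < (L - 1) * (a - c) by move=> h; apply: (no 1) => //; lra.
have k2 : ~ L * (c + 1) < (L - 1) * (c - b).
  by move=> h; apply: (no (-1)); rewrite ?intrN //; lra.
move/negP: k1; move/negP: k2; rewrite -!leNgt => k2 k1.
have k3 : 0 <= (L - 2) * (a - c) by rewrite mulr_ge0 //; lra.
split; [|lra|lra|].
- apply/eqP => c0; apply: no2; rewrite c0.
    by have : 0 < (L - 2) * - b; [rewrite mulr_gt0 //; nra|rewrite ?subr0; lra].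
  rewrite subrr mulr0 mulr_gt0 ?subr0 //; first lra.
  by rewrite c0 in h2; nra.
- move=> c0; rewrite leNgt; apply/negP => h; apply: no2; rewrite ?subr0 ?sub0r; first lra.
  have : 0 < L * c by exact: mulr_gt0.
  lra.
Qed.

End NormalForm.

(** * Inequalities between the parameters of the normal form *)

Section NormalAlgebra.
Variable R : realFieldType.

(** Eliminating [a] and [b] leaves [(2 * L - 3) * (L - 2) <= L * c]. The bound [5/3] is reached at
    [L = 9/4], [c = 1/6]. *)
Lemma normal_bounds (L a b c : R) : 9/4 <= L -> 0 < c -> c <= a -> 3 <= a + b ->
  (L - 1) * a + c <= L -> (L - 1) * b <= L + c -> (L - 2) * b <= 2 * c ->
  [/\ L <= 3, c <= 1, 1 < b, a <= 5/3 & 2 * L - 3 + c <= (L - 1) * b].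
Proof.
move=> L94 c0 ca ab e1 e2 e3.
have k : 0 <= (L - 1) * (a + b - 3) by apply: mulr_ge0; lra.
have L3 : L <= 3 by lra.
have k2 : 2 * L - 3 + c <= (L - 1) * b by lra.
have c1 : c <= 1.
  have : 0 <= (L - 1) * (a - c) by apply: mulr_ge0; lra.
  nra.
have b1 : 1 < b by nra.
split=> //.
have cL : (2 * L - 3) * (L - 2) <= L * c.
  have : (L - 2) * (2 * L - 3 + c) <= (L - 1) * (2 * c) by nra.
  lra.
nra.
Qed.

(** The source of [5/6]: it is the value of [a * (3 - L) / (b + c)] at [L = 9/4], [c = 1/6],
    [a = 5/3], [b = 4/3]. *)
Lemma normal_top_alg (L a b c t be : R) : 9/4 <= L -> L <= 3 -> 0 < c -> c <= 1 -> 1 < b -> 0 < a ->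
  3 <= a + b ->
  (L - 1) * a + c <= L -> (L - 2) * b <= 2 * c ->
  L * (b - 1) <= (1 - t) * (b + c) -> be <= t * a -> be <= 5/6.
Proof.
move=> L94 L3 c0 c1 b1 a0 ab e1 e3 h1 h2.
have k0 : be * (b + c) <= a * (L + c - (L - 1) * b).
  have : 0 <= (t * a - be) * (b + c) by apply: mulr_ge0; lra.
  have : 0 <= a * ((1 - t) * (b + c) - L * (b - 1)) by apply: mulr_ge0; lra.
  lra.
have k1 : (L - 1) * (a + b - 3) >= 0 by apply: mulr_ge0; lra.
have k2 : L + c - (L - 1) * b <= 3 - L by lra.
have k3 : be * (b + c) <= a * (3 - L).
  have : 0 <= a * (3 - L - (L + c - (L - 1) * b)) by apply: mulr_ge0; lra.
  lra.
have cL : (2 * L - 3) * (L - 2) <= L * c.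
  have : 0 <= (L - 2) * ((L - 1) * b - (2 * L - 3 + c)) by apply: mulr_ge0; lra.
  have : 0 <= (L - 1) * (2 * c - (L - 2) * b) by apply: mulr_ge0; lra.
  lra.
clear h1 h2 k0 k1 k2 e3.
have k4 : a * (3 - L) <= 5/6 * (3 - a + c).
  suff : 0 <= (L - 1) * (15 + 5 * c - a * (23 - 6 * L)) by rewrite pmulr_rge0; lra.
  have k5 : 0 <= (23 - 6 * L) * (L - c - (L - 1) * a) by apply: mulr_ge0; lra.
  suff : 0 <= 6 * L ^+ 2 - 8 * L - 15 + (18 - L) * c by lra.
  suff : 0 <= L * (6 * L ^+ 2 - 8 * L - 15 + (18 - L) * c) by rewrite pmulr_rge0; lra.
  have : 0 <= (18 - L) * (L * c - (2 * L - 3) * (L - 2)) by apply: mulr_ge0; lra.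
  have : 0 <= (L - 9/4) * (4 * L * (L - 9/4) + 53 * L - 48) by apply: mulr_ge0; nra.
  lra.
rewrite leNgt; apply/negP => be56.
have : 5/6 * (b + c) < be * (b + c) by rewrite ltr_pM2r //; lra.
lra.
Qed.

Lemma normal_window_alg (L b c s : R) : 9/4 <= L -> L <= 3 -> 0 < c -> c <= 1 -> 1 < b ->
  2 * L - 3 + c <= (L - 1) * b -> b * (L - 2 + s * c) <= 2 * c -> s < 5/6.
Proof.
move=> L94 L3 c0 c1 b1 h1 h2; rewrite ltNge; apply/negP => s56.
have h3 : b * (L - 2 + 5/6 * c) <= 2 * c.
  apply: le_trans h2; rewrite ler_pM2l; last by lra.
  by rewrite lerD2l ler_pM2r.
have h4 : (2 * L - 3 + c) * (L - 2 + 5/6 * c) <= 2 * c * (L - 1).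
  have : 0 <= ((L - 1) * b - (2 * L - 3 + c)) * (L - 2 + 5/6 * c) by apply: mulr_ge0; lra.
  have : 0 <= (L - 1) * (2 * c - b * (L - 2 + 5/6 * c)) by apply: mulr_ge0; lra.
  lra.
have : 0 <= (L - 9/4) * (2 * L - 5/2 + 2/3 * c) by apply: mulr_ge0; lra.
(* At [L = 9/4] the defect in [h4] is [5/6 * c ^+ 2 - c + 3/8], which has its positive minimum at
   [c = 3/5]. *)
have := sqr_ge0 (c - 3/5).
lra.
Qed.

Lemma normal_bottom_alg (L b c t be : R) : 9/4 <= L -> 0 < c -> c <= 1 -> 1 < b ->
  be <= t * (b - 1) ->
  b * (L - 2 + t * (1 + c)) <= c * (2 + t * (b - 1)) -> be <= 5/6.
Proof.
move=> L94 c0 c1 b1 h1 h2.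
rewrite leNgt; apply/negP => be56.
have h3 : t * (b + c) <= 2 * c - (L - 2) * b by lra.
have h4 : 0 <= (b - 1) * (2 * c - (L - 2) * b - t * (b + c)) by apply: mulr_ge0; lra.
have h5 : 5/6 * (b + c) < t * (b - 1) * (b + c) by rewrite ltr_pM2r; lra.
have h6 : 5/6 * (b + c) < (b - 1) * (2 * c - (L - 2) * b) by lra.
have h7 : 0 <= (b - 1) * b * (L - 9/4) by apply: mulr_ge0; [apply: mulr_ge0|]; lra.
have h8 : 5/6 * (b + c) < (b - 1) * (2 * c - b / 4) by lra.
have q1 : 0 <= 3 * b ^+ 2 - 17 * b + 34 by have := sqr_ge0 (b - 17/6); lra.
have : 0 <= c * (3 * b ^+ 2 - 17 * b + 34) by apply: mulr_ge0; lra.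
have q2 : 0 <= b * (3 * (b - 1) + 10) by apply: mulr_ge0; lra.
have : 0 <= (1 - c) * (b * (3 * (b - 1) + 10)) by apply: mulr_ge0; lra.
lra.
Qed.

(* AM-GM for X = L u and Y = 6 v *)
Lemma wild_square (L u v : R) : 9/4 <= L -> 0 < L * u ->
  (L - 1) ^+ 2 * (2 * L - 3) <= u * v ->
  L * u + 6 * v = 49 * L - 13 * L ^+ 2 - 36 -> False.
Proof.
move=> L94 X0 h e.
have l0 : 0 <= (L - 9/4) * (13 * L - 79/4) by apply: mulr_ge0; lra.
have K1 : L * u + 6 * v <= 9 by lra.
have XY : 9/4 * 6 * (3/2 * (25/16)) <= (L * u) * (6 * v).
  have q1 : 5/4 * (5/4) <= (L - 1) ^+ 2 by rewrite expr2 ler_pM; lra.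
  have q2 : (5/4 * (5/4)) * (3/2) <= (L - 1) ^+ 2 * (2 * L - 3) by rewrite ler_pM; lra.
  have : 9/4 * (6 * (u * v)) <= L * (6 * (u * v)) by rewrite ler_wpM2r; lra.
  lra.
have Y0 : 0 < 6 * v.
  by rewrite -(pmulr_rgt0 _ X0); lra.
have := sqr_ge0 (L * u - 6 * v).
have : (L * u + 6 * v) ^+ 2 <= 9 ^+ 2 by rewrite ler_sqr ?nnegrE; lra.
lra.
Qed.

Lemma normal_wild_alg (L a b c x q : R) : 9/4 <= L -> L <= 3 -> 0 < c -> c <= 1 -> 1 < b -> 3 <= a + b ->
  (L - 1) * a + c <= L -> (L - 2) * b <= 2 * c -> 2 * L - 3 + c <= (L - 1) * b ->
  0 < x -> x <= a - 7/6 -> x + 1/6 <= q -> L * b * q <= (x + q) * (b + c) -> False.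
Proof.
move=> L94 L3 c0 c1 b1 ab e1 e3 e4 x0 xa xq h.
have h1 : b * ((L - 2) * x + (L - 1) / 6) <= (2 * x + 1/6) * c.
  have : 0 <= (b * (L - 1) - c) * (q - (x + 1/6)) by apply: mulr_ge0; lra.
  lra.
have h2 : (b * (L - 1) - c) / 6 <= (a - 7/6) * (2 * c - (L - 2) * b).
  have : 0 <= (a - 7/6 - x) * (2 * c - (L - 2) * b) by apply: mulr_ge0; lra.
  lra.
have h3 : 2 * L - 3 <= (6 * a - 7) * (2 * c - (L - 2) * b) by lra.
have h4 : (L - 1) * (2 * L - 3) <= (6 * (L - c) - 7 * (L - 1)) * (2 * c - (L - 2) * b).
  have : 0 <= (L - c - (L - 1) * a) * (2 * c - (L - 2) * b) by apply: mulr_ge0; lra.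
  have : 0 <= (L - 1) * ((6 * a - 7) * (2 * c - (L - 2) * b) - (2 * L - 3)) by apply: mulr_ge0; lra.
  lra.
clear x0 xa xq h h1 h2 h3 ab e1 b1 c0 c1 L3.
pose u := 7 - L - 6 * c.
have u0 : 0 < u.
  rewrite ltNge; apply/negP => un.
  have : 0 <= - u * (2 * c - (L - 2) * b) by apply: mulr_ge0; lra.
  have : 0 < (L - 1) * (2 * L - 3) by apply: mulr_gt0; lra.
  by rewrite /u; lra.
have h5 : (L - 1) ^+ 2 * (2 * L - 3) <= u * (2 * c * (L - 1) - (L - 2) * (2 * L - 3 + c)).
  have : 0 <= u * (L - 2) * ((L - 1) * b - (2 * L - 3 + c)).
    by apply: mulr_ge0; [apply: mulr_ge0|]; lra.
  have : 0 <= (L - 1) * ((6 * (L - c) - 7 * (L - 1)) * (2 * c - (L - 2) * b) - (L - 1) * (2 * L - 3)) by apply: mulr_ge0; lra.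
  rewrite /u; lra.
have h6 : u * (2 * c * (L - 1) - (L - 2) * (2 * L - 3 + c)) <= u * (L * c).
  rewrite ler_pM2l //.
  have : 0 <= (L - 2) * (2 * L - 3) by apply: mulr_ge0; lra.
  lra.
have h7 : (L - 1) ^+ 2 * (2 * L - 3) <= u * (L * c - (L - 2) * (2 * L - 3)) by lra.
(* With [v = L * c - (L - 2) * (2 * L - 3)], the weights [L] and 6 make [c] cancel in
   [L * u + 6 * v]. *)
apply: (wild_square L94 (mulr_gt0 _ u0) h7); [lra|rewrite /u; ring].
Qed.

End NormalAlgebra.

(** * Supporting lines of a body in normal form *)

Section Geometry.
Variable R : realType.
Implicit Types S : R -> R -> Prop.

(** A nonzero lattice point is not inner, so it has a supporting line. Since 0 is inner, the
    functional is positive at that point and can be scaled to 1 there. *)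
Lemma tight_line S (m n : int) : tight S -> m != 0 \/ n != 0 ->
  exists al be, al * m%:~R + be * n%:~R = 1 /\ forall x y, S x y -> al * x + be * y <= 1.
Proof.
move=> [[cS _ _ _] I0 u0 _] mn.
have nI : ~ inner S m%:~R n%:~R.
  by move=> /u0 [em en]; case: mn; rewrite ?em ?en eqxx.
have [a [b [ab h]]] := supp_not_inner cS I0 nI.
case: I0 => e e0 he.
set v := a * m%:~R + b * n%:~R in h.
have v0 : 0 < v.
  have k x y : `|x| <= e -> `|y| <= e -> a * x + b * y <= v.
    by move=> hx hy; apply: h; apply: he; rewrite subr0.
  have z0 : `|0 : R| <= e by rewrite normr0 ltW.
  have eE : `|e| <= e by rewrite gtr0_norm.
  have eN : `|- e| <= e by rewrite normrN gtr0_norm.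
  have k1 : `|a| * e <= v.
    have := k _ _ eE z0; have := k _ _ eN z0; rewrite !mulr0 !addr0 mulrN.
    by have [a0|a0] := leP 0 a; rewrite ?(ger0_norm a0) ?(ltr0_norm a0) ?mulNr.
  have k2 : `|b| * e <= v.
    have := k _ _ z0 eE; have := k _ _ z0 eN; rewrite !mulr0 !add0r mulrN.
    by have [b0|b0] := leP 0 b; rewrite ?(ger0_norm b0) ?(ltr0_norm b0) ?mulNr.
  case: ab => h0.
    by apply: lt_le_trans k1; rewrite mulr_gt0 // normr_gt0.
  by apply: lt_le_trans k2; rewrite mulr_gt0 // normr_gt0.
exists (a / v), (b / v); split.
  by rewrite !(mulrAC _ v^-1) -mulrDl divff // gt_eqF.
by move=> x y /h; rewrite !(mulrAC _ v^-1) -mulrDl ler_pdivrMr // mul1r.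
Qed.

Section Normal.
Variables (S : R -> R -> Prop) (p c L a b z : R).
Hypothesis N : normal_form S p c L a b z.

Lemma normal_ineq : [/\ [/\ 9/4 <= L, L <= 3, 0 < c, c <= 1 & c <= a],
  [/\ 1 < b, a <= 5/3 & 3 <= a + b] & [/\ (L - 1) * a + c <= L,
  (L - 1) * b <= L + c, (L - 2) * b <= 2 * c & 2 * L - 3 + c <= (L - 1) * b]].
Proof.
case: N => _ [s1 _] _ [bd _] [L94 c0 ab [e1 e2 e3]].
have [_ ca] := bd _ _ s1.
by have [] := normal_bounds L94 c0 ca ab e1 e2 e3; split.
Qed.

Lemma line01 : exists t, forall x y, S x y -> y <= 1 + t * x.
Proof.
case: N => tS _ _ _ _.
have [al [be [e h]]] := @tight_line S 0 1 tS (or_intror isT).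
rewrite mulr0 add0r mulr1 in e; exists (- al) => x y /h; rewrite e; lra.
Qed.

Lemma line10 : exists k, forall x y, S x y -> x <= 1 + k * y.
Proof.
case: N => tS _ _ _ _.
have [al [be [e h]]] := @tight_line S 1 0 tS (or_introl isT).
rewrite mulr0 addr0 mulr1 in e; exists (- be) => x y /h; rewrite e; lra.
Qed.

Lemma lineN10 : exists s, forall x y, S x y -> - x + s * y <= 1.
Proof.
case: N => tS _ _ _ _.
have [al [be [e h]]] := @tight_line S (-1) 0 tS (or_introl isT).
rewrite mulr0 addr0 intrN mulrN mulr1 in e; exists be => x y /h.
have -> : al = -1 by lra.
lra.
Qed.

(** For [s >= 1] the point [(z, -1)] with [z > -1] forces [s = 1], a horizontal line, but [S]
    reaches below height -1. *)
Lemma lineN1N1 : exists2 s, s < 1 & forall x y, S x y -> - x + s * (x - y) <= 1.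
Proof.
have [_ [b1 _ _] _] := normal_ineq.
case: N => tS _ [_ [bx Sb]] [_ [Sz /andP[z1 z0]]] _.
have [al [be [e h]]] := @tight_line S (-1) (-1) tS (or_introl isT).
rewrite intrN !mulrN !mulr1 in e.
have alE : al = - 1 - be by lra.
have h' x y : S x y -> - x + - be * (x - y) <= 1 by move=> /h; rewrite alE; lra.
exists (- be) => //; rewrite ltNge; apply/negP => s1.
have := h' _ _ Sz; have := h' _ _ Sb => k1 k2.
have : 0 <= (- be - 1) * (z + 1) by apply: mulr_ge0; lra.
have [e1|ne] := eqVneq (- be) 1; first by rewrite e1 in k1; lra.
have : 0 < (- be - 1) * (z + 1) by apply: mulr_gt0; [rewrite subr_gt0 lt_neqAle eq_sym ne|lra].
lra.
Qed.

(** The sign comes from [(z, -1)] with [z < 0]; [al = 0] is excluded because [b > 1]. *)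
Lemma line0N1 : exists2 al, 0 < al & forall x y, S x y -> al * x <= 1 + y.
Proof.
have [_ [b1 _ _] _] := normal_ineq.
case: N => tS _ [_ [bx Sb]] [_ [Sz /andP[z1 z0]]] _.
have [al [be [e h]]] := @tight_line S 0 (-1) tS (or_intror isT).
rewrite intrN mulr0 add0r mulrN mulr1 in e.
have beE : be = -1 by lra.
have h' x y : S x y -> al * x <= 1 + y by move=> /h; rewrite beE; lra.
exists al => //.
have := h' _ _ Sz => k1; have := h' _ _ Sb => k2.
have [al0|//|al0] := ltrgtP al 0.
  have : 0 < - al * - z by apply: mulr_gt0; lra.
  lra.
rewrite al0 in k2; lra.
Qed.

Lemma chord_below y : - b <= y -> y <= c ->
  exists x1 l, [/\ S x1 y, S (x1 + l) y & l * (b + c) = L * (y + b)].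
Proof.
have [[L94 _ c0 _ _] [b1 _ _] _] := normal_ineq.
case: N => [[[cS _ _ _] _ _ _] [s1 s2] [_ [bx Sb]] _ _] yb yc.
have bc : 0 < b + c by lra.
pose r := (c - y) / (b + c).
have rE : r * (b + c) = c - y by rewrite divfK // gt_eqF.
have r0 : 0 <= r by rewrite divr_ge0 ?(ltW bc) //; lra.
have r1 : r <= 1 by rewrite ler_pdivrMr // mul1r; lra.
have yE : (1 - r) * c + r * - b = y.
  by transitivity (c - r * (b + c)); [ring|rewrite rE; ring].
exists ((1 - r) * p + r * bx), ((1 - r) * L); split.
- by rewrite -yE; exact: cS.
- have -> : (1 - r) * p + r * bx + (1 - r) * L = (1 - r) * (p + L) + r * bx by ring.
  by rewrite -yE; exact: cS.
- transitivity (L * (b + c) - L * (r * (b + c))); first by ring.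
  by rewrite rE; ring.
Qed.

(** The lines at [(-1, 0)] and [(1, 0)] enclose the long chord, so [L - 2 + s * c <= k * c]. The
    point passing between [(-1, 0)] and [(-1, -1)] tilts the line at [(-1, -1)] so that the bottom
    point has [bx >= -1], which caps [k] by [2 / b]. *)
Lemma window_left x y : S x y -> -1 < y -> y < 0 -> x < -1 ->
  exists s, - 1 - x <= s * - y /\ b * (L - 2 + s * c) <= 2 * c.
Proof.
have [[L94 _ c0 _ _] [b1 _ _] _] := normal_ineq.
case: N => _ [s1 s2] [_ [bx Sb]] _ _ Sxy y1 y0 x1.
have [s hs] := lineN10; have [k hk] := line10; have [t t1 ht] := lineN1N1.
exists s; split; first by have := hs _ _ Sxy; lra.
have kc : L - 2 + s * c <= k * c by have := hs _ _ s1; have := hk _ _ s2; lra.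
have t0 : 0 < t.
  have := ht _ _ Sxy => h; rewrite ltNge; apply/negP => tn.
  have : 0 <= - t * (y - x) by apply: mulr_ge0; lra.
  lra.
have bx1 : -1 <= bx.
  have := ht _ _ Sb => h.
  have : 0 <= t * (b - 1) by apply: mulr_ge0; lra.
  rewrite leNgt => g; apply/negP => bx0.
  have : 0 < (1 - t) * (- 1 - bx) by apply: mulr_gt0; lra.
  lra.
have kb : k * b <= 2 by have := hk _ _ Sb; lra.
have : 0 <= b * (k * c - (L - 2 + s * c)) by apply: mulr_ge0; lra.
have : 0 <= c * (2 - k * b) by apply: mulr_ge0; lra.
lra.
Qed.

Lemma low_right x y : S x y -> y <= -1 -> y <= x.
Proof.
move=> Sxy y1; rewrite leNgt; apply/negP => xy.
have [t t1 ht] := lineN1N1; have := ht _ _ Sxy => h.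
have : 0 < (1 - t) * (y - x) by apply: mulr_gt0; lra.
lra.
Qed.

Lemma wild_left x y : S x y -> 7/6 <= y - x -> 0 <= y.
Proof.
have [[L94 L3 c0 c1 ca] [b1 a53 ab] [e1 e2 e3 e4]] := normal_ineq.
move=> Sxy h; rewrite leNgt; apply/negP => y0.
have [y1|y1] := leP y (-1); first by have := low_right Sxy y1; lra.
have x1 : x < -1 by lra.
have [s [h1 h2]] := window_left Sxy y1 y0 x1.
have := normal_window_alg L94 L3 c0 c1 b1 e4 h2 => s56.
have : 0 <= (1 - s) * - y by apply: mulr_ge0; lra.
lra.
Qed.

(** If [x > 0], the line at [(0, 1)] has slope [t > 0]. Together with the line at [(1, 0)] it limits
    the chord at height 0 to [1 + 1 / t], too short for the one inherited from the long chord. *)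
Lemma wild_top x y : S x y -> 7/6 <= y - x -> x <= 0.
Proof.
have [[L94 L3 c0 c1 ca] [b1 a53 ab] [e1 e2 e3 e4]] := normal_ineq.
move=> Sxy h; rewrite leNgt; apply/negP => x0.
case: (N) => _ _ _ [bd _] _; have [_ ya] := bd _ _ Sxy.
have [t ht] := line01; have [k hk] := line10.
have [x1 [l [t1 t2 le]]] := @chord_below 0 ltac:(lra) ltac:(lra).
rewrite add0r in le.
have k1 := ht _ _ Sxy; have k2 := ht _ _ t1; have k3 := hk _ _ t2.
rewrite mulr0 addr0 in k3.
have t0 : 0 < t by rewrite -(pmulr_lgt0 _ x0); lra.
(* [q = t * x] satisfies [q >= x + 1/6] because [x + 7/6 <= y <= 1 + t * x]. *)
apply: (@normal_wild_alg _ L a b c x (t * x)) => //; [lra|lra|].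
have bc : 0 <= b + c by lra.
have xl : 0 <= 1 - x1 - l by lra.
have : 0 <= x * t * (b + c) * (1 - x1 - l).
  by rewrite !mulr_ge0 ?(ltW x0) ?(ltW t0).
have : 0 <= x * (b + c) * (1 + t * x1).
  by rewrite !mulr_ge0 ?(ltW x0).
have -> : L * b * (t * x) = l * (b + c) * (t * x) by rewrite le; ring.
lra.
Qed.

End Normal.

(** The excess [- 1 - x] is bounded according to height. Above 0 the line at [(-1, 0)] must leave
    room for the chord at height -1; between -1 and 0 this is [window_left]; below -1 the line at
    [(-1, -1)] is played against the chord and the line at [(1, 0)]. *)
Lemma left_bound S p c L a b z x y : normal_form S p c L a b z -> S x y -> - x <= 11/6.
Proof.
move=> N.
have [[L94 L3 c0 c1 ca] [b1 a53 ab] [e1 e2 e3 e4]] := normal_ineq N.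
move=> Sxy; have a0 : 0 < a by move: c0 ca; clear; lra.
suff : - 1 - x <= 5/6 by clear; lra.
have [s hs] := lineN10 N.
case: (N) => _ [s1 s2] [_ [bx Sb]] [bd _] _.
have [yb ya] := bd _ _ Sxy.
have [y0|y0|y0] := ltrgtP y 0; last by move: (hs _ _ Sxy); rewrite y0; clear; lra.
- have [y1|y1|y1] := ltrgtP y (-1).
  + have [t t1 ht] := lineN1N1 N; have [k hk] := line10 N.
    have xy := low_right N Sxy (ltW y1).
    have [h|xm] := le_lt_cases (- x) (11/6); first by move: h; clear; lra.
    have h1 := ht _ _ Sxy.
    have xy' : y < x.
      rewrite lt_neqAle xy andbT; apply/eqP => e; rewrite e subrr mulr0 in h1.
      by move: h1 xm; clear; lra.
    have t0 : t < 0.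
      rewrite ltNge; apply/negP => tn.
      have : 0 <= t * (x - y) by rewrite mulr_ge0 // subr_ge0.
      by move: h1 xm; clear; lra.
    have t1' : 0 < 1 - t by rewrite subr_gt0.
    (* The line at [(-1, -1)] solved for [x] is [x >= -1 + r * (1 + y)]. *)
    have [r rE] : exists r, r * (1 - t) = - t.
      by exists (- t / (1 - t)); rewrite divfK // gt_eqF.
    apply: (@normal_bottom_alg _ L b c r) => //.
      rewrite -(ler_pM2r t1').
      have -> : r * (b - 1) * (1 - t) = r * (1 - t) * (b - 1) by ring.
      rewrite rE.
      have : 0 <= - t * (y + b).
        by apply: mulr_ge0; [move: t0|move: yb]; clear; lra.
      by move: h1; clear; lra.
    have h2 := ht _ _ s1; have h3 := hk _ _ s2; have h4 := hk _ _ Sb; have h5 := ht _ _ Sb.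
    have pl : -1 + r * (1 + c) <= p.
      rewrite -(ler_pM2r t1').
      have -> : (-1 + r * (1 + c)) * (1 - t) = (t - 1) + r * (1 - t) * (1 + c) by ring.
      by rewrite rE; move: h2; clear; lra.
    have bl : -1 + r - r * b <= bx.
      rewrite -(ler_pM2r t1').
      have -> : (-1 + r - r * b) * (1 - t) = (t - 1) + r * (1 - t) * (1 - b) by ring.
      by rewrite rE; move: h5; clear; lra.
    have : 0 <= b * (k * c - (L - 2 + r * (1 + c))).
      by apply: mulr_ge0; [move: b1|move: h3 pl]; clear; lra.
    have : 0 <= c * (2 + r * (b - 1) - k * b).
      by apply: mulr_ge0; [move: c0|move: h4 bl]; clear; lra.
    by clear; lra.
  + have [h|x1] := le_lt_cases (-1) x; first by move: h; clear; lra.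
    have [s' [h1 h2]] := window_left N Sxy y1 y0 x1.
    have s56 := normal_window_alg L94 L3 c0 c1 b1 e4 h2.
    have s0 : 0 < s'.
      by rewrite -(pmulr_lgt0 _ (_ : 0 < - y)); move: h1 x1 y0; clear; lra.
    have : 0 <= s' * (1 + y) by apply: mulr_ge0; [move: s0|move: y1]; clear; lra.
    by move: h1 s56; clear; lra.
  + have [t t1 ht] := lineN1N1 N; have := ht _ _ Sxy; rewrite y1 => h.
    have [h'|x1] := le_lt_cases (-1) x; first by move: h'; clear; lra.
    have : 0 < (1 - t) * (- 1 - x) by rewrite mulr_gt0 ?subr_gt0.
    by move: h; clear; lra.
- have yb1 : - b <= -1 by move: b1; clear; lra.
  have yc1 : -1 <= c by move: c0; clear; lra.
  have [x1 [l [t1 t2 le]]] := chord_below N yb1 yc1.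
  have [al al0 hal] := line0N1 N.
  have k1 : x1 + l <= 0.
    by have := hal _ _ t2; rewrite subrr pmulr_rle0.
  have k2 := hs _ _ t1; have k3 := hs _ _ Sxy.
  have [h'|x0] := le_lt_cases (- x) 1; first by move: h'; clear; lra.
  have s0 : 0 < - s by rewrite -(pmulr_lgt0 _ y0); move: k3 x0; clear; lra.
  apply: (@normal_top_alg _ L a b c (- s)) => //.
    have : 0 <= (1 + s - l) * (b + c).
      by apply: mulr_ge0; [move: k1 k2|move: b1 c0]; clear; lra.
    by move: le; clear; lra.
  have : 0 <= - s * (a - y) by apply: mulr_ge0; [exact: ltW|rewrite subr_ge0].
  by move: k3; clear; lra.
Qed.

(** The reflection [x -> y - x] fixes [u1 = y] and exchanges [u2 = - x] with [u3 = x - y], so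
    results for one side yield the other. *)
Lemma normal_refl S p c L a b z : normal_form S p c L a b z ->
  normal_form (ipull S (-1) 1 0 1 0 0) (c - p - L) c L a b (- 1 - z).
Proof.
move=> [tS [s1 s2] [[tx t1] [bx t2]] [bd [Sz /andP[z1 z0]]] ineq].
have E x y : ipull S (-1) 1 0 1 0 0 x y = S (y - x) y.
  by rewrite /ipull /apull; congr S; ring.
split=> //.
- exact: tight_ipull.
- rewrite !E; have -> : c - (c - p - L) = p + L by ring.
  by have -> : c - (c - p - L + L) = p by ring.
- split; first by exists (a - tx); rewrite E subKr.
  by exists (- b - bx); rewrite E subKr.
- split; first by move=> x y; rewrite E => /bd.
  by rewrite E subKr; split=> //; apply/andP; split; lra.
Qed.
End Geometry.

(** * From the normal form to the triangle *)

Section OnePoint.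
Variable R : realType.
Implicit Types S : R -> R -> Prop.

(** [(m, n)] and [(m', n')] are the functionals read as [a] and [b]; [(p, q)] and [(p', q')] form
    the dual basis. Hence [(p, q)] and [(p + p', q + q')] are the lattice points with [(a, b)] equal
    to [(1, 0)] and [(1, 1)]. *)
Lemma mk_side S T (p q p' q' m n m' n' : int) : tight S ->
  (forall a b c, T a b c <->
    a + b + c = 0 /\ S (p%:~R * a + p'%:~R * b) (q%:~R * a + q'%:~R * b)) ->
  [/\ p * m + p' * m' = 1, p * n + p' * n' = 0, q * m + q' * m' = 0 & q * n + q' * n' = 1] ->
  m * p + n * q = 1 /\ m * p' + n * q' = 0 -> m != 0 \/ n != 0 ->
  p != 0 \/ q != 0 -> p + p' != 0 \/ q + q' != 0 ->
  (forall a b c, T a b c -> a <= 11/6) ->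
  (forall a b c, T a b c -> a <= - (7/6) -> 0 <= b) -> side T.
Proof.
move=> tS HT [i1 i2 i3 i4] [j1 j2] mn pq pq' bd tame; split=> //.
- have [al [be [e h]]] := tight_line tS pq.
  exists (al * p'%:~R + be * q'%:~R) => a b c /HT[_ /h].
  have -> : al * (p%:~R * a + p'%:~R * b) + be * (q%:~R * a + q'%:~R * b) =
    (al * p%:~R + be * q%:~R) * a + (al * p'%:~R + be * q'%:~R) * b by ring.
  by rewrite e mul1r.
- have [al [be [e h]]] := tight_line tS pq'.
  exists (al * p%:~R + be * q%:~R) => a b c /HT[_ /h].
  rewrite !intrD in e.
  have -> : 1 - (al * p%:~R + be * q%:~R) = al * p'%:~R + be * q'%:~R by lra.
  have -> // : al * (p%:~R * a + p'%:~R * b) + be * (q%:~R * a + q'%:~R * b) =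
    (al * p%:~R + be * q%:~R) * a + (al * p'%:~R + be * q'%:~R) * b by ring.
- case: tS => [[_ _ mS _] _ _ wS].
  have [x [y [Sxy mx]]] := mS m%:~R n%:~R.
  have [x1 [y1 [x2 [y2 [S1 S2 h]]]]] := wS _ _ mn.
  have cast (u v : int) : u = v -> u%:~R = v%:~R :> R by move=> ->.
  have {}i1 := cast _ _ i1; have {}i2 := cast _ _ i2; have {}i3 := cast _ _ i3.
  have {}i4 := cast _ _ i4; have {}j1 := cast _ _ j1; have {}j2 := cast _ _ j2.
  rewrite !(intrD, intrM) in i1 i2 i3 i4 j1 j2.
  have E u v : S u v -> T (m%:~R * u + n%:~R * v) (m'%:~R * u + n'%:~R * v)
      (- (m%:~R * u + n%:~R * v) - (m'%:~R * u + n'%:~R * v)).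
    move=> Suv; apply/HT; split; first by ring.
    have -> : p%:~R * (m%:~R * u + n%:~R * v) + p'%:~R * (m'%:~R * u + n'%:~R * v) = u.
      transitivity ((p%:~R * m%:~R + p'%:~R * m'%:~R) * u + (p%:~R * n%:~R + p'%:~R * n'%:~R) * v); first by ring.
      by rewrite i1 i2; ring.
    have -> // : q%:~R * (m%:~R * u + n%:~R * v) + q'%:~R * (m'%:~R * u + n'%:~R * v) = v.
    transitivity ((q%:~R * m%:~R + q'%:~R * m'%:~R) * u + (q%:~R * n%:~R + q'%:~R * n'%:~R) * v); first by ring.
    by rewrite i3 i4; ring.
  exists (m%:~R * x + n%:~R * y), (m'%:~R * x + n'%:~R * y), (- (m%:~R * x + n%:~R * y) - (m'%:~R * x + n'%:~R * y)).
  exists (m%:~R * x2 + n%:~R * y2), (m'%:~R * x2 + n'%:~R * y2), (- (m%:~R * x2 + n%:~R * y2) - (m'%:~R * x2 + n'%:~R * y2)).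
  split; [exact: E|exact: E| |].
    have := mx _ _ S1; have {h} : 3 <= (m%:~R * x1 + n%:~R * y1) - (m%:~R * x2 + n%:~R * y2).
      by apply: le_trans h _; rewrite le_eqVlt; apply/orP; left; apply/eqP; ring.
    lra.
  move=> a b c /HT[_ /mx]; apply: le_trans; rewrite le_eqVlt; apply/orP; left; apply/eqP.
  transitivity ((m%:~R * p%:~R + n%:~R * q%:~R) * a + (m%:~R * p'%:~R + n%:~R * q'%:~R) * b); last by ring.
  by rewrite j1 j2; ring.
Qed.

Definition triple S : R -> R -> R -> Prop := fun a b c => a + b + c = 0 /\ S (- b) a.

Lemma frame_normal S p c L a b z : normal_form S p c L a b z -> frame (triple S).
Proof.
move=> N; have N' := normal_refl N; have tS : tight S by case: N.
have E x y : ipull S (-1) 1 0 1 0 0 x y = S (y - x) y.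
  by rewrite /ipull /apull; congr S; ring.
have up x y : S x y -> y <= 11/6.
  have [_ [_ a53 _] _] := normal_ineq N; case: N => _ _ _ [bd _] _.
  by move=> /bd[_]; lra.
have left x y : S x y -> - x <= 11/6 by exact: (left_bound N).
have right x y : S x y -> x - y <= 11/6.
  by move=> Sxy; have := @left_bound _ _ _ _ _ _ _ _ (y - x) y N'; rewrite E subKr opprB; exact.
have low1 x y : S x y -> y <= -1 -> y <= x by exact: (low_right N).
have low2 x y : S x y -> y <= -1 -> x <= 0.
  move=> Sxy h; have := @low_right _ _ _ _ _ _ _ _ N' (y - x) y; rewrite E subKr.
  by move=> /(_ Sxy h); lra.
have w1 x y : S x y -> 7/6 <= y - x -> 0 <= y by exact: (wild_left N).
have w2 x y : S x y -> 7/6 <= y - x -> x <= 0 by exact: (wild_top N).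
have w3 x y : S x y -> 7/6 <= x -> 0 <= y.
  by move=> Sxy h; have := @wild_left _ _ _ _ _ _ _ _ N' (y - x) y; rewrite E subKr; exact.
have w4 x y : S x y -> 7/6 <= x -> y <= x.
  move=> Sxy h; have := @wild_top _ _ _ _ _ _ _ _ N' (y - x) y; rewrite E subKr.
  by move=> /(_ Sxy h); lra.
have HT (T : R -> R -> R -> Prop) (p0 q0 p1 q1 : int) :
    (forall a b c, a + b + c = 0 -> T a b c <-> S (p0%:~R * a + p1%:~R * b) (q0%:~R * a + q1%:~R * b)) ->
    (forall a b c, T a b c -> a + b + c = 0) ->
    forall a b c, T a b c <->
    a + b + c = 0 /\ S (p0%:~R * a + p1%:~R * b) (q0%:~R * a + q1%:~R * b).
  by move=> h h0 a0 b0 c0; split=> [t|[s k]];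
    [split; [exact: h0 t|exact/(h _ _ _ (h0 _ _ _ t))]|exact/(h _ _ _ s)].
have S2 x y x' y' : x = x' -> y = y' -> S x y <-> S x' y' by move=> -> ->.
split; first by move=> x y u [].
- split.
  + apply: (@mk_side S _ 0 1 (-1) 0 0 1 (-1) 0) => //; try (by left); try (by right).
    * apply: HT => [x y u s|x y u []] //; rewrite /triple.
      by split=> [[_]|h]; [|split=> //; move: h]; apply S2; ring.
    * by move=> x y u [_ /up].
    * by move=> x y u [_ /low2] + h; move=> /(_ ltac:(lra)); lra.
  + apply: (@mk_side S _ 1 1 1 0 0 1 1 (-1)) => //; try (by left); try (by right).
    * apply: HT => [x y u s|x y u []]; rewrite /swap3 /triple; last by lra.
      by split=> [[_]|h]; [|split; [lra|move: h]]; apply S2; lra.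
    * by move=> x y u [_ /up].
    * by move=> x y u [s /low1] + h; move=> /(_ ltac:(lra)); lra.
- split.
  + apply: (@mk_side S _ (-1) (-1) 0 (-1) (-1) 0 1 (-1)) => //; try (by left); try (by right).
    * apply: HT => [x y u s|x y u []]; rewrite /rot3 /triple; last by lra.
      by split=> [[_]|h]; [|split; [lra|move: h]]; apply S2; lra.
    * by move=> x y u [_ /left]; lra.
    * by move=> x y u [s /w4] + h; move=> /(_ ltac:(lra)); lra.
  + apply: (@mk_side S _ (-1) 0 0 1 (-1) 0 0 1) => //; try (by left); try (by right).
    * apply: HT => [x y u s|x y u []]; rewrite /swap3 /rot3 /triple; last by lra.
      by split=> [[_]|h]; [|split; [lra|move: h]]; apply S2; lra.
    * by move=> x y u [_ /left]; lra.
    * by move=> x y u [s /w3] + h; move=> /(_ ltac:(lra)); lra.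
- split.
  + apply: (@mk_side S _ 1 0 1 1 1 (-1) 0 1) => //; try (by left); try (by right).
    * apply: HT => [x y u s|x y u []]; rewrite /rot3 /triple; last by lra.
      by split=> [[_]|h]; [|split; [lra|move: h]]; apply S2; lra.
    * by move=> x y u [s /right]; lra.
    * by move=> x y u [s /w1] + h; move=> /(_ ltac:(lra)); lra.
  + apply: (@mk_side S _ 0 (-1) (-1) (-1) 1 (-1) (-1) 0) => //; try (by left); try (by right).
    * apply: HT => [x y u s|x y u []]; rewrite /swap3 /rot3 /triple; last by lra.
      by split=> [[_]|h]; [|split; [lra|move: h]]; apply S2; lra.
    * by move=> x y u [s /right]; lra.
    * by move=> x y u [s /w2] + h; move=> /(_ ltac:(lra)); lra.
Qed.

Lemma triangle_hull S x1 y1 x2 y2 x3 y3 l m n : pconvex S -> S x1 y1 -> S x2 y2 -> S x3 y3 ->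
  0 <= l -> 0 <= m -> 0 <= n -> l + m + n = 1 ->
  S (l * x1 + m * x2 + n * x3) (l * y1 + m * y2 + n * y3).
Proof.
move=> cS s1 s2 s3 l0 m0 n0 s.
have [e|ne] := eqVneq l 1.
  have m00 : m = 0 by lra. have n00 : n = 0 by lra.
  by rewrite e m00 n00 !mul0r !addr0 !mul1r.
have u0 : 0 < m + n.
  rewrite lt_neqAle addr_ge0 // andbT eq_sym; apply: contra ne => /eqP e.
  by apply/eqP; lra.
have t0 : 0 <= n / (m + n) by rewrite divr_ge0 // ltW.
have t1 : n / (m + n) <= 1 by rewrite ler_pdivrMr // mul1r; lra.
have h0 : 0 <= m + n by exact: ltW.
have h1 : m + n <= 1 by lra.
have := cS _ _ _ _ _ s1 (cS _ _ _ _ _ s2 s3 t0 t1) h0 h1.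
have k v1 v2 v3 : (1 - (m + n)) * v1 + (m + n) * ((1 - n / (m + n)) * v2 + n / (m + n) * v3)
    = l * v1 + m * v2 + n * v3.
  have -> : l = 1 - (m + n) by lra.
  by field; rewrite gt_eqF.
by rewrite !k.
Qed.

(** In a triangle of lattice width 3, width at least 3 in the directions [(1, -1)], [(-1, 0)] and
    [(0, 1)] can only be attained at the vertices, so all three lie in [S]. *)
Lemma equi_normal S p c L a b z : normal_form S p c L a b z -> equi S.
Proof.
move=> N; have F := frame_normal N.
case: (N) => -[[cS _ _ _] _ _ wS] _ _ _ _.
have le x y : S x y -> [/\ y <= 1, - x <= 1 & x - y <= 1].
  move=> Sxy; have := frame_le F (a := y) (b := - x) (c := x - y).
  by apply; split; [ring|rewrite opprK].
have v1 : S (-1) 1.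
  have [x [y [x' [y' [s1 s2]]]]] := wS 1 (-1) (or_introl isT).
  rewrite intrN => h; have [k1 k2 k3] := le _ _ s1; have [k4 k5 k6] := le _ _ s2.
  have ex : x' = -1 by lra. have ey : y' = 1 by lra.
  by rewrite -ex -[in S _ _]ey.
have v2 : S 2 1.
  have [x [y [x' [y' [s1 s2]]]]] := wS (-1) 0 (or_introl isT).
  rewrite intrN => h; have [k1 k2 k3] := le _ _ s1; have [k4 k5 k6] := le _ _ s2.
  have ex : x' = 2 by lra. have ey : y' = 1 by lra.
  by rewrite -ex -[in S _ _]ey.
have v3 : S (-1) (-2).
  have [x [y [x' [y' [s1 s2]]]]] := wS 0 1 (or_intror isT).
  move=> h; have [k1 k2 k3] := le _ _ s1; have [k4 k5 k6] := le _ _ s2.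
  have ex : x' = -1 by lra. have ey : y' = -2 by lra.
  by rewrite -ex -[in S _ _]ey.
(* The coordinates [x + 1] and [1 - y], whose sum is [x - y + 2], turn the three bounds into
   [tri]. *)
exists 1, 0, 0, (-1), 1, 1; split=> // x y.
rewrite /ipull /apull /tri !mul0r !mul1r intrN addr0 add0r mulN1r.
split=> [/le[? ? ?]|[X0 Y0 XY]]; first by split; lra.
have l0 : 0 <= 1 - (x + 1) / 3 - (1 - y) / 3 by lra.
have m0 : 0 <= (x + 1) / 3 by lra.
have n0 : 0 <= (1 - y) / 3 by lra.
have s : 1 - (x + 1) / 3 - (1 - y) / 3 + (x + 1) / 3 + (1 - y) / 3 = 1 by lra.
have := triangle_hull cS v1 v2 v3 l0 m0 n0 s.
set X := (_ + _ + _); set Y := (_ + _ + _).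
have -> : X = x by rewrite /X; lra.
by have -> : Y = y by rewrite /Y; lra.
Qed.

Lemma tight_equi_pos S p c L : tight S -> S p c -> S (p + L) c -> 9/4 <= L -> 0 < c -> equi S.
Proof.
move=> tS s1 s2 L94 c0; case: (tS) => bS _ u0 wS.
have [tx [a [bx [b [s3 s4 ab bd]]]]] := vertical_ends bS wS.
have [bc ca] := bd _ _ s1.
have [_ e1 e2 e3] := tight_chord tS s1 s2 s3 s4 bc ca L94 ab.
have {}e3 := e3 c0.
have ab' : 3 <= a + - b by [].
have [_ _ b1 _ _] := normal_bounds L94 c0 ca ab' e1 e2 e3.
case: (bS) => cS _ _ _.
have L0 : 0 < L by lra.
have [||x1 [x2 [t1 t2 xx _ _]]] := @line_wide R S p c L tx a bx b 0 (-1) cS s1 s2 s3 s4 bc ca (lexx _) L0.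
- rewrite subr0 ltr_pM2l //; lra.
- rewrite subr0 ltr_pM2l //; lra.
(* The midpoint of a proper chord at height -1 is inner, hence not a lattice point. A shear by [k]
   moves it strictly between -1 and 0, as [normal_form] requires. *)
pose w := (x1 + x2) / 2.
have Sw : S w (-1).
  have h0 : 0 <= 2^-1 :> R by lra. have h1 : 2^-1 <= 1 :> R by lra.
  have := cS _ _ _ _ _ t1 t2 h0 h1.
  have -> : (1 - 2^-1) * x1 + 2^-1 * x2 = w by rewrite /w; lra.
  by have -> : (1 - 2^-1) * -1 + 2^-1 * -1 = -1 :> R by lra.
have nz (m : int) : w != m%:~R.
  apply/eqP => e; have : lat S m (-1).
    rewrite /lat -e intrN; apply: (line_inner bS t1 t2 _ _ s4 _ s3 _); rewrite /w; lra.
  by move=> /u0[].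
pose k := Num.floor w + 1.
have [k1 k2] : -1 < w - k%:~R /\ w - k%:~R < 0.
  have /andP[h1 h2] := floor_itv w; rewrite /k; rewrite !intrD in h2 *.
  split; last lra.
  have : (Num.floor w)%:~R < w by rewrite lt_neqAle h1 andbT eq_sym nz.
  lra.
have D1 : (1 * 1 - (- k) * 0) ^+ 2 = 1 :> int by rewrite mulr0 subr0 mulr1 expr1n.
have E x y : ipull S 1 (- k) 0 1 0 0 x y = S (x - k%:~R * y) y.
  by rewrite /ipull /apull intrN; congr S; ring.
apply: (equi_ipull (e := 0) (f := 0) D1).
apply: (@equi_normal _ (p + k%:~R * c) c L a (- b) (w - k%:~R)); split.
- exact: tight_ipull.
- rewrite !E addrK; split=> //.
  by have -> : p + k%:~R * c + L - k%:~R * c = p + L by ring.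
- split; first by exists (tx + k%:~R * a); rewrite E addrK.
  by exists (bx + k%:~R * b); rewrite E opprK addrK.
- split; first by move=> x y; rewrite E opprK => /bd.
  by rewrite E mulrN1 opprK subrK; split=> //; apply/andP.
- by split.
Qed.

Lemma tight_equi S : tight S -> equi S.
Proof.
move=> tS; case: (tS) => bS _ _ wS.
have p3 : 0 < 3 :> R by lra.
have [a [b [c [d [D1 [p [y [L [s1 s2 L0 L94]]]]]]]]] := chord_basis bS wS p3.
have D2 : (a * d - b * c) ^+ 2 = 1 by rewrite D1.
apply: (equi_ipull (e := 0) (f := 0) D2).
have {}L94 : 9/4 <= L by lra.
have := tight_ipull D2 tS; move: s1 s2; move: (ipull S a b c d 0 0) => S1 s1 s2 t1.
case: (t1) => b1 _ _ w1.
have [tx [u [bx [v [s3 s4 uv bd]]]]] := vertical_ends b1 w1.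
have [vy yu] := bd _ _ s1.
have [y0 _ _ _] := tight_chord t1 s1 s2 s3 s4 vy yu L94 uv.
have [yn|yp|e] := ltrgtP y 0; last by rewrite e eqxx in y0.
  have D3 : (1 * -1 - 0 * 0) ^+ 2 = 1 :> int by [].
  have E x' y' : ipull S1 1 0 0 (-1) 0 0 x' y' = S1 x' (- y').
    by rewrite /ipull /apull intrN; congr S1; ring.
  apply: (equi_ipull (e := 0) (f := 0) D3).
  apply: (@tight_equi_pos _ p (- y) L) => //; first exact: tight_ipull.
  - by rewrite E opprK.
  - by rewrite E opprK.
  - by rewrite oppr_gt0.
exact: tight_equi_pos s1 s2 L94 yp.
Qed.

End OnePoint.

(** * Halving along a parity class *)

Section Induction.
Variable R : realType.
Implicit Types S : R -> R -> Prop.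

Definition enumerates S (s : seq (int * int)) :=
  uniq s /\ forall m n, (m, n) \in s <-> lat S m n.

Lemma wid_le S v w : v <= w -> wid S w -> wid S v.
Proof.
move=> vw h m n /h[x [y [x' [y' [s1 s2 k]]]]]; exists x, y, x', y'; split=> //.
exact: le_trans k.
Qed.

Lemma equi_wid S w : equi S -> wid S w -> w <= 3.
Proof.
move=> [a [b [c [d [e [f [D h]]]]]]] wS.
have ab : a != 0 \/ b != 0.
  have [a0|] := eqVneq a 0; last by left.
  have [b0|] := eqVneq b 0; last by right.
  by move: D; rewrite a0 b0 !mul0r subrr expr0n.
have [x [y [x' [y' [/h[t1 t2 t3] /h[t4 t5 t6] k]]]]] := wS a b ab.
lra.
Qed.

Lemma equi_xmax S : equi S -> exists M : int,
  (exists y, S M%:~R y) /\ forall x y, S x y -> x <= M%:~R.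
Proof.
move=> [a [b [c [d [e [f [D h]]]]]]].
have [Dt DtE] : exists Dt, Dt = a * d - b * c by eexists.
have [A AE] : exists A, A = Dt * d by eexists.
have [B BE] : exists B, B = - (Dt * b) by eexists.
have [C CE] : exists C, C = - Dt * (d * e - b * f) by eexists.
have DD : (Dt%:~R * Dt%:~R = 1 :> R) by rewrite -intrM -expr2 DtE D.
have DE : (Dt%:~R = a%:~R * d%:~R - b%:~R * c%:~R :> R) by rewrite DtE intrB !intrM.
have xE (x y : R) : x = A%:~R * (a%:~R * x + b%:~R * y + e%:~R) +
    B%:~R * (c%:~R * x + d%:~R * y + f%:~R) + C%:~R.
  transitivity (Dt%:~R * Dt%:~R * x); first by rewrite DD mul1r.
  by rewrite AE BE CE !(intrM, intrN, intrB) DE; ring.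
have pt (X Y : R) : tri X Y -> exists y, S (A%:~R * X + B%:~R * Y + C%:~R) y.
  have [x [y [eX eY]]] := apull_onto e%:~R f%:~R (idet_neq0 R D) X Y.
  rewrite eX eY -xE => t; exists y; exact/h.
(* [x] is an integer affine function of the triangle coordinates; the signs tell at which of the
   integer vertices [(0, 0)], [(3, 0)], [(0, 3)] it is largest. *)
have [[A0 B0]|[[A0 AB]|[B0 AB]]] :
    (A <= 0 /\ B <= 0) \/ (0 <= A /\ B <= A) \/ (0 <= B /\ A <= B) by lia.
- exists C; split.
    by have := pt 0 0; rewrite !mulr0 !add0r; apply; split; lra.
  move=> x y /h[X0 Y0 XY]; rewrite (xE x y).
  rewrite -(ler_int R) in A0; rewrite -(ler_int R) in B0; move: X0 Y0 XY.
  set X := _ + _ + e%:~R; set Y := _ + _ + f%:~R => X0 Y0 XY.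
  have : 0 <= - A%:~R * X by apply: mulr_ge0; lra.
  have : 0 <= - B%:~R * Y by apply: mulr_ge0; lra.
  lra.
- exists (A * 3 + C); split.
    by have := pt 3 0; rewrite !mulr0 addr0 intrD intrM; apply; split; lra.
  move=> x y /h[X0 Y0 XY]; rewrite (xE x y) intrD intrM.
  rewrite -(ler_int R) in A0; rewrite -(ler_int R) in AB; move: X0 Y0 XY.
  set X := _ + _ + e%:~R; set Y := _ + _ + f%:~R => X0 Y0 XY.
  have : 0 <= A%:~R * (3 - X - Y) by apply: mulr_ge0; lra.
  have : 0 <= (A%:~R - B%:~R) * Y by apply: mulr_ge0; lra.
  lra.
- exists (B * 3 + C); split.
    by have := pt 0 3; rewrite !mulr0 add0r intrD intrM; apply; split; lra.
  move=> x y /h[X0 Y0 XY]; rewrite (xE x y) intrD intrM.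
  rewrite -(ler_int R) in B0; rewrite -(ler_int R) in AB; move: X0 Y0 XY.
  set X := _ + _ + e%:~R; set Y := _ + _ + f%:~R => X0 Y0 XY.
  have : 0 <= B%:~R * (3 - X - Y) by apply: mulr_ge0; lra.
  have : 0 <= (B%:~R - A%:~R) * X by apply: mulr_ge0; lra.
  lra.
Qed.

(** This is [(S - v) / 2]; its lattice points correspond to those of [S] congruent to [v] modulo
    2. *)
Definition half S (v : int * int) : R -> R -> Prop := apull S 2 0 0 2 v.1%:~R v.2%:~R.

Lemma det2 : 2 * 2 - 0 * 0 != 0 :> R.
Proof. by rewrite gt_eqF //; lra. Qed.

Lemma lat_half S v m n : lat (half S v) m n <-> lat S (2 * m + v.1) (2 * n + v.2).
Proof.
rewrite /lat (inner_apull _ _ det2) !mul0r addr0 add0r.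
by rewrite !intrD !intrM.
Qed.

Lemma wid_half S v w : wid S w -> wid (half S v) (w / 2).
Proof.
move=> wS m n /wS[x [y [x' [y' [s1 s2 h]]]]].
have E X Y : S X Y -> half S v ((X - v.1%:~R) / 2) ((Y - v.2%:~R) / 2).
  rewrite /half /apull.
  have -> : 2 * ((X - v.1%:~R) / 2) + 0 * ((Y - v.2%:~R) / 2) + v.1%:~R = X by field.
  by have -> : 0 * ((X - v.1%:~R) / 2) + 2 * ((Y - v.2%:~R) / 2) + v.2%:~R = Y by field.
exists ((x - v.1%:~R) / 2), ((y - v.2%:~R) / 2), ((x' - v.1%:~R) / 2), ((y' - v.2%:~R) / 2).
by split; [exact: E|exact: E|lra].
Qed.

(* The maximum of x on a copy of the triangle is an integer, while the two halves
   differ by the translation (1/2, 0). *)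
Lemma equi_half_no S : equi (half S (0, 0)) -> equi (half S (1, 0)) -> False.
Proof.
move=> /equi_xmax[M [[y My] mM]] /equi_xmax[N [[z Nz] mN]].
have E x t : half S (1, 0) x t = half S (0, 0) (x + 2^-1) t.
  by rewrite /half /apull /=; congr S; field.
have h1 := mM _ _ (eq_ind _ id Nz _ (E _ _)).
have h2 : M%:~R - 2^-1 <= N%:~R :> R.
  by apply: (mN _ y); rewrite E subrK.
have : (M%:~R = N%:~R + 2^-1 :> R) by lra.
move=> e; have : (2 * M = 2 * N + 1).
  by apply/eqP; rewrite -(eqr_int R) intrD !intrM e; apply/eqP; field.
lia.
Qed.

Definition even_at (v p : int * int) := (2 %| p.1 - v.1)%Z && (2 %| p.2 - v.2)%Z.

Definition halves (s : seq (int * int)) v :=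
  [seq (((p.1 - v.1) %/ 2)%Z, ((p.2 - v.2) %/ 2)%Z) | p <- s & even_at v p].

Lemma enumerates_half S s v : enumerates S s -> enumerates (half S v) (halves s v).
Proof.
move=> [us es]; split.
  rewrite map_inj_in_uniq ?filter_uniq // => -[p1 p2] [q1 q2].
  rewrite !mem_filter /even_at /= => /andP[/andP[a1 a2] _] /andP[/andP[a3 a4] _] [].
  by move=> e1 e2; congr pair; lia.
move=> m n; rewrite lat_half -es; split.
  move=> /mapP[[p1 p2]]; rewrite mem_filter /even_at /= => /andP[/andP[a1 a2] ps] [-> ->].
  suff [-> ->] : 2 * ((p1 - v.1) %/ 2)%Z + v.1 = p1 /\ 2 * ((p2 - v.2) %/ 2)%Z + v.2 = p2 by [].
  by lia.
move=> h; apply/mapP; exists (2 * m + v.1, 2 * n + v.2).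
  by rewrite mem_filter h /even_at /= !addrK !dvdz_mulr.
by rewrite /= !addrK !mulKz.
Qed.

Lemma size_halves s : (size s = size (halves s (0%R, 0%R)) + size (halves s (1%R, 0%R)) +
  size (halves s (0%R, 1%R)) + size (halves s (1%R, 1%R)))%N.
Proof.
rewrite /halves !size_map !size_filter; elim: s => //= -[p1 p2] s ->.
by rewrite /even_at /=; lia.
Qed.

Lemma size_ge3 (s : seq (int * int)) (p1 p2 p3 : int * int) :
  uniq [:: p1; p2; p3] -> p1 \in s -> p2 \in s -> p3 \in s -> (3 <= size s)%N.
Proof.
move=> u h1 h2 h3; apply: (uniq_leq_size u) => p.
by rewrite !inE => /or3P[] /eqP->.
Qed.

(* Some class of Z^2 modulo 2 contains at most a quarter of the interior lattice
   points; halving S at that class divides w by 2. *)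
Lemma width_bound n S s w : (size s <= n)%N -> pbody S -> enumerates S s -> (0 < size s)%N ->
  0 <= w -> wid S w ->
  w ^+ 2 <= 9 * (size s)%:R /\ (w ^+ 2 = 9 * (size s)%:R -> equi S).
Proof.
elim: n S s w => [|n IH] S s w sn bS eS s0 w0 wS; first by case: (size s) s0 sn.
have [s1|s1] := leqP (size s) 1.
  have {}s1 : size s = 1%N by apply/eqP; rewrite eqn_leq s1 s0.
  rewrite s1 mulr1.
  have [w3|w3] := ltP w 3.
    have lt9 : w ^+ 2 < 9 by nra.
    by split; [exact: ltW|move=> e; rewrite e ltxx in lt9].
  case: s s1 eS {sn s0} => [|[m0 n0] [|//]] // _ [_ es].
  have D1 : (1 * 1 - 0 * 0) ^+ 2 = 1 :> int by [].
  have tS : tight (ipull S 1 0 0 1 m0 n0).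
    split; first exact: pbody_ipull.
    - by apply/(lat_ipull m0 n0 D1); rewrite !mulr0 !add0r; apply/es; rewrite mem_head.
    - move=> m k /(lat_ipull m0 n0 D1)/es; rewrite inE.
      by move=> /eqP[] e1 e2; split; lia.
    - by apply: wid_ipull => //; exact: wid_le wS.
  have eqS : equi S by apply: (equi_ipull D1); exact: tight_equi tS.
  have wE : w = 3 by apply/eqP; rewrite eq_le w3 (equi_wid eqS wS).
  by split=> //; rewrite wE; lra.
have [s2|s2] := leqP (size s) 2.
  have {}s2 : size s = 2%N by apply/eqP; rewrite eqn_leq s2 s1.
  (* [w ^+ 2 >= 18] would give [w >= 21/5], hence a third interior lattice point. *)
  have lt18 : w ^+ 2 < 9 * (size s)%:R.
    rewrite s2 ltNge; apply/negP => h.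
    have w5 : 21/5 <= w by rewrite leNgt; apply/negP => h'; nra.
    have [p1 [p2 [p3 [u l1 l2 l3]]]] := three_points bS wS w5.
    case: eS => _ es.
    have mem (p : int * int) : lat S p.1 p.2 -> p \in s by case: p => p q /es.
    by have := size_ge3 u (mem _ l1) (mem _ l2) (mem _ l3); rewrite s2.
  by split; [exact: ltW|move=> e; rewrite e ltxx in lt18].
have bH v : pbody (half S v) by exact: (pbody_apull _ _ det2).
(* An empty class has no induction hypothesis; [flatness] gives [w <= 14/3], whose square is below
   [27 <= 9 * size s]. *)
have flat v : size (halves s v) = 0%N -> w ^+ 2 < 9 * (size s)%:R.
  move=> /eqP; rewrite size_eq0 => /eqP z.
  have w14 : w / 2 <= 7/3.
    rewrite leNgt; apply/negP => h.
    have [m [k]] := flatness (bH v) (wid_half v wS) h.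
    by case: (enumerates_half v eS) => _ <-; rewrite z.
  have : (3%:R : R) <= (size s)%:R by rewrite ler_nat.
  nra.
have bound v : (4 * size (halves s v) <= size s)%N -> w ^+ 2 <= 9 * (size s)%:R /\
    (w ^+ 2 = 9 * (size s)%:R -> (4 * size (halves s v))%N = size s /\ equi (half S v)).
  move=> h; have [z|nz] := posnP (size (halves s v)).
    have lt := flat _ z.
    by split; [exact: ltW|move=> e; rewrite e ltxx in lt].
  have sl : (size (halves s v) <= n)%N by lia.
  have w20 : 0 <= w / 2 by lra.
  have [k1 k2] := IH _ _ _ sl (bH v) (enumerates_half v eS) nz w20 (wid_half v wS).
  have hR : 4 * (size (halves s v))%:R <= (size s)%:R :> R by rewrite -natrM ler_nat.
  have w4 : (w / 2) ^+ 2 = w ^+ 2 / 4 by field.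
  rewrite w4 in k1 k2.
  split; first lra.
  move=> e; split; last by apply: k2; lra.
  by apply/eqP; rewrite -(eqr_nat R) natrM; apply/eqP; lra.
have sz := size_halves s.
have [v hv] : exists v, (4 * size (halves s v) <= size s)%N.
  have [h|h] := leqP (4 * size (halves s (0%R, 0%R))) (size s); first by eexists; exact: h.
  have [h1|h1] := leqP (4 * size (halves s (1%R, 0%R))) (size s); first by eexists; exact: h1.
  have [h2|h2] := leqP (4 * size (halves s (0%R, 1%R))) (size s); first by eexists; exact: h2.
  by exists (1, 1); lia.
have [k1 _] := bound v hv; split=> // e; exfalso.
have half_le v' : (4 * size (halves s v') <= size s)%N -> (4 * size (halves s v'))%N = size s.
  by move=> /bound[_ /(_ e)[]].
(* In the equality case no class lies below a quarter, and the four sizes add up to [size s]; so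
   each is exactly a quarter. *)
have h00 : (4 * size (halves s (0%R, 0%R)) <= size s)%N.
  have := half_le (1, 0); have := half_le (0, 1); have := half_le (1, 1); lia.
have h10 : (4 * size (halves s (1%R, 0%R)) <= size s)%N.
  have := half_le (0, 0); have := half_le (0, 1); have := half_le (1, 1); lia.
have [_ /(_ e)[_ q1]] := bound _ h00; have [_ /(_ e)[_ q2]] := bound _ h10.
exact: equi_half_no q1 q2.
Qed.

End Induction.

(** * Convex bodies of row vectors *)

Section Topology.
Variable R : realType.
Implicit Types K : set 'rV[R]_2.

Definition slice K : R -> R -> Prop := fun x y => K (point2 x y).

Lemma point2_0 (a b : R) : point2 a b 0 0 = a. Proof. by rewrite mxE. Qed.
Lemma point2_1 (a b : R) : point2 a b 0 1 = b. Proof. by rewrite mxE. Qed.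
Lemma point2K (x : 'rV[R]_2) : point2 (x 0 0) (x 0 1) = x.
Proof.
apply/rowP => i; rewrite mxE.
by case: i => -[|[|//]] ilt /=; congr (x _ _); apply/val_inj.
Qed.

Lemma dotp2 (u x : 'rV[R]_2) : dotp u x = u 0 0 * x 0 0 + u 0 1 * x 0 1.
Proof. by rewrite /dotp !big_ord_recl big_ord0 addr0; congr (_ + u _ _ * x _ _); apply/val_inj. Qed.

Lemma intv_point (z : 'rV[int]_2) : intv R z = point2 (z 0 0)%:~R (z 0 1)%:~R.
Proof. by rewrite -[LHS]point2K !mxE. Qed.

Lemma interior_slice K x y : interior K (point2 x y) <-> inner (slice K) x y.
Proof.
split.
  (* Library balls are open while [inner] uses closed squares, hence the radius [e / 2]. *)
  move=> /nbhs_ballP[e /= e0 h]; exists (e / 2); first by rewrite divr_gt0.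
  move=> x' y' hx hy; apply: h; split=> // i j; rewrite !mxE.
  have e2 : e / 2 < e by lra.
  by case: j => -[|[|//]] jlt /=; rewrite -ball_normE /= distrC; exact: le_lt_trans e2.
move=> [e e0 h]; apply/nbhs_ballP; exists e => //= z [_ hz].
rewrite -(point2K z); apply: h.
  by have := hz 0 0; rewrite point2_0 -ball_normE /= distrC => /ltW.
by have := hz 0 1; rewrite point2_1 -ball_normE /= distrC => /ltW.
Qed.

Lemma convE (x y : 'rV[R]_2) (t : {i01 R}) i :
  @conv R (convex_lmodType 'rV[R]_2) t x y 0 i = t%:num * x 0 i + (1 - t%:num) * y 0 i.
Proof. by rewrite !mxE. Qed.

Lemma pconvex_slice K : convex_set K -> pconvex (slice K).
Proof.
move=> cK x1 y1 x2 y2 t s1 s2 t0 t1.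
have := cK _ _ (Itv01 t0 t1) (mem_set s2) (mem_set s1).
rewrite inE /slice; congr K; apply/rowP => i.
rewrite convE !mxE.
by case: i => -[|[|//]] ilt; rewrite /= addrC.
Qed.

Lemma convex_slice K : pconvex (slice K) -> convex_set K.
Proof.
move=> cK x y t /set_mem Kx /set_mem Ky; apply/mem_set.
rewrite -(point2K x) in Kx; rewrite -(point2K y) in Ky.
have t0 : 0 <= t%:num by []. have t1 : t%:num <= 1 by [].
have := cK _ _ _ _ _ Ky Kx t0 t1.
rewrite /slice; congr K; apply/rowP => i.
rewrite convE mxE.
by case: i => -[|[|//]] ilt /=; rewrite addrC; congr (_ * x _ _ + _ * y _ _); apply/val_inj.
Qed.

Lemma continuous_comb (T : topologicalType) (u v : T -> R) (a b : R) :
  continuous u -> continuous v -> continuous (fun x => a * u x + b * v x).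
Proof.
move=> cu cv x; apply: (@continuousD _ _ _ (fun x => a * u x) (fun x => b * v x)).
  by apply: (@continuousM _ _ (fun => a) u); [exact: cst_continuous|exact: cu].
by apply: (@continuousM _ _ (fun => b) v); [exact: cst_continuous|exact: cv].
Qed.

Lemma continuous_lin (a b : R) : continuous (fun x : 'rV[R]_2 => a * x 0 0 + b * x 0 1).
Proof. by apply: continuous_comb; exact: coord_continuous. Qed.

Lemma compact_max (T : topologicalType) (f : T -> R) (A : set T) :
  A !=set0 -> compact A -> continuous f ->
  exists2 c, A c & forall t, A t -> f t <= f c.
Proof.
move=> A0 cA cf; have [c /set_mem Ac h] := compact_EVT_max A0 cA (continuous_subspaceT cf).
by exists c => // t /mem_set; exact: h.
Qed.

Lemma pbody_slice K : convex_body K -> (exists x y, inner (slice K) x y) -> pbody (slice K).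
Proof.
move=> [K0 cK vK] iK; split=> //.
- exact: pconvex_slice.
- move=> a b; have [c Kc h] := compact_max K0 cK (@continuous_lin a b).
  exists (c 0 0), (c 0 1); rewrite /slice point2K; split=> // x y /h.
  by rewrite point2_0 point2_1.
- move=> a b ab.
  have D0 : 0 < a ^+ 2 + b ^+ 2.
    rewrite lt_neqAle addr_ge0 ?sqr_ge0 // andbT eq_sym paddr_eq0 ?sqr_ge0 //.
    by rewrite !sqrf_eq0 negb_and; apply/orP.
  have cd i : continuous (fun P : 'rV[R]_2 * 'rV[R]_2 => P.2 0 i - P.1 0 i).
    move=> P; apply: (@continuousB _ _ _ (fun P : 'rV[R]_2 * 'rV[R]_2 => P.2 0 i)
      (fun P : 'rV[R]_2 * 'rV[R]_2 => P.1 0 i)).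
      apply: (@continuous_comp _ _ _ snd (fun x : 'rV[R]_2 => x 0 i)); first exact: cvg_snd.
      exact: coord_continuous.
    apply: (@continuous_comp _ _ _ fst (fun x : 'rV[R]_2 => x 0 i)); first exact: cvg_fst.
    exact: coord_continuous.
  pose g (P : 'rV[R]_2 * 'rV[R]_2) := b * (P.2 0 0 - P.1 0 0) + - a * (P.2 0 1 - P.1 0 1).
  pose f (P : 'rV[R]_2 * 'rV[R]_2) := a * (P.2 0 0 - P.1 0 0) + b * (P.2 0 1 - P.1 0 1).
  have cg : continuous g by apply: continuous_comb; exact: cd.
  have cf : continuous f by apply: continuous_comb; exact: cd.
  (* Pairs of points of [K] whose difference is parallel to [(a, b)]: a closed condition on a
     compact set, so the longest such chord exists. *)
  pose E := (K `*` K) `&` [set P | g P = 0].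
  have cE : compact E.
    apply: compact_closedI; first exact: compact_setX.
    apply: (@preimage_closed _ _ g [set r | r = 0]); last exact: closed_eq.
    by move=> P _; exact: cg.
  have E0 : E !=set0.
    by have [x Kx] := K0; exists (x, x); split=> //=; rewrite /g /= !subrr !mulr0 addr0.
  have [[P Q] [[/= KP KQ] gE] h] := compact_max E0 cE cf.
  have [l lE] : exists l, l * (a ^+ 2 + b ^+ 2) = f (P, Q).
    by exists (f (P, Q) / (a ^+ 2 + b ^+ 2)); rewrite divfK ?lt0r_neq0.
  exists (P 0 0), (P 0 1), l.
  have e1 : P 0 0 + l * a = Q 0 0.
    apply: (mulIf (lt0r_neq0 D0)).
    have -> : (P 0 0 + l * a) * (a ^+ 2 + b ^+ 2) =
        P 0 0 * (a ^+ 2 + b ^+ 2) + a * (l * (a ^+ 2 + b ^+ 2)) by ring.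
    have : b * (g (P, Q)) = 0 by rewrite gE mulr0.
    by rewrite lE /g /f /=; lra.
  have e2 : P 0 1 + l * b = Q 0 1.
    apply: (mulIf (lt0r_neq0 D0)).
    have -> : (P 0 1 + l * b) * (a ^+ 2 + b ^+ 2) =
        P 0 1 * (a ^+ 2 + b ^+ 2) + b * (l * (a ^+ 2 + b ^+ 2)) by ring.
    have : a * (g (P, Q)) = 0 by rewrite gE mulr0.
    by rewrite lE /g /f /=; lra.
  split; rewrite /slice ?e1 ?e2 ?point2K //.
  move=> x y m s1 s2; rewrite -(ler_pM2r D0) lE.
  have : E (point2 x y, point2 (x + m * a) (y + m * b)).
    by split=> //=; rewrite /g /= !point2_0 !point2_1; ring.
  move/h; apply: le_trans.
  by rewrite /f /= !point2_0 !point2_1 le_eqVlt; apply/orP; left; apply/eqP; ring.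
Qed.
End Topology.

(** * Lattice width and interior points in coordinates *)

Section Width.
Variable R : realType.
Implicit Types K : set 'rV[R]_2.

Lemma intv_interior K (z : 'rV[int]_2) : interior K (intv R z) <-> lat (slice K) (z 0 0) (z 0 1).
Proof. by rewrite intv_point; exact: interior_slice. Qed.

Definition zpoint (m n : int) : 'rV[int]_2 := \row_(j < 2) [:: m; n]`_j.
Lemma zpoint_0 m n : zpoint m n 0 0 = m. Proof. by rewrite mxE. Qed.
Lemma zpoint_1 m n : zpoint m n 0 1 = n. Proof. by rewrite mxE. Qed.
Lemma zpointK (z : 'rV[int]_2) : zpoint (z 0 0) (z 0 1) = z.
Proof.
apply/rowP => i; rewrite mxE.
by case: i => -[|[|//]] ilt /=; congr (z _ _); apply/val_inj.
Qed.

Lemma enumerates_slice K : (0 < interior_count K)%N ->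
  exists2 s, enumerates (slice K) s & size s = interior_count K.
Proof.
rewrite /interior_count; set A := [set z | _] => n0.
(* A positive count implies finiteness, because [fset_set] of an infinite set is empty. *)
have fA : finite_set A.
  by apply: contrapT => nA; move: n0; rewrite /fset_set; case: pselect => // _; rewrite cardfs0.
exists [seq (z 0 0, z 0 1) | z : 'rV[int]_2 <- fset_set A]; last by rewrite size_map.
split.
  rewrite map_inj_in_uniq ?fset_uniq // => y z _ _ [e0 e1].
  by rewrite -(zpointK y) -(zpointK z) e0 e1.
move=> m n; split.
  move=> /mapP[z]; rewrite in_fset_set // inE => /intv_interior + [-> ->].
  by [].
move=> mn; apply/mapP; exists (zpoint m n); last by rewrite zpoint_0 zpoint_1.
rewrite in_fset_set // inE; apply/intv_interior; by rewrite zpoint_0 zpoint_1.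
Qed.

Lemma interior_count1 K m n :
  (forall m' n', lat (slice K) m' n' <-> m' = m /\ n' = n) -> interior_count K = 1%N.
Proof.
move=> h; rewrite /interior_count.
rewrite (_ : [set z | _] = [set zpoint m n]) ?fset_set1 ?cardfs1 //.
apply/seteqP; split=> z /=.
  by move/intv_interior/h => [e0 e1]; rewrite -(zpointK z) e0 e1.
by move=> ->; apply/intv_interior/h; rewrite zpoint_0 zpoint_1.
Qed.

Lemma width_along_attained K u : convex_body K -> exists p q,
  [/\ K p, K q, width_along K u = dotp u p - dotp u q &
    forall x y, K x -> K y -> dotp u x - dotp u y <= width_along K u].
Proof.
move=> [K0 cK _].
have cu v : continuous (dotp v : 'rV[R]_2 -> R).
  rewrite (_ : dotp v = fun x => v 0 0 * x 0 0 + v 0 1 * x 0 1); last by apply/funext => x; exact: dotp2.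
  exact: continuous_lin.
have dN (v x : 'rV[R]_2) : dotp (- v) x = - dotp v x :> R by rewrite !dotp2 !mxE; ring.
have [p Kp hp] := compact_max K0 cK (cu u).
have [q Kq hq] := compact_max K0 cK (cu (- u)).
set A := [set dotp u x | x in K].
have A0 : A !=set0 by exists (dotp u p), p.
have Ap : ubound A (dotp u p) by move=> _ [x Kx <-]; exact: hp.
have Aq : lbound A (dotp u q) by move=> _ [x Kx <-]; move: (hq x Kx); rewrite !dN lerN2.
have sE : sup A = dotp u p.
  by apply/le_anti; rewrite ge_sup //= ub_le_sup //; [exists (dotp u p)|exists p].
have iE : inf A = dotp u q.
  by apply/le_anti; rewrite lb_le_inf // andbT ge_inf //; [exists (dotp u q)|exists q].
exists p, q; split=> //; rewrite /width_along -/A sE iE // => x y Kx Ky.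
have := hq y Ky; rewrite !dN lerN2; have := hp x Kx; lra.
Qed.

Let widths K := [set width_along K (intv R u) | u in [set u : 'rV[int]_2 | u != 0]].

Lemma width_along_ge0 K u : convex_body K -> 0 <= width_along K u.
Proof.
move=> cK; have [p [q [Kp Kq _ h]]] := width_along_attained u cK.
by have := h p p Kp Kp; rewrite subrr.
Qed.

Lemma widths_lb K : convex_body K -> lbound (widths K) 0.
Proof. by move=> cK _ [u _ <-]; exact: width_along_ge0. Qed.

Lemma widths_neq0 K : widths K !=set0.
Proof.
exists (width_along K (intv R (zpoint 1 0))), (zpoint 1 0) => //=.
by apply/eqP => /rowP /(_ 0); rewrite zpoint_0 mxE.
Qed.

Lemma lattice_width_ge0 K : convex_body K -> 0 <= lattice_width K.
Proof. by move=> cK; apply: lb_le_inf; [exact: widths_neq0|exact: widths_lb]. Qed.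

Lemma wid_lattice_width K : convex_body K -> wid (slice K) (lattice_width K).
Proof.
move=> cK m n mn.
have z0 : zpoint m n != 0.
  apply/eqP => z0; have := zpoint_0 m n; have := zpoint_1 m n.
  by rewrite z0 !mxE => n0 m0; move: mn; rewrite -m0 -n0 eqxx; case.
have [p [q [Kp Kq e _]]] := width_along_attained (intv R (zpoint m n)) cK.
exists (p 0 0), (p 0 1), (q 0 0), (q 0 1); rewrite /slice !point2K; split=> //.
have : lattice_width K <= width_along K (intv R (zpoint m n)).
  by apply: ge_inf; [exists 0; exact: widths_lb|exists (zpoint m n)].
rewrite e !dotp2 intv_point !point2_0 !point2_1 zpoint_0 zpoint_1; lra.
Qed.

Lemma wid_le_lattice_width K w : convex_body K -> wid (slice K) w -> w <= lattice_width K.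
Proof.
move=> cK wK; apply: lb_le_inf; first exact: widths_neq0.
move=> _ [u u0 <-].
have mn : u 0 0 != 0 \/ u 0 1 != 0.
  have [e0|] := eqVneq (u 0 0) 0; last by left.
  have [e1|] := eqVneq (u 0 1) 0; last by right.
  exfalso; move: u0 => /= /eqP; apply; apply/rowP => i; rewrite -(zpointK u) e0 e1 !mxE.
  by case: i => -[|[|//]].
have [x [y [x' [y' [s1 s2 h]]]]] := wK _ _ mn.
have [p [q [_ _ _ k]]] := width_along_attained (intv R u) cK.
have := k _ _ s1 s2.
rewrite !dotp2 intv_point !point2_0 !point2_1; lra.
Qed.
End Width.

(** * The triangle and its unimodular copies *)

Section Triangle.
Variable R : realType.
Implicit Types K : set 'rV[R]_2.
Local Notation T := (dilate 3 (Delta2 R)).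

Lemma pconvex_tri : pconvex (@tri R).
Proof.
move=> x1 y1 x2 y2 t [a1 b1 c1] [a2 b2 c2] t0 t1.
have u0 : 0 <= 1 - t by lra.
have := mulr_ge0 u0 a1; have := mulr_ge0 u0 b1; have := ler_wpM2l u0 c1.
have := mulr_ge0 t0 a2; have := mulr_ge0 t0 b2; have := ler_wpM2l t0 c2.
by move=> *; split; lra.
Qed.

Lemma slice_triangle x y : slice T x y <-> tri x y.
Proof.
split.
  have h : Delta2 R `<=` [set p | tri (3 * p 0 0) (3 * p 0 1)].
    apply: smallest_sub.
      apply: convex_slice => x1 y1 x2 y2 t; rewrite /slice /= !point2_0 !point2_1 => h1 h2 t0 t1.
      have := pconvex_tri h1 h2 t0 t1.
      by congr tri; ring.
    by move=> p /= [[]|] ->; rewrite point2_0 point2_1; split; lra.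
  move=> [p /h + e]; have := congr1 (fun v : 'rV[R]_2 => v 0 0) e.
  by have := congr1 (fun v : 'rV[R]_2 => v 0 1) e; rewrite point2_0 point2_1 !mxE => /= -> ->.
move=> [x0 y0 xy]; exists (point2 (x / 3) (y / 3)).
  move=> B [cB hB].
  have s1 : slice B 0 0 by apply: hB; left; left.
  have s2 : slice B 0 1 by apply: hB; left; right.
  have s3 : slice B 1 0 by apply: hB; right.
  have c0 : 0 <= 1 - y / 3 - x / 3 by lra.
  have y0' : 0 <= y / 3 by lra.
  have x0' : 0 <= x / 3 by lra.
  have sm : 1 - y / 3 - x / 3 + y / 3 + x / 3 = 1 by ring.
  have := triangle_hull (pconvex_slice cB) s1 s2 s3 c0 y0' x0' sm.
  by rewrite !mulr0 !mulr1 !add0r addr0.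
apply/rowP => i; rewrite !mxE.
by case: i => -[|[|//]] ilt /=; field.
Qed.

Lemma triangle_body : convex_body T.
Proof.
(* A box cut by a closed half-plane, which makes compactness immediate. *)
have TE : T = [set v | forall i, `[0, 3]%classic (v ord0 i)] `&`
    [set v | 1 * v 0 0 + 1 * v 0 1 <= 3].
  apply/seteqP; split=> v.
    rewrite -(point2K v) => /slice_triangle[a b c]; split=> [i|] /=; last first.
      by rewrite point2_0 point2_1; lra.
    rewrite in_itv /= mxE; case: i => -[|[|//]] ilt /=; apply/andP; split; lra.
  move=> [h /= k]; rewrite -(point2K v); apply/slice_triangle.
  have := h 0; have := h 1; rewrite /= !in_itv /= => /andP[a _] /andP[b _].
  by split=> //; lra.
split.
- by exists (point2 0 0); apply/slice_triangle; split; lra.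
- rewrite TE; apply: compact_closedI.
    by apply: (@rV_compact R 2 (fun=> `[0, 3]%classic)) => i; exact: segment_compact.
  apply: (@preimage_closed _ _ (fun v : 'rV[R]_2 => 1 * v 0 0 + 1 * v 0 1) [set r | r <= 3]).
    by move=> v _; exact: (@continuous_lin R 1 1).
  exact: closed_le.
- apply: convex_slice => x1 y1 x2 y2 t /slice_triangle h1 /slice_triangle h2 t0 t1.
  by apply/slice_triangle; exact: pconvex_tri.
Qed.

Lemma equi_triangle : equi (slice T).
Proof.
exists 1, 0, 0, 1, 0, 0; split=> // x y.
by rewrite slice_triangle /ipull /apull !mul1r !mul0r !addr0 add0r.
Qed.

Lemma wid_tri : wid (@tri R) 3.
Proof.
move=> m n mn.
have v1 : tri (0 : R) 0 by split; lra.
have v2 : tri (3 : R) 0 by split; lra.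
have v3 : tri (0 : R) 3 by split; lra.
have [m0|m0|m0] := ltgtP m 0.
- have : m%:~R <= -1 :> R by rewrite -[-1]/((-1)%:~R) ler_int; lia.
  by move=> h; exists 0, 0, 3, 0; split=> //; lra.
- have : 1 <= m%:~R :> R by rewrite -[1]/(1%:~R) ler_int; lia.
  by move=> h; exists 3, 0, 0, 0; split=> //; lra.
have [n0|n0|n0] := ltgtP n 0.
- have : n%:~R <= -1 :> R by rewrite -[-1]/((-1)%:~R) ler_int; lia.
  by move=> h; exists 0, 0, 0, 3; split=> //; lra.
- have : 1 <= n%:~R :> R by rewrite -[1]/(1%:~R) ler_int; lia.
  by move=> h; exists 0, 3, 0, 0; split=> //; lra.
by move: mn; rewrite m0 n0 eqxx; case.
Qed.

Lemma lat_tri m n : lat (@tri R) m n <-> m = 1 /\ n = 1.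
Proof.
split.
  move=> [e e0 h].
  have e1 : `|- e| <= e by rewrite normrN gtr0_norm.
  have e2 : `|e| <= e by rewrite gtr0_norm.
  have [||a b _] := h (m%:~R - e) (n%:~R - e); rewrite 1?addrAC ?subrr ?add0r //.
  have [||_ _ c] := h (m%:~R + e) (n%:~R + e); rewrite 1?addrAC ?subrr ?add0r //.
  have m0 : 0 < m by rewrite -(ltr_int R); lra.
  have n0 : 0 < n by rewrite -(ltr_int R); lra.
  have mn : m + n < 3 by rewrite -(ltr_int R) intrD; lra.
  by split; lia.
move=> [-> ->]; exists (1/2); first by lra.
by move=> x y; rewrite !ler_norml => /andP[a b] /andP[c d]; split; lra.
Qed.

Lemma equi_ext S : equi S -> exists a b c d e f : int,
  (a * d - b * c) ^+ 2 = 1 /\ S = ipull (@tri R) a b c d e f.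
Proof.
move=> [a [b [c [d [e [f [D h]]]]]]]; exists a, b, c, d, e, f; split=> //.
by apply/funext => x; apply/funext => y; apply/propext.
Qed.

Lemma equi_lattice_width K : convex_body K -> equi (slice K) -> lattice_width K = 3.
Proof.
move=> cK eK; apply/le_anti; rewrite (equi_wid eK (wid_lattice_width cK)) /=.
apply: wid_le_lattice_width => //.
have [a [b [c [d [e [f [D ->]]]]]]] := equi_ext eK.
exact: wid_ipull wid_tri.
Qed.

Lemma equi_interior_count K : equi (slice K) -> interior_count K = 1%N.
Proof.
move=> /equi_ext[a [b [c [d [e [f [D h]]]]]]].
apply: (@interior_count1 _ K ((a * d - b * c) * (d * (1 - e) - b * (1 - f)))
  ((a * d - b * c) * (a * (1 - f) - c * (1 - e)))) => m n.
rewrite h (lat_ipull _ _ D) lat_tri; split.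
  move=> [h1 h2].
  have -> : 1 - e = a * m + b * n by move: h1; clear; lia.
  have -> : 1 - f = c * m + d * n by move: h2; clear; lia.
  split.
    transitivity ((a * d - b * c) ^+ 2 * m); [by rewrite D mul1r|ring].
  transitivity ((a * d - b * c) ^+ 2 * n); [by rewrite D mul1r|ring].
move=> [-> ->]; split.
  transitivity ((a * d - b * c) ^+ 2 * (1 - e) + e); [ring|by rewrite D; ring].
transitivity ((a * d - b * c) ^+ 2 * (1 - f) + f); [ring|by rewrite D; ring].
Qed.
End Triangle.

(** * Unimodular equivalence as an integer pullback *)

Section Unimodular.
Variable R : realType.
Implicit Types K : set 'rV[R]_2.
Local Notation T := (dilate 3 (Delta2 R)).

Lemma mulmx22 (A B : 'M[int]_2) i j : (A *m B) i j = A i 0 * B 0 j + A i 1 * B 1 j.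
Proof.
rewrite mxE !big_ord_recl big_ord0 addr0.
by congr (_ + A _ _ * B _ _); apply/val_inj.
Qed.

Lemma mulmx12 (p : 'rV[R]_2) (U : 'M[int]_2) i :
  (p *m (map_mx intr U)^T) 0 i = p 0 0 * (U i 0)%:~R + p 0 1 * (U i 1)%:~R.
Proof.
rewrite mxE !big_ord_recl big_ord0 addr0 !mxE.
by congr (_ + p _ _ * (U _ _)%:~R); apply/val_inj.
Qed.

Lemma slice_image (U : 'M[int]_2) (t : 'rV[int]_2) X Y :
  slice [set x *m (map_mx intr U)^T + intv R t | x in T] X Y <-> exists x y,
  [/\ tri x y, (U 0 0)%:~R * x + (U 0 1)%:~R * y + (t 0 0)%:~R = X &
    (U 1 0)%:~R * x + (U 1 1)%:~R * y + (t 0 1)%:~R = Y].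
Proof.
split.
  move=> [v + e]; rewrite -(point2K v) => /slice_triangle h; exists (v 0 0), (v 0 1).
  split=> //; [rewrite -(point2_0 X Y)|rewrite -(point2_1 X Y)];
    by rewrite -e mxE mulmx12 mxE; ring.
move=> [x [y [/slice_triangle h <- <-]]]; exists (point2 x y) => //.
rewrite -[LHS]point2K; congr point2; rewrite mxE mulmx12 point2_0 point2_1 [in LHS]mxE; ring.
Qed.

Section Inverse.
Variables (p q r s a b c d : int).
Hypotheses (e00 : a * p + b * r = 1) (e01 : a * q + b * s = 0).
Hypotheses (e10 : c * p + d * r = 0) (e11 : c * q + d * s = 1).

Lemma det_inverse : (p * s - q * r) * (a * d - b * c) = 1.
Proof.
transitivity ((a * p + b * r) * (c * q + d * s) - (a * q + b * s) * (c * p + d * r)); first ring.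
by rewrite e00 e01 e10 e11.
Qed.

Lemma sqr_det_inverse : (a * d - b * c) ^+ 2 = 1.
Proof. by have /intUnitRing.unitzPl := det_inverse; rewrite qualifE => /orP[] /eqP ->. Qed.

End Inverse.

Lemma inverse_comb (p q r s a b m n : int) (f g x y : R) :
  a * p + b * r = m -> a * q + b * s = n ->
  a%:~R * (p%:~R * x + q%:~R * y + f) + b%:~R * (r%:~R * x + s%:~R * y + g)
    - (a%:~R * f + b%:~R * g) = m%:~R * x + n%:~R * y.
Proof. by move=> <- <-; rewrite !intrD !intrM; ring. Qed.

Lemma comb_inverse (p q a b c d m n : int) (f g X Y : R) :
  p * a + q * c = m -> p * b + q * d = n ->
  p%:~R * (a%:~R * X + b%:~R * Y - (a%:~R * f + b%:~R * g)) +
  q%:~R * (c%:~R * X + d%:~R * Y - (c%:~R * f + d%:~R * g))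
    = m%:~R * (X - f) + n%:~R * (Y - g).
Proof. by move=> <- <-; rewrite !intrD !intrM; ring. Qed.

Lemma slice_image_tri (U V : 'M[int]_2) (t : 'rV[int]_2) X Y :
  V *m U = 1%:M ->
  slice [set x *m (map_mx intr U)^T + intv R t | x in T] X Y <->
  ipull (@tri R) (V 0 0) (V 0 1) (V 1 0) (V 1 1)
    (- (V 0 0 * t 0 0 + V 0 1 * t 0 1)) (- (V 1 0 * t 0 0 + V 1 1 * t 0 1)) X Y.
Proof.
move=> VU; have UV := mulmx1C VU.
have VU' i j := congr1 (fun M : 'M[int]_2 => M i j) VU.
have UV' i j := congr1 (fun M : 'M[int]_2 => M i j) UV.
have := VU' 0 0; have := VU' 0 1; have := VU' 1 0; have := VU' 1 1.
have := UV' 0 0; have := UV' 0 1; have := UV' 1 0; have := UV' 1 1.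
rewrite slice_image {VU' UV'} !mulmx22 !mxE /= => u11 u10 u01 u00 v11 v10 v01 v00.
rewrite /ipull /apull !intrN !intrD !intrM; split.
  move=> [x [y [h <- <-]]].
  by rewrite (inverse_comb _ _ _ _ v00 v01) (inverse_comb _ _ _ _ v10 v11) !mul1r !mul0r addr0 add0r.
move=> h; eexists; eexists; split; first exact: h.
  by rewrite (comb_inverse _ _ _ _ u00 u01) mul1r mul0r addr0 subrK.
by rewrite (comb_inverse _ _ _ _ u10 u11) mul1r mul0r add0r subrK.
Qed.

Lemma unimodular_equivP K : unimodular_equiv K T <-> equi (slice K).
Proof.
split.
  move=> [U [t [Uu ->]]].
  have VU : invmx U *m U = 1%:M by exact: mulVmx.
  have VU' i j := congr1 (fun M : 'M[int]_2 => M i j) VU.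
  have := VU' 0 0; have := VU' 0 1; have := VU' 1 0; have := VU' 1 1.
  rewrite {VU'} !mulmx22 !mxE /= => v11 v10 v01 v00.
  (* The first four integers are the entries of [invmx U], fixed by unification; the translation is
     fixed by [slice_image_tri]. *)
  do 6 eexists; split; first exact: sqr_det_inverse v00 v01 v10 v11.
  by move=> x y; exact: slice_image_tri.
move=> [a [b [c [d [e [f [D h]]]]]]].
have [D' DE] : exists D', D' = a * d - b * c by eexists.
have DD : D' * D' = 1 by rewrite -expr2 DE.
pose V : 'M[int]_2 := \matrix_(i, j) [:: [:: a; b]`_j; [:: c; d]`_j]`_i.
(* The inverse of [V]: its adjugate times [D'], since [D'] is its own inverse. *)
pose U : 'M[int]_2 := \matrix_(i, j) [:: [:: D' * d; - D' * b]`_j; [:: - D' * c; D' * a]`_j]`_i.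
pose t := zpoint (D' * (b * f - d * e)) (D' * (c * e - a * f)).
have VU : V *m U = 1%:M.
  apply/matrixP => i j; rewrite mulmx22 !mxE.
  by case: i => -[|[|//]] ilt; case: j => -[|[|//]] jlt /=;
    [transitivity (D' * (a * d - b * c)); [ring|rewrite -DE DD] | ring | ring |
     transitivity (D' * (a * d - b * c)); [ring|rewrite -DE DD]].
have [_ Uu] := mulmx1_unit VU.
exists U, t; split=> //; apply/seteqP.
have k x y : slice K x y <-> slice [set x *m (map_mx intr U)^T + intv R t | x in T] x y.
  rewrite h (slice_image_tri _ _ _ VU) !mxE /=.
  have -> : - (a * (D' * (b * f - d * e)) + b * (D' * (c * e - a * f))) = e.
    transitivity (D' * (a * d - b * c) * e); [ring|by rewrite -DE DD mul1r].
  have -> // : - (c * (D' * (b * f - d * e)) + d * (D' * (c * e - a * f))) = f.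
  transitivity (D' * (a * d - b * c) * f); [ring|by rewrite -DE DD mul1r].
by split=> v; rewrite -(point2K v) => /k.
Qed.
End Unimodular.

Theorem corollary1p2 (R : realType) (K : set 'rV[R]_2)
    (K_body : convex_body K) (K_int : (0 < interior_count K)%N) :
  lattice_width K / Num.sqrt (interior_count K)%:R
    <= lattice_width (dilate 3 (Delta2 R))
       / Num.sqrt (interior_count (dilate 3 (Delta2 R)))%:R
  /\ (lattice_width K / Num.sqrt (interior_count K)%:R
        = lattice_width (dilate 3 (Delta2 R))
          / Num.sqrt (interior_count (dilate 3 (Delta2 R)))%:R
      <-> unimodular_equiv K (dilate 3 (Delta2 R))).
Proof.
rewrite unimodular_equivP (equi_interior_count (equi_triangle R)).
rewrite (equi_lattice_width (triangle_body R) (equi_triangle R)) sqrtr1 divr1.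
have [s es se] := enumerates_slice K_int.
have s0 : (0 < size s)%N by rewrite se.
have iK : exists x y, inner (slice K) x y.
  case: (s) es s0 => // -[m n] s' [_ e] _.
  by exists m%:~R, n%:~R; apply/e; rewrite mem_head.
have w0 := lattice_width_ge0 K_body.
have [wle weq] := width_bound (leqnn _) (pbody_slice K_body iK) es s0 w0
  (wid_lattice_width K_body).
rewrite se in wle weq.
have n0 : 0 < (interior_count K)%:R :> R by rewrite ltr0n.
have q0 : 0 < Num.sqrt (interior_count K)%:R :> R by rewrite sqrtr_gt0.
(* After clearing the denominator and squaring, the inequality compares [w ^+ 2] with [9 * G], the
   form of [width_bound]. *)
have qq : (3 * Num.sqrt (interior_count K)%:R) ^+ 2 = 9 * (interior_count K)%:R :> R.
  by rewrite exprMn sqr_sqrtr ?ltW // -natrX.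
have t0 : 0 <= 3 * Num.sqrt (interior_count K)%:R :> R by rewrite mulr_ge0 // ltW.
split.
  by rewrite ler_pdivrMr // -(ler_pXn2r (ltn0Sn 1)) ?nnegrE // qq.
split=> [e|eK].
  by apply: weq; rewrite -qq -e divfK // lt0r_neq0.
by rewrite (equi_lattice_width K_body eK) (equi_interior_count eK) sqrtr1 divr1.
Qed.
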